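(* Let $d\ge 1$ and $\boldsymbol{\alpha}\in\mathbb{N}^d$. The generalized zeta function $$Z_{2\boldsymbol{\alpha}}(s) := \sum_{\boldsymbol{n}\in\mathbb{Z}^d\setminus\{\boldsymbol{0}\}} \frac{\boldsymbol{n}^{2\boldsymbol{\alpha}}}{|\boldsymbol{n}|^s},\qquad \mathrm{Re}(s) > d+2|\boldsymbol{\alpha}|_1,$$ has a meromorphic continuation to the whole complex plane $\mathbb{C}$ whose only pole is a simple pole at $s=d+2|\boldsymbol{\alpha}|_1$, and it satisfies the functional equation $$\begin{aligned}\frac{\Gamma(s/2)}{\pi^{s/2}} Z_{2\boldsymbol{\alpha}}(s) &= \left(-\frac{1}{4\pi}\right)^{|\boldsymbol{\alpha}|_1} \frac{2H_{2\boldsymbol{\alpha}}(\boldsymbol{0})}{s-d-2|\boldsymbol{\alpha}|_1} - \frac{2\delta_{\boldsymbol{0},\boldsymbol{\alpha}}}{s} + \sum_{\boldsymbol{n}\in\mathbb{Z}^d\setminus\{\boldsymbol{0}\}} \boldsymbol{n}^{2\boldsymbol{\alpha}}\int_1^\infty e^{-|\boldsymbol{n}|^2\pi t}\, t^{\frac{s}{2}-1}\,\mathrm{d}t \\ &\quad + \left(-\frac{1}{4\pi}\right)^{|\boldsymbol{\alpha}|_1}\sum_{\boldsymbol{k}\in\mathbb{Z}^d\setminus\{\boldsymbol{0}\}} \int_1^\infty e^{-|\boldsymbol{k}|^2\pi t}\, H_{2\boldsymbol{\alpha}}(\sqrt{\pi t}\,\boldsymbol{k})\, t^{\frac{d+2|\boldsymbol{\alpha}|_1-s}{2}-1}\,\mathrm{d}t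 .\end{aligned}$$
   Context: $\mathbb{N}$ includes $0$. For $\boldsymbol{x}\in\mathbb{R}^d$ and a multi-index $\boldsymbol{\gamma}\in\mathbb{N}^d$: $\boldsymbol{x}^{\boldsymbol{\gamma}}=\prod_j x_j^{\gamma_j}$ (with $0^0=1$), $|\boldsymbol{x}|$ is the Euclidean norm, $|\boldsymbol{\gamma}|_1=\sum_j\gamma_j$. $\delta_{\boldsymbol{0},\boldsymbol{\alpha}}=1$ if $\boldsymbol{\alpha}=\boldsymbol{0}$ and $0$ otherwise. The multivariate Hermite polynomial is $H_{\boldsymbol{\gamma}}(\boldsymbol{x}) := (-1)^{|\boldsymbol{\gamma}|_1} e^{|\boldsymbol{x}|^2}\,\partial_{\boldsymbol{x}}^{\boldsymbol{\gamma}}\big(e^{-|\boldsymbol{x}|^2}\big)$. $\Gamma$ is the Gamma function. The functional equation is an identity of meromorphic functions on $\mathbb{C}$. *)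

(* Defs.v *)
From HB Require Import structures.
From mathcomp Require Import all_boot all_order all_algebra.
From mathcomp Require Import finmap complex.
From mathcomp Require Import all_classical all_reals all_analysis.
From mathcomp Require summability.

Set Implicit Arguments.
Unset Strict Implicit.
Unset Printing Implicit Defensive.

Import Order.TTheory GRing.Theory Num.Theory numFieldNormedType.Exports.

Local Open Scope classical_set_scope.
Local Open Scope ring_scope.
Local Open Scope complex_scope.

(* R[i] carries its topology and its normed structure over itself through the
   alias (R[i])^o; derivability over the scalar field R[i] is complex
   differentiability. *)

Section ComplexAnalysis.
Variable R : realType.
Implicit Types (f : R[i] -> R[i]) (z : R[i]).

Definition holomorphic_at f z : Prop :=
  \forall w \near (z : (R[i])^o), derivable (f : (R[i])^o -> (R[i])^o) w 1.

Definition pole_of_order f z (m : nat) : Prop :=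
  (0 < m)%N /\
  exists g : R[i] -> R[i], [/\ holomorphic_at g z, g z != 0 &
    \forall w \near (z : (R[i])^o)^', f w = g w / (w - z) ^+ m].

Definition is_pole f z : Prop := exists m, pole_of_order f z m.

(* Values of f at its poles are irrelevant; everywhere else f has to be
   holomorphic, so that removable singularities are filled in. *)
Definition meromorphic f : Prop :=
  forall z, holomorphic_at f z \/ is_pole f z.

Definition cexp z : R[i] :=
  (expR (complex.Re z))%:C * (cos (complex.Im z) +i* sin (complex.Im z)).

(* t ^ z for t > 0 *)
Definition rpowC (t : R) z : R[i] := cexp (z * (ln t)%:C).

Definition cintegrable (D : set R) (f : R -> R[i]) : Prop :=
  (lebesgue_measure : measure _ R).-integrable D
    (fun t => (complex.Re (f t))%:E) /\
  (lebesgue_measure : measure _ R).-integrable D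
    (fun t => (complex.Im (f t))%:E).

Definition cintegral (D : set R) (f : R -> R[i]) : R[i] :=
  (\int[lebesgue_measure]_(t in D) complex.Re (f t)) +i*
  (\int[lebesgue_measure]_(t in D) complex.Im (f t)).

(* Series over an unordered index set are limits of the sums over finite
   subsets ordered by inclusion (unconditional, hence absolute, convergence). *)
Definition has_csum (I : choiceType) (P : pred I) (f : I -> R[i]) z : Prop :=
  (fun A : {fset I} => \sum_(i <- A | P i) f i) @ summability.totally
    --> (z : (R[i])^o).

Definition csummable (I : choiceType) (P : pred I) (f : I -> R[i]) : Prop :=
  exists z, has_csum P f z.

Definition csum (I : choiceType) (P : pred I) (f : I -> R[i]) : R[i] :=
  xget 0 [set z | has_csum P f z].

Definition Euler_integral z : R[i] :=
  cintegral `]0, +oo[ (fun t => (expR (- t))%:C * rpowC t (z - 1)).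

(* Euler's integral when Re z > 0, extended to the other half-plane by
   Gamma (z + n) = z (z + 1) ... (z + n - 1) Gamma z, with n the least natural
   number such that Re z + n > 0.  The value at a pole is junk. *)
Definition Gamma z : R[i] :=
  let n := Num.truncn (1 - complex.Re z) in
  Euler_integral (z + n%:R) / \prod_(k < n) (z + k%:R).

Definition Gamma_pole z : Prop := exists m : nat, z = - m%:R.

End ComplexAnalysis.

Section Lattice.
Variables (R : realType) (d : nat).
Implicit Types (gamma : 'rV[nat]_d) (x : 'rV[R]_d).

Definition norm1 gamma : nat := (\sum_(j < d) gamma 0%R j)%N.

Definition monomial gamma x : R := \prod_(j < d) x 0 j ^+ gamma 0 j.

(* Euclidean norm: the norm of the library on 'rV[R]_d is the sup norm. *)
Definition enorm x : R := Num.sqrt (\sum_(j < d) x 0 j ^+ 2).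

Definition partial_derive gamma (f : 'rV[R]_d -> R) : 'rV[R]_d -> R :=
  foldr (fun (j : 'I_d) (g : 'rV[R]_d -> R) =>
           iter (gamma 0 j) (fun h : 'rV[R]_d -> R => 'D_(delta_mx 0 j) h) g)
        f (enum 'I_d).

Definition Hermite gamma x : R :=
  (- 1) ^+ norm1 gamma * expR (enorm x ^+ 2) *
  partial_derive gamma (fun y => expR (- enorm y ^+ 2)) x.

Definition vecR (n : 'rV[int]_d) : 'rV[R]_d := map_mx intr n.

Definition zeta_term gamma (s : R[i]) (n : 'rV[int]_d) : R[i] :=
  (monomial gamma (vecR n))%:C / rpowC (enorm (vecR n)) s.

Definition gen_zeta gamma (s : R[i]) : R[i] :=
  csum (fun n : 'rV[int]_d => n != 0) (zeta_term gamma s).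

End Lattice.
Arguments vecR R {d} n.

(* Main.v *)
Require Import Defs.
From HB Require Import structures.
From mathcomp Require Import all_boot all_order all_algebra.
From mathcomp Require Import finmap complex ring lra.
From mathcomp Require Import all_classical all_reals all_analysis.
From mathcomp Require Import measurable_realfun.
From mathcomp Require summability.

(** The proof is Riemann's: the zeta series is the Mellin transform of a theta
series, and the inversion formula of the theta series folds the integral over
the half-line onto [1, +oo[, where everything converges for every s.

Let theta (t) be the sum of n^(2 alpha) exp (- pi |n|^2 t) over the lattice and
dual (t) the sum of H_(2 alpha) (sqrt (pi t) n) exp (- pi |n|^2 t).  Both are
products over the coordinates of one-dimensional series, and
  theta (1/t) = (- 1/(4 pi))^|alpha| t^(d/2 + |alpha|) dual (t)   ([ltheta_inv]).
In dimension one, weight 0, this is Jacobi's identity.  It is obtained here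
without Fourier analysis, by Polya's argument: summing cos^(2m) over the
multiples of pi / l gives a finite identity between powers of cosines and
binomial coefficients ([cos_pow_binomial_duality]); when m and l tend to
infinity with l^2 ~ tau m, both sides are theta series in the limit, by
dominated convergence, up to a factor that does not depend on the regime and
that the self-dual value tau = pi determines ([jacobi_theta]).
Differentiating the identity with respect to t raises the weight by one and
produces on the dual side polynomials that obey the recurrence of the Hermite
polynomials of even order ([theta_inversion], [Hermite_even]).

Write omega and omega_dual for the two series without their terms at 0.  They
decay exponentially on [1, +oo[, so that their Mellin transforms on this
half-line exist and are holomorphic on the whole plane ([is_derive_mellin]), and
they may be computed term by term ([omega_csum_1y], [omega_dual_csum_1y]): these
are the two series of integrals of the functional equation.  For
Re s > d + 2 |alpha| the transform of omega on ]0, +oo[ also exists; term by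
term it gives Gamma (s/2) pi^(-s/2) times the zeta series ([zeta_csum]), while
the substitution t -> 1/t on ]0, 1] and the inversion formula give the right
hand side of the functional equation ([mellin_omega_split]); the two polar
terms come from the terms at 0.

Dividing by Gamma (s/2) defines the continuation.  Since 1/Gamma is entire
([cdiff_Gamma_inv]) and (2/s) / Gamma (s/2) = 1/Gamma (s/2 + 1), the polar term
at s = 0 disappears and only s = d + 2 |alpha| remains; the pole is there
because H_(2 alpha) (0), 1/Gamma and the powers of pi do not vanish at this
point.  The functional equation itself needs Gamma (s/2) <> 0.  Euler's integral
has no zeros: a zero z would propagate to all z + m, but for large m the measure
exp (- t) t^(Re z + m - 1) dt is so concentrated around its mode that the
oscillating factor t^(i Im z) cannot annihilate its mass
([Euler_integral_neq0]). *)

Set Implicit Arguments.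
Unset Strict Implicit.
Unset Printing Implicit Defensive.
Import Order.TTheory GRing.Theory Num.Theory numFieldNormedType.Exports.
Local Open Scope classical_set_scope.
Local Open Scope ring_scope.

(** * Unconditional sums of real families *)

Section Sums.
Variables (R : realType) (I : choiceType).
Implicit Types (f g u v : I -> R) (A B : {fset I}) (S U : R).

(** Unconditional convergence over an arbitrary index type, with explicit epsilons:
a form in which sums over nat, int and the lattice are compared directly. *)
Definition has_rsum f S := forall e : R, 0 < e ->
  exists A0 : {fset I}, forall A, (A0 `<=` A)%fset ->
    `|S - \sum_(i <- A) f i| < e.

Lemma fset_sumD f A B : (A `<=` B)%fset ->
  \sum_(i <- B) f i = \sum_(i <- A) f i + \sum_(i <- (B `\` A)%fset) f i.
Proof.
move=> /fsubsetP AB; rewrite (big_fsetID _ (mem A)) /=; congr (_ + _).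
  suff -> : [fset x in B | x \in A]%fset = A by [].
  by apply/fsetP => x; rewrite !inE /=; case: (boolP (x \in A)) => [/AB ->|]; rewrite ?andbF.
suff -> : [fset x in B | x \notin A]%fset = (B `\` A)%fset by [].
by apply/fsetP => x; rewrite !inE /= andbC.
Qed.

Lemma fset_sum_le u A B : (forall i, 0 <= u i) -> (A `<=` B)%fset ->
  \sum_(i <- A) u i <= \sum_(i <- B) u i.
Proof. by move=> u0 AB; rewrite (fset_sumD _ AB) lerDl sumr_ge0. Qed.

Lemma has_rsum_uniq f S U : has_rsum f S -> has_rsum f U -> S = U.
Proof.
move=> fS fU; apply/eqP/negPn/negP => SU.
have e0 : 0 < `|S - U| / 2 by rewrite divr_gt0// normr_gt0 subr_eq0.
have [A1 h1] := fS _ e0; have [A2 h2] := fU _ e0.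
have {}h1 := h1 _ (fsubsetUl A1 A2); have {}h2 := h2 _ (fsubsetUr A1 A2).
rewrite distrC in h2.
by have := le_lt_trans (ler_distD _ S U) (ltrD h1 h2); rewrite -splitr ltxx.
Qed.

Lemma eq_has_rsum f g S : f =1 g -> has_rsum f S -> has_rsum g S.
Proof. by move=> /funext ->. Qed.

Lemma has_rsumD f g S U : has_rsum f S -> has_rsum g U ->
  has_rsum (fun i => f i + g i) (S + U).
Proof.
move=> fS gU e e0; have e20 : 0 < e / 2 by rewrite divr_gt0.
have [A1 h1] := fS _ e20; have [A2 h2] := gU _ e20.
exists (A1 `|` A2)%fset => A; rewrite fsubUset => /andP[/h1{}h1 /h2{}h2].
rewrite big_split/= opprD addrACA (splitr e).
by rewrite (le_lt_trans (ler_normD _ _))// ltrD.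
Qed.

Lemma has_rsumZ (c : R) f S : has_rsum f S -> has_rsum (fun i => c * f i) (c * S).
Proof.
move=> fS e e0; have c0 : 0 < `|c| + 1 by rewrite ltr_wpDl.
have [A1 h1] := fS (e / (`|c| + 1)) (divr_gt0 e0 c0).
exists A1 => A /h1{}h1; rewrite -mulr_sumr -mulrBr normrM.
rewrite (@le_lt_trans _ _ ((`|c| + 1) * `|S - \sum_(i <- A) f i|))//.
  by rewrite ler_wpM2r// lerDl.
by rewrite mulrC -ltr_pdivlMr.
Qed.

Lemma has_rsumN f S : has_rsum f S -> has_rsum (fun i => - f i) (- S).
Proof. by move=> /(@has_rsumZ (-1)); rewrite mulN1r; apply: eq_has_rsum => i; rewrite mulN1r. Qed.

Lemma has_rsumB f g S U : has_rsum f S -> has_rsum g U ->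
  has_rsum (fun i => f i - g i) (S - U).
Proof. by move=> fS /has_rsumN; apply: has_rsumD. Qed.

Lemma has_rsum0 : has_rsum (fun=> 0) 0.
Proof. by move=> e e0; exists fset0 => A _; rewrite big1// subr0 normr0. Qed.

Lemma has_rsum_sum n (f : 'I_n -> I -> R) (S : 'I_n -> R) :
  (forall k, has_rsum (f k) (S k)) ->
  has_rsum (fun i => \sum_(k < n) f k i) (\sum_(k < n) S k).
Proof.
elim: n f S => [|n IH] f S h.
  by rewrite big_ord0; apply: eq_has_rsum has_rsum0 => i; rewrite big_ord0.
rewrite big_ord_recr; apply: (@eq_has_rsum
  (fun i => \sum_(k < n) f (widen_ord (leqnSn n) k) i + f ord_max i)).
  by move=> i; rewrite big_ord_recr.
by apply: has_rsumD => //; apply: IH.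
Qed.

Lemma has_rsum_fin f A : (forall i, i \notin A -> f i = 0) ->
  has_rsum f (\sum_(i <- A) f i).
Proof.
move=> fA e e0; exists A => B AB; rewrite (big_fset_incl _ AB) ?subrr ?normr0//.
by move=> x _; apply: fA.
Qed.

Lemma has_rsum_partial u U A : (forall i, 0 <= u i) -> has_rsum u U ->
  \sum_(i <- A) u i <= U.
Proof.
move=> u0 uU; apply/ler_addgt0Pr => e e0; have [A1 h1] := uU _ e0.
have := h1 _ (fsubsetUr A A1); rewrite ltr_norml => /andP[+ _].
rewrite ltrBrDl ltrBlDr => /ltW; apply: le_trans.
exact: fset_sum_le (fsubsetUl _ _).
Qed.

Lemma has_rsum_ge0 u U : (forall i, 0 <= u i) -> has_rsum u U -> 0 <= U.
Proof. by move=> u0 /(has_rsum_partial fset0 u0); rewrite big_seq_fset0. Qed.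

Lemma has_rsum_bounded u (M : R) : (forall i, 0 <= u i) ->
  (forall A, \sum_(i <- A) u i <= M) -> exists U, has_rsum u U.
Proof.
move=> u0 uM; pose E := [set x | exists A, x = \sum_(i <- A) u i].
have supE : has_sup E.
  split; first by exists (\sum_(i <- fset0) u i); exists fset0.
  by exists M => _ [A ->].
exists (sup E) => e e0; have [_ [A ->] eA] := sup_adherent e0 supE.
exists A => B AB; rewrite ger0_norm.
  by rewrite ltrBlDl -ltrBlDr (lt_le_trans eA)// fset_sum_le.
by rewrite subr_ge0 ub_le_sup//; [exact: supE.2|exists B].
Qed.

Lemma has_rsum_le f g S U : (forall i, f i <= g i) ->
  has_rsum f S -> has_rsum g U -> S <= U.
Proof.
move=> fg fS gU; rewrite -subr_ge0.
have := @has_rsum_partial (fun i => g i - f i) _ fset0 _ (has_rsumB gU fS).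
by rewrite big_seq_fset0; apply => i; rewrite subr_ge0.
Qed.

Lemma has_rsum_dom u U v : has_rsum u U -> (forall i, `|v i| <= u i) ->
  exists V, has_rsum v V.
Proof.
move=> uU vu; have u0 i : 0 <= u i by apply: le_trans (vu i).
have [W hW] : exists W, has_rsum (fun i => u i + v i) W.
  apply: (@has_rsum_bounded _ (2 * U)) => [i|A].
    by have := vu i; rewrite ler_norml => /andP[+ _]; rewrite -subr_ge0 opprK addrC.
  rewrite mulr_natl mulr2n big_split/= lerD ?(has_rsum_partial _ u0)//.
  rewrite (le_trans _ (has_rsum_partial A u0 uU))//.
  by apply: ler_sum => i _; rewrite (le_trans (ler_norm _)).
exists (W - U); apply: eq_has_rsum (has_rsumB hW uU) => i /=.
by rewrite addrAC subrr add0r.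
Qed.

Lemma has_rsum_tail u U v V A : has_rsum u U -> (forall i, `|v i| <= u i) ->
  has_rsum v V -> `|V - \sum_(i <- A) v i| <= U - \sum_(i <- A) u i.
Proof.
move=> uU vu vV; apply/ler_addgt0Pr => e e0.
have [A1 h1] := vV _ e0; have {h1} := h1 _ (fsubsetUr A A1).
set B := (A `|` A1)%fset => h1; have AB : (A `<=` B)%fset by apply: fsubsetUl.
have u0 i : 0 <= u i by apply: le_trans (vu i).
rewrite (fset_sumD v AB) opprD addrA in h1.
rewrite -[leLHS](subrK (`|\sum_(i <- (B `\` A)%fset) v i|)) addrC lerD ?(ltW (le_lt_trans (lerB_dist _ _) h1))//.
rewrite (le_trans (ler_norm_sum _ _ _))//.
rewrite (le_trans (ler_sum _ (fun i _ => vu i)))//.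
rewrite lerBrDl (le_trans _ (has_rsum_partial B u0 uU))//.
by rewrite (fset_sumD u AB).
Qed.

Lemma has_rsum_norm_le u U v V : has_rsum u U -> (forall i, `|v i| <= u i) ->
  has_rsum v V -> `|V| <= U.
Proof. by move=> uU vu /(has_rsum_tail fset0 uU vu); rewrite !big_seq_fset0 !subr0. Qed.

(** An unconditional sum may be computed along any exhausting sequence of finite
sets; this identifies sums that are known to exist but not to what value. *)
Lemma has_rsum_cvg f S (A : nat -> {fset I}) : has_rsum f S ->
  (forall i, \forall N \near \oo, i \in A N) ->
  (\sum_(i <- A N) f i) @[N --> \oo] --> S.
Proof.
move=> fS hA; apply/cvgrPdist_lt => e e0; have [A0 h0] := fS _ e0.
suff : \forall N \near \oo, (A0 `<=` A N)%fset by apply: filterS => N /h0.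
have : \forall N \near \oo, forall i : A0, val i \in A N.
  by apply: filter_forall => i; apply: hA.
by apply: filterS => N h; apply/fsubsetP => i iA; have := h [` iA]%fset.
Qed.

(** Tannery's theorem: outside a finite set that carries the dominating sum up to
e / 3, neither the terms nor their limits matter. *)
Lemma has_rsum_dominated_cvg (f : nat -> I -> R) g u U (F : nat -> R) :
  has_rsum u U ->
  (\forall N \near \oo, forall i, `|f N i| <= u i) ->
  (forall i, f N i @[N --> \oo] --> g i) ->
  (forall N, has_rsum (f N) (F N)) ->
  exists2 G, has_rsum g G & F N @[N --> \oo] --> G.
Proof.
move=> uU fu fg fF.
have gu i : `|g i| <= u i.
  have h : `|f N i| @[N --> \oo] --> `|g i| by apply: cvg_norm.
  rewrite -(cvg_lim _ h)//; apply: limr_le; first by apply/cvg_ex; exists `|g i|.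
  by apply: filterS fu => N; apply.
have [G gG] := has_rsum_dom uU gu; exists G => //.
apply/cvgrPdist_le => e e0.
have e30 : 0 < e / 3 by rewrite divr_gt0.
have [A hA] := uU _ e30; have {hA} := hA A (fsubset_refl A) => /ltW hA.
have {}hA := le_trans (ler_norm _) hA.
have h1 : \sum_(i <- A) f N i @[N --> \oo] --> \sum_(i <- A) g i.
  by apply: cvg_big => [|i _]; [exact: add_continuous|exact: fg].
move/cvgrPdist_le : h1 => /(_ _ e30) h1.
near=> N.
have fuN : forall i, `|f N i| <= u i by near: N.
have t1 := le_trans (has_rsum_tail A uU gu gG) hA.
have t2 := le_trans (has_rsum_tail A uU fuN (fF N)) hA.
have t3 : `|\sum_(i <- A) g i - \sum_(i <- A) f N i| <= e / 3 by near: N.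
rewrite distrC in t2.
have -> : G - F N = (G - \sum_(i <- A) g i) + (\sum_(i <- A) g i - \sum_(i <- A) f N i)
   + (\sum_(i <- A) f N i - F N) by rewrite !addrA !subrK.
rewrite (le_trans (ler_normD _ _))// (le_trans (lerD (ler_normD _ _) (lexx _)))//.
by rewrite (le_trans (lerD (lerD t1 t3) t2))//; lra.
Unshelve. all: by end_near. Qed.
End Sums.

(** * Sums over the integers by folding *)

Section Windows.
Variable R : realType.
Implicit Types (F : nat -> R).

(** The number of integers of absolute value n: an even function on int is summed
over nat with these multiplicities. *)
Definition wgt (n : nat) : R := if n == 0%N then 1 else 2.

Lemma wgt_ge0 n : 0 <= wgt n. Proof. by rewrite /wgt; case: ifP. Qed.

Fixpoint nwin (N : nat) : {fset nat} :=
  if N is N'.+1 then (N' |` nwin N')%fset else fset0.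

Lemma in_nwin N i : (i \in nwin N) = (i < N)%N.
Proof.
elim: N => [|N IH]; first by rewrite in_fset0 ltn0.
by rewrite /= in_fset1U IH [in RHS]ltnS [in RHS]leq_eqVlt.
Qed.

Lemma sum_nwin N F : \sum_(i <- nwin N) F i = \sum_(i < N) F i.
Proof.
elim: N => [|N IH]; first by rewrite big_ord0 big_seq_fset0.
by rewrite big_ord_recr/= big_fsetU1 ?in_nwin ?ltnn//= IH addrC.
Qed.

Lemma sub_nwin (A : {fset nat}) : exists N, (A `<=` nwin N)%fset.
Proof.
exists (\max_(i <- A) i).+1; apply/fsubsetP => i iA; rewrite in_nwin ltnS.
by rewrite (big_fsetD1 i)//= leq_maxl.
Qed.

Fixpoint zwin (N : nat) : {fset int} :=
  if N is N'.+1 then (Posz N |` (Negz N' |` zwin N'))%fset else [fset 0]%fset.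

Lemma in_zwin N i : (i \in zwin N) = (absz i <= N)%N.
Proof.
elim: N i => [|N IH] i; first by rewrite /= inE leqn0 absz_eq0.
rewrite /= !inE IH [in RHS]leq_eqVlt ltnS orbA; congr (_ || _).
by case: i => k; rewrite ?orbF //= ?eqSS.
Qed.

Lemma sum_zwin N F :
  \sum_(i <- zwin N) F (absz i) = \sum_(n < N.+1) wgt n * F n.
Proof.
elim: N => [|N IH]; first by rewrite big_ord1 big_seq_fset1 /wgt eqxx mul1r.
rewrite big_ord_recr/= !big_fsetU1 ?in_zwin ?ltnn//=; last first.
  by rewrite !inE in_zwin ltnn.
by rewrite IH addrA addrC /wgt mulr_natl mulr2n.
Qed.

Lemma sub_zwin (A : {fset int}) : exists N, (A `<=` zwin N)%fset.
Proof.
exists (\max_(i <- A) absz i)%N; apply/fsubsetP => i iA; rewrite in_zwin.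
by rewrite (big_fsetD1 i)//= leq_maxl.
Qed.

Lemma near_in_nwin i : \forall N \near \oo, i \in nwin N.
Proof. by exists i.+1 => // N /=; rewrite in_nwin. Qed.

Lemma near_in_zwin i : \forall N \near \oo, i \in zwin N.
Proof. by exists (absz i) => // N /=; rewrite in_zwin. Qed.

Lemma has_rsum_even F S : (forall n, 0 <= F n) ->
  has_rsum (fun n => wgt n * F n) S -> has_rsum (fun i : int => F (absz i)) S.
Proof.
move=> F0 FS.
have [U hU] : exists U, has_rsum (fun i : int => F (absz i)) U.
  apply: (@has_rsum_bounded _ _ _ S) => // A.
  have [N AN] := sub_zwin A; rewrite (le_trans (fset_sum_le _ AN))//.
  rewrite sum_zwin -(sum_nwin _ (fun n => wgt n * F n)).
  by apply: has_rsum_partial FS => n; rewrite mulr_ge0// wgt_ge0.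
suff -> : S = U by [].
have h1 : \sum_(n < N.+1) wgt n * F n @[N --> \oo] --> U.
  by under eq_fun do rewrite -sum_zwin; apply: (has_rsum_cvg hU near_in_zwin).
have h2 : \sum_(n < N) wgt n * F n @[N --> \oo] --> S.
  under eq_fun do rewrite -(sum_nwin _ (fun n => wgt n * F n)).
  exact: (has_rsum_cvg FS near_in_nwin).
apply: cvg_unique h1; last first.
  by rewrite -(cvg_shiftS (fun N => \sum_(n < N) wgt n * F n)) in h2.
exact: norm_hausdorff.
Qed.

Lemma has_rsum_nat_fin F N : (forall n, (N <= n)%N -> F n = 0) ->
  has_rsum F (\sum_(n < N) F n).
Proof.
by move=> F0; rewrite -sum_nwin; apply: has_rsum_fin => i; rewrite in_nwin -leqNgt => /F0.
Qed.

Lemma has_rsum_wgt_exp (c : R) : 0 < c ->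
  exists U, has_rsum (fun n => wgt n * expR (- c * n%:R)) U.
Proof.
move=> c0; set q := expR (- c).
have q0 : 0 < q by apply: expR_gt0.
have q1 : q < 1 by rewrite expR_lt1 oppr_lt0.
have qq : 0 < 1 - q by rewrite subr_gt0.
apply: (@has_rsum_bounded _ _ _ (2 / (1 - q))) => [n|A].
  by rewrite mulr_ge0 ?wgt_ge0 ?expR_ge0.
have w0 n : 0 <= wgt n * expR (- c * n%:R) by rewrite mulr_ge0 ?wgt_ge0 ?expR_ge0.
have [N AN] := sub_nwin A; rewrite (le_trans (fset_sum_le w0 AN))//.
rewrite sum_nwin (@le_trans _ _ (\sum_(n < N) 2 * q ^+ n))//.
  apply: ler_sum => n _; rewrite mulrC expRM_natr mulrC ler_wpM2r ?exprn_ge0 ?(ltW q0)//.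
  by rewrite /wgt; case: ifP => // _; rewrite ler1n.
rewrite -mulr_sumr ler_wpM2l//.
rewrite -[leRHS]mul1r ler_pdivlMr// mulrC -[X in X * _]opprB mulNr -subrX1 opprB.
by rewrite lerBlDr lerDl exprn_ge0// ltW.
Qed.
End Windows.

(** * Polya's finite duality between powers of cosine and binomial coefficients *)

Section Polya.
Variable R : realType.
Implicit Types (x : R) (m p q : nat).
Local Notation wgt := (@wgt R).

Lemma cosM2 x y : 2 * cos x * cos y = cos (y + x) + cos (y - x) :> R.
Proof. by rewrite cosD cosB; ring. Qed.

Lemma cos_pow_binom n x : (2 * cos x) ^+ n =
  \sum_(r < n.+1) 'C(n, r)%:R * cos ((n%:R - 2 * r%:R) * x).
Proof.
elim: n => [|n IH].
  by rewrite big_ord1 expr0 bin0 mulr0 subrr !mul0r cos0 mulr1.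
pose g (r : nat) : R := cos ((n.+1%:R - 2 * r%:R) * x).
have -> : \sum_(r < n.+2) 'C(n.+1, r)%:R * cos ((n.+1%:R - 2 * r%:R) * x) =
  \sum_(r < n.+1) 'C(n, r)%:R * g r + \sum_(r < n.+1) 'C(n, r)%:R * g r.+1.
  rewrite big_ord_recl/= bin0 -/(g 0%N).
  under eq_bigr do rewrite /bump/= add1n binS (natrD R) mulrDl.
  rewrite big_split/= addrA; congr (_ + _).
  rewrite [RHS]big_ord_recl/= bin0; congr (_ + _).
  rewrite big_ord_recr/= bin_small// mul0r addr0.
  by apply: eq_bigr => i _; rewrite /bump/= add1n.
rewrite exprS IH mulr_sumr -big_split/=; apply: eq_bigr => r _.
rewrite mulrCA cosM2 mulrDr /g.
congr (_ * cos _ + _ * cos _); rewrite -!natr1; ring.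
Qed.

Lemma sum_fold (g : nat -> R) m : \sum_(r < (m + m).+1) g r =
  g m + \sum_(q < m) (g (m + q.+1)%N + g (m - q.+1)%N).
Proof.
rewrite -(big_mkord xpredT) (@big_cat_nat _ _ _ m)//= ?leqW ?leq_addr//.
rewrite big_nat_recl ?leq_addr// big_split/=.
have -> : \sum_(0 <= i < m) g i = \sum_(i < m) g (m - i.+1)%N.
  by rewrite big_nat_rev/= big_mkord; apply: eq_bigr => i _; rewrite add0n.
rewrite addrC -addrA; congr (_ + (_ + _)).
rewrite -{1}[m]add0n big_addn addnK big_mkord.
by apply: eq_bigr => i _; rewrite addnC addnS.
Qed.

(** The binomial expansion of (e^(ix) + e^(-ix))^(2m), with the exponents q and - q
folded together. *)
Lemma cos_pow_even m x : (2 * cos x) ^+ (m + m) =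
  \sum_(q < m.+1) wgt q * ('C(m + m, m + q)%:R * cos (2 * q%:R * x)).
Proof.
rewrite cos_pow_binom (sum_fold (fun r => 'C(m + m, r)%:R * cos (((m + m)%:R - 2 * r%:R) * x))).
rewrite big_ord_recl/= addn0 /wgt eqxx mul1r (natrD R).
congr (_ * cos _ + _); first by ring.
apply: eq_bigr => q _; rewrite /bump/= add1n [RHS]mulr_natl [RHS]mulr2n.
have qm : (q.+1 <= m)%N by [].
rewrite (natrB R)// (natrD R); congr (_ + _).
  by rewrite -cosN; congr (_ * cos _); ring.
rewrite -bin_sub ?leq_add2l//; last by rewrite (leq_trans (leq_subr _ _)) ?leq_addr.
congr ('C(_, _)%:R * cos _); last by ring.
by rewrite subnBA// -addnA addnC addnK addnC.
Qed.

(** The Dirichlet kernel: multiplied by sin (y / 2), each cosine becomes a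
difference of consecutive sines. *)
Lemma sum_cos_telescope y p : sin (y / 2) * (\sum_(j < p.+1) wgt j * cos (j%:R * y))
  = sin ((p%:R + 2^-1) * y).
Proof.
elim: p => [|p IH].
  by rewrite big_ord1 /wgt eqxx mul0r cos0 !mul1r mulr1 add0r mulrC.
rewrite big_ord_recr/= mulrDr IH /wgt/= -!(natr1 p).
have -> : (p%:R + 2^-1) * y = (p%:R + 1) * y - y / 2 by field.
have -> : (p%:R + 1 + 2^-1) * y = (p%:R + 1) * y + y / 2 by ring.
by rewrite sinB sinD; ring.
Qed.

Lemma sin_natmul_pi q : sin (q%:R * pi) = 0 :> R.
Proof.
by elim: q => [|q IH]; rewrite ?mul0r ?sin0// -(natr1 q) mulrDl mul1r sinDpi IH oppr0.
Qed.

Lemma cos_natmul_2pi q : cos (2 * q%:R * pi) = 1 :> R.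
Proof.
elim: q => [|q IH]; first by rewrite mulr0 mul0r cos0.
rewrite -(natr1 q) (_ : 2 * (q%:R + 1) * pi = 2 * q%:R * pi + pi *+ 2); last first.
  by rewrite -[pi *+ 2]mulr_natl; ring.
by rewrite cosD2pi.
Qed.

Lemma sin_natdiv_pi_neq0 q l : (0 < l)%N -> ~~ (l %| q)%N ->
  sin (q%:R / l%:R * pi) != 0 :> R.
Proof.
move=> l0 lq; have l1 : 0 < l%:R :> R by rewrite ltr0n.
rewrite {1}(divn_eq q l) (_ : _ * pi = (q %% l)%:R / l%:R * pi + pi *+ (q %/ l)).
  rewrite (alternatingn (@sinDpi R)) mulf_neq0// ?signr_eq0//.
  rewrite gt_eqF// sin_gt0_pi// mulr_gt0 ?pi_gt0 ?divr_gt0 ?ltr0n//=.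
    by rewrite -[ltRHS]mul1r ltr_pM2r ?pi_gt0// ltr_pdivrMr// mul1r ltr_nat ltn_mod.
  by rewrite lt0n; rewrite /dvdn in lq.
by rewrite (natrD R) (natrM R) -[pi *+ _]mulr_natl; field; rewrite gt_eqF.
Qed.

(** Orthogonality of the characters of Z/l, in real form; l is odd so that the
classes fold to 0, ..., p. *)
Lemma sum_cos_roots q p : let l := p.*2.+1 in
  \sum_(j < p.+1) wgt j * cos (2 * q%:R * (pi * j%:R / l%:R)) =
  if (l %| q)%N then l%:R else 0 :> R.
Proof.
move=> l; have l0 : l%:R != 0 :> R by rewrite pnatr_eq0.
case: ifPn => [/dvdnP[k ->]|lq].
  have E j : cos (2 * (k * l)%:R * (pi * j%:R / l%:R)) = 1 :> R.
    clearbody l; rewrite (_ : _ * _ = 2 * (k * j)%:R * pi) ?cos_natmul_2pi//.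
    by rewrite !(natrM R); field.
  under eq_bigr do rewrite E mulr1.
  rewrite big_ord_recl /wgt/= sumr_const card_ord -mulrnA.
  by rewrite /l -(natr1 p.*2) -mul2n addrC.
pose y : R := 2 * q%:R * pi / l%:R.
have := sum_cos_telescope y p.
have -> : (p%:R + 2^-1) * y = q%:R * pi.
  rewrite /y /l -(natr1 p.*2) -mul2n (natrM R); field.
  by rewrite -(natrM R) natr1 mul2n.
rewrite sin_natmul_pi => /eqP; rewrite mulf_eq0 => /orP[|/eqP E]; last first.
  by rewrite -[RHS]E; apply: eq_bigr => j _; congr (_ * cos _); rewrite /y; field.
rewrite (_ : y / 2 = q%:R / l%:R * pi); last by rewrite /y; field.
by rewrite (negbTE (sin_natdiv_pi_neq0 _ lq)).
Qed.

Lemma sum_multiples (F : nat -> R) l m : (0 < l)%N ->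
  (forall q, (m < q)%N -> F q = 0) ->
  \sum_(q < m.+1) wgt q * F q * (l %| q)%N%:R = \sum_(k < m.+1) wgt k * F (k * l)%N.
Proof.
move=> l0 F0.
have E (k : 'I_m.+1) : wgt k * F (k * l)%N =
    \sum_(q < m.+1) (if q == (k * l)%N :> nat then wgt q * F q else 0).
  rewrite -big_mkcond/=; have [kl|kl] := ltnP (k * l)%N m.+1.
    rewrite (big_pred1 (Ordinal kl))//=.
    by congr (_ * _); rewrite /wgt muln_eq0 (gtn_eqF l0) orbF.
  rewrite F0// mulr0 big1// => q /eqP qkl.
  by have := ltn_ord q; rewrite qkl ltnNge kl.
rewrite (eq_bigr _ (fun k _ => E k)) exchange_big/=; apply: eq_bigr => q _.
case: (boolP (l %| q)%N) => [lq|lq]; last first.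
  rewrite mulr0 big1// => k _; case: eqP => // qkl.
  by rewrite qkl dvdn_mull in lq.
have ql : (q %/ l < m.+1)%N by rewrite (leq_ltn_trans (leq_div _ _)).
rewrite -big_mkcond/= (big_pred1 (Ordinal ql)) ?mulr1// => k.
by rewrite /= -{1}(divnK lq) eqn_mul2r (gtn_eqF l0)/= eq_sym.
Qed.

(** Poisson summation on Z/l.  Averaging cos^(2m) over the multiples of pi / l keeps,
among the binomial coefficients of its expansion, those whose index is a
multiple of l from the middle. *)
Lemma cos_pow_binomial_duality m p : let l := p.*2.+1 in
  \sum_(j < p.+1) wgt j * cos (pi * j%:R / l%:R) ^+ (m + m) =
  l%:R * 'C(m + m, m)%:R / 2 ^+ (m + m) *
  \sum_(k < m.+1) wgt k * ('C(m + m, m + k * l)%:R / 'C(m + m, m)%:R) :> R.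
Proof.
move=> l; have c0 : 'C(m + m, m)%:R != 0 :> R by rewrite pnatr_eq0 -lt0n bin_gt0 leq_addr.
have p0 : 2 ^+ (m + m) != 0 :> R by rewrite expf_neq0.
apply: (mulfI p0); rewrite [RHS](_ : _ = l%:R *
    \sum_(k < m.+1) wgt k * 'C(m + m, m + k * l)%:R); last first.
  rewrite !mulrA [X in X * _](_ : _ = l%:R * 'C(m + m, m)%:R); last first.
    by move: (2 ^+ (m + m)) p0 => X X0; field.
  rewrite -mulrA mulr_sumr; congr (_ * _).
  by apply: eq_bigr => k _; move: ('C(m + m, m)%:R) c0 => X X0; field.
(* The multiples of l are selected by the divisibility indicator, itself a sum of cosines. *)
rewrite -(sum_multiples (F := fun q => 'C(m + m, m + q)%:R))//; last first.
  by move=> q mq; rewrite bin_small// ltn_add2l.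
rewrite !mulr_sumr.
under eq_bigr => j _.
  rewrite mulrCA -exprMn cos_pow_even mulr_sumr.
  under eq_bigr => q _ do rewrite mulrCA mulrA.
  over.
rewrite exchange_big/=; apply: eq_bigr => q _.
have -> : l%:R * (wgt q * 'C(m + m, m + q)%:R * (l %| q)%N%:R) =
    (if (l %| q)%N then l%:R else 0) * wgt q * 'C(m + m, m + q)%:R :> R.
  by case: (l %| q)%N => /=; ring.
rewrite -sum_cos_roots !mulr_suml; apply: eq_bigr => j _. ring.
Qed.
End Polya.

(** * Jacobi's inversion of the theta series *)

Section Estimates.
Variable R : realType.
Implicit Types (x : R) (m p q : nat).

(** Elementary inequalities between functions that agree at 0 are read off their
derivatives. *)
Lemma le_of_derive_le (f g f' g' : R -> R) x : 0 <= x ->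
  (forall x, is_derive x 1 f (f' x)) -> (forall x, is_derive x 1 g (g' x)) ->
  (forall y, 0 < y < x -> f' y <= g' y) -> f 0 = g 0 -> f x <= g x.
Proof.
move=> x0 df dg fg fg0.
have dh (y : R) : is_derive y 1 (g - f) (g' y - f' y) by apply: is_deriveB.
have : (g - f) 0 <= (g - f) x.
  apply: (@ger0_derive1_le _ (g - f) 0 x _ _ true false) => //=.
  - by move=> y /[!in_itv]/= /andP[y0 yx]; rewrite derive1E derive_val subr_ge0 fg// y0.
  - by apply: derivable_within_continuous => y _; exact: ex_derive.
  - by rewrite in_itv/= lexx.
  - by rewrite in_itv/= x0 lexx.
by rewrite !fctE fg0 subrr subr_ge0.
Qed.

Lemma sin_le x : 0 <= x -> sin x <= x.
Proof.
move=> x0; apply: (@le_of_derive_le sin id cos (fun=> 1)) => //=.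
by rewrite sin0.
Qed.

Lemma xcos_le_sin x : 0 <= x <= pi -> x * cos x <= sin x.
Proof.
move=> /andP[x0 xpi].
apply: (@le_of_derive_le (fun x => x * cos x) sin (fun x => cos x - x * sin x) cos) => //=.
- move=> y; apply: is_derive_eq; rewrite /GRing.scale/=; ring.
- move=> y /andP[y0 yx]; rewrite gerBl mulr_ge0 ?(ltW y0)// sin_ge0_pi// (ltW y0)/=.
  by rewrite (le_trans (ltW yx)).
- by rewrite mul0r sin0.
Qed.

(** sin x = 2 cos (x/2) sin (x/2) >= x cos^2 (x/2), and cos^2 (x/2) >= 1/2 as
long as cos x >= 0. *)
Lemma half_le_sin x : 0 <= x <= pi / 2 -> x / 2 <= sin x.
Proof.
move=> /andP[x0 xpi]; have pi0 := @pi_gt0 R.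
have h : x / 2 * cos (x / 2) <= sin (x / 2) by apply: xcos_le_sin; lra.
have c0 : 0 <= cos (x / 2) by apply: cos_ge0_pihalf; lra.
have c1 : 0 <= cos x by apply: cos_ge0_pihalf; lra.
have E : x = x / 2 + x / 2 by field.
have h2 : cos x = 2 * cos (x / 2) ^+ 2 - 1.
  by rewrite {1}E -mulr2n cos_mulr2n -mulr_natl.
have h3 : sin x = 2 * (cos (x / 2) * sin (x / 2)).
  by rewrite {1}E -mulr2n sin_mulr2n -mulr_natl.
rewrite h3 (le_trans (_ : _ <= 2 * (cos (x / 2) * (x / 2 * cos (x / 2)))))//; last first.
  by rewrite ler_wpM2l// ler_wpM2l.
have : 1 / 2 <= cos (x / 2) ^+ 2 by lra.
move=> h4; rewrite (_ : 2 * _ = x * cos (x / 2) ^+ 2); last by field.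
by rewrite ler_wpM2l//; lra.
Qed.

(** cos^2 x = 1 - sin^2 x <= exp (- sin^2 x). *)
Lemma cos_pow_le_sin x m : cos x ^+ (m + m) <= expR (- (m%:R * sin x ^+ 2)).
Proof.
rewrite addnn -mul2n exprM -mulrN expRM_natl lerXn2r ?nnegrE ?sqr_ge0 ?expR_ge0//.
by rewrite cos2sin2 (le_trans _ (expR_ge1Dx _)).
Qed.

Lemma cos_pow_le x m : 0 <= x <= pi / 2 ->
  cos x ^+ (m + m) <= expR (- (m%:R * x ^+ 2 * cos x ^+ 2)).
Proof.
move=> /andP[x0 xpi]; have pi0 := @pi_gt0 R.
rewrite (le_trans (cos_pow_le_sin _ _))// ler_expR lerN2 -mulrA ler_wpM2l// -exprMn.
have c0 : 0 <= cos x by apply: cos_ge0_pihalf; lra.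
by rewrite lerXn2r ?nnegrE ?mulr_ge0// ?xcos_le_sin ?sin_ge0_pi//; lra.
Qed.

Lemma cos_pow_dom x m : 0 <= x <= pi / 2 ->
  cos x ^+ (m + m) <= expR (- (m%:R * x ^+ 2 / 4)).
Proof.
move=> /andP[x0 xpi]; have pi0 := @pi_gt0 R.
rewrite (le_trans (cos_pow_le_sin _ _))// ler_expR lerN2 -mulrA ler_wpM2l//.
rewrite (_ : _ / 4 = (x / 2) ^+ 2); last by field.
by rewrite lerXn2r ?nnegrE ?half_le_sin ?sin_ge0_pi//; lra.
Qed.

(** 1 / cos^2 x = 1 + tan^2 x <= exp (tan^2 x), and tan x cos x = sin x <= x. *)
Lemma cos_pow_ge x m : 0 <= x < pi / 2 ->
  expR (- (m%:R * x ^+ 2 / cos x ^+ 2)) <= cos x ^+ (m + m).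
Proof.
move=> /andP[x0 xpi]; have pi0 := @pi_gt0 R.
have c0 : 0 < cos x by apply: cos_gt0_pihalf; lra.
have c20 : 0 < cos x ^+ 2 by rewrite exprn_gt0.
rewrite addnn -mul2n exprM -mulrA -mulrN expRM_natl lerXn2r ?nnegrE ?sqr_ge0 ?expR_ge0//.
rewrite expRN -[leRHS]invrK lef_pV2 ?posrE ?expR_gt0 ?invr_gt0//.
rewrite (le_trans _ (expR_ge1Dx _))//.
rewrite -[X in X + _](@divff _ (cos x ^+ 2)) ?gt_eqF// -mulrDl -[leLHS]mul1r ler_pM2r ?invr_gt0//.
rewrite -[leLHS](cos2Dsin2 x) lerD2l lerXn2r ?nnegrE ?sin_le// sin_ge0_pi//; lra.
Qed.

(** The binomial coefficients relative to the central one, which satisfy a simple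
first-order recurrence and tend to a Gaussian. *)
Definition binratio m q : R := 'C(m + m, m + q)%:R / 'C(m + m, m)%:R.

Lemma binratio_ge0 m q : 0 <= binratio m q. Proof. by rewrite divr_ge0. Qed.

Lemma binratio0 m : binratio m 0 = 1.
Proof. by rewrite /binratio addn0 divff// pnatr_eq0 -lt0n bin_gt0 leq_addr. Qed.

Lemma binratio_gt m q : (m < q)%N -> binratio m q = 0.
Proof. by move=> mq; rewrite /binratio bin_small ?mul0r// ltn_add2l. Qed.

Lemma binratioS m q : binratio m q.+1 = binratio m q * ((m - q)%N%:R / (m + q).+1%:R).
Proof.
have := mul_bin_left (m + m) (m + q); rewrite subnDl -addnS => /(congr1 (fun n => n%:R : R)).
rewrite !(natrM R) => h; rewrite /binratio.
have c0 : 'C(m + m, m)%:R != 0 :> R by rewrite pnatr_eq0 -lt0n bin_gt0 leq_addr.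
have d0 : (m + q.+1)%:R != 0 :> R by rewrite pnatr_eq0 addnS.
have -> : 'C(m + m, m + q.+1)%:R = (m - q)%:R * 'C(m + m, m + q)%:R / (m + q.+1)%:R :> R.
  by rewrite -h mulrAC divff ?mul1r.
by rewrite addnS; rewrite addnS in d0; move: (_%:R) (_.+1%:R) c0 d0 => X Y X0 Y0; field; rewrite X0 Y0.
Qed.

(** Each factor (m - q) / (m + q + 1) = 1 - (2q + 1) / (m + q + 1) is at most
exp (- (2q + 1) / (m + Q)); the exponents 2q + 1 add up to a square. *)
Lemma binratio_le m Q q : (0 < m)%N -> (q <= Q)%N ->
  binratio m q <= expR (- (q%:R ^+ 2 / (m + Q)%:R)).
Proof.
move=> m0; elim: q => [|q IH] qQ.
  by rewrite binratio0 expr2 !mul0r oppr0 expR0.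
have M0 : 0 < (m + Q)%:R :> R by rewrite ltr0n addn_gt0 m0.
rewrite binratioS (_ : - _ = - (q%:R ^+ 2 / (m + Q)%:R) - (2 * q%:R + 1) / (m + Q)%:R); last first.
  by rewrite -(natr1 q); move: ((m + Q)%:R) M0 => X X0; field; rewrite gt_eqF.
rewrite expRD ler_pM ?binratio_ge0 ?divr_ge0 ?IH//; first exact: ltnW.
have [qm|mq] := leqP q m; last by rewrite (eqP (ltnW mq)) mul0r expR_ge0.
have N0 : 0 < (m + q).+1%:R :> R by rewrite ltr0n.
rewrite (@le_trans _ _ (expR (- ((2 * q%:R + 1) / (m + q).+1%:R))))//.
  rewrite (le_trans _ (expR_ge1Dx _))// (natrB R)// ler_pdivrMr// mulrDl mulNr divfK ?gt_eqF//.
  by rewrite -(natr1 (m + q)) (natrD R); lra.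
rewrite ler_expR lerN2 ler_wpM2l ?addr_ge0 ?mulr_ge0//.
by rewrite lef_pV2 ?posrE// ler_nat ltn_add2l.
Qed.

Lemma binratio_dom m q : (0 < m)%N -> binratio m q <= expR (- (q%:R ^+ 2 / (2 * m%:R))).
Proof.
move=> m0; have [qm|mq] := leqP q m; last by rewrite binratio_gt// expR_ge0.
rewrite (le_trans (@binratio_le m m _ m0 qm))// (natrD R).
by rewrite [_ + _](_ : _ = 2 * m%:R)//; ring.
Qed.

(** The same factors bounded from below: (m + q + 1) / (m - q) = 1 + (2q + 1) / (m - q)
is at most exp ((2q + 1) / (m - Q)). *)
Lemma binratio_ge m Q q : (Q < m)%N -> (q <= Q)%N ->
  expR (- (q%:R ^+ 2 / (m - Q)%N%:R)) <= binratio m q.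
Proof.
move=> mQ; elim: q => [|q IH] qQ.
  by rewrite binratio0 expr2 !mul0r oppr0 expR0.
have M0 : 0 < (m - Q)%N%:R :> R by rewrite ltr0n subn_gt0.
rewrite binratioS (_ : - _ = - (q%:R ^+ 2 / (m - Q)%N%:R) - (2 * q%:R + 1) / (m - Q)%N%:R); last first.
  by rewrite -(natr1 q); move: ((m - Q)%N%:R) M0 => X X0; field; rewrite gt_eqF.
rewrite expRD ler_pM ?expR_ge0 ?IH//; first exact: ltnW.
have qm : (q < m)%N by rewrite (leq_ltn_trans _ mQ)// ltnW.
have N0 : 0 < (m - q)%N%:R :> R by rewrite ltr0n subn_gt0.
rewrite (@le_trans _ _ (expR (- ((2 * q%:R + 1) / (m - q)%N%:R))))//.
  rewrite ler_expR lerN2 ler_wpM2l ?addr_ge0 ?mulr_ge0//.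
  by rewrite lef_pV2 ?posrE// ler_nat leq_sub2l// ltnW.
rewrite expRN -[leRHS]invrK lef_pV2 ?posrE ?expR_gt0 ?invr_gt0 ?divr_gt0 ?ltr0n ?subn_gt0//.
rewrite invf_div (le_trans _ (expR_ge1Dx _))// ler_pdivrMr// mulrDl divfK ?gt_eqF//.
by rewrite -(natr1 (m + q)) (natrD R) (natrB R) ?(ltnW qm)//; lra.
Qed.
End Estimates.

Section Jacobi.
Variable R : realType.
Local Notation wgt := (@wgt R).

Section fixed_tau.
Variable tau : R.
Hypothesis tau0 : 0 < tau.

(** The modulus l = 2 p + 1 is an odd integer at distance at most 1 from
sqrt (tau m): this scaling makes both sides of the duality converge. *)
Let p (m : nat) : nat := Num.truncn (Num.sqrt (tau * m%:R) / 2).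
Let l (m : nat) : nat := (p m).*2.+1.

Let l0 m : 0 < (l m)%:R :> R. Proof. by rewrite ltr0n. Qed.

Let cvg_invm : (m%:R^-1 : R) @[m --> \oo] --> (0 : R).
Proof. by rewrite -(cvg_shiftS (fun m => m%:R^-1 : R)); exact: cvg_harmonic. Qed.

Let cvg_invsqrt : ((Num.sqrt m%:R)^-1 : R) @[m --> \oo] --> (0 : R).
Proof.
rewrite -(@sqrtr0 R); under eq_fun do rewrite -sqrtrV//.
exact: (continuous_cvg _ (@sqrt_continuous R 0) cvg_invm).
Qed.

Let l_sqrt m : `|(l m)%:R - Num.sqrt tau * Num.sqrt m%:R| <= 1.
Proof.
have h0 : 0 <= Num.sqrt (tau * m%:R) / 2 by rewrite divr_ge0// sqrtr_ge0.
have /andP[h1 h2] := truncn_itv h0.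
rewrite -sqrtrM ?(ltW tau0)// ler_norml /l -(natr1 (p m).*2) -mul2n (natrM R).
rewrite -/(p m) -(natr1 (p m)) in h1 h2.
by apply/andP; split; lra.
Qed.

Let cvg_l_sqrt : (l m)%:R / Num.sqrt m%:R @[m --> \oo] --> Num.sqrt tau.
Proof.
apply/cvgrPdist_le => e e0.
have h : \forall m \near \oo, `|0 - (Num.sqrt m%:R : R)^-1| <= e.
  by move/cvgrPdist_le : cvg_invsqrt; exact.
near=> m.
have m0 : 0 < Num.sqrt m%:R :> R by rewrite sqrtr_gt0 ltr0n; near: m; exact: nbhs_infty_gt.
have -> : Num.sqrt tau - (l m)%:R / Num.sqrt m%:R =
  (Num.sqrt tau * Num.sqrt m%:R - (l m)%:R) / Num.sqrt m%:R.
  by rewrite mulrBl mulfK ?gt_eqF.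
rewrite normrM normfV (gtr0_norm m0) distrC.
rewrite (@le_trans _ _ (1 / Num.sqrt m%:R))// ?ler_wpM2r ?invr_ge0 ?(ltW m0)//.
have : `|0 - (Num.sqrt m%:R)^-1| <= e by near: m.
by rewrite sub0r normrN normfV (gtr0_norm m0) mul1r.
Unshelve. all: by end_near. Qed.

Let r m : R := (l m)%:R ^+ 2 / m%:R.

Let cvg_r : r m @[m --> \oo] --> tau.
Proof.
rewrite -[tau]sqr_sqrtr ?(ltW tau0)// expr2.
have -> : r = fun m => ((l m)%:R / Num.sqrt m%:R) * ((l m)%:R / Num.sqrt m%:R).
  apply/funext => m; rewrite /r mulrACA -expr2 -invfM -expr2 sqr_sqrtr//.
exact: cvgM.
Qed.

Let cvg_lm : (l m)%:R / m%:R @[m --> \oo] --> (0 : R).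
Proof.
rewrite -(mulr0 (Num.sqrt tau)).
have -> : (fun m => (l m)%:R / m%:R) = fun m => ((l m)%:R / Num.sqrt m%:R) * (Num.sqrt m%:R : R)^-1.
  by apply/funext => m; rewrite -mulrA -invfM -expr2 sqr_sqrtr.
exact: cvgM.
Qed.

Let cvg_rV : (r m)^-1 @[m --> \oo] --> tau^-1.
Proof. by apply: cvgV => //; rewrite gt_eqF. Qed.

Let cvg_lV : ((l m)%:R^-1 : R) @[m --> \oo] --> (0 : R).
Proof.
rewrite -(mulr0 tau^-1); apply: cvg_trans (cvgM cvg_rV cvg_lm).
apply: near_eq_cvg; near=> m.
have m0 : m%:R != 0 :> R by rewrite pnatr_eq0 -lt0n; near: m; exact: nbhs_infty_gt.
rewrite /r /=; move: (l m)%:R (l0 m) => X X0; field.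
by rewrite m0 gt_eqF.
Unshelve. all: by end_near. Qed.

Let fX m j : R := if (j <= p m)%N then wgt j * cos (pi * j%:R / (l m)%:R) ^+ (m + m) else 0.
Let X m : R := \sum_(j < (p m).+1) wgt j * cos (pi * j%:R / (l m)%:R) ^+ (m + m).
Let fY m k : R := wgt k * binratio R m (k * l m).
Let Y m : R := \sum_(k < m.+1) wgt k * binratio R m (k * l m).

Let has_X m : has_rsum (fX m) (X m).
Proof.
rewrite (_ : X m = \sum_(j < (p m).+1) fX m j); last first.
  by apply: eq_bigr => j _; rewrite /fX -ltnS ltn_ord.
by apply: has_rsum_nat_fin => n pn; rewrite /fX leqNgt pn.
Qed.

Let has_Y m : has_rsum (fY m) (Y m).
Proof.
apply: has_rsum_nat_fin => n mn; rewrite /fY binratio_gt ?mulr0//.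
by rewrite (leq_trans mn)// leq_pmulr.
Qed.

Let XY m : X m = (l m)%:R * 'C(m + m, m)%:R / 2 ^+ (m + m) * Y m.
Proof. exact: cos_pow_binomial_duality. Qed.

Let angle_le m j : (j <= p m)%N -> 0 <= (pi : R) * j%:R / (l m)%:R < pi / 2.
Proof.
move=> jp; rewrite divr_ge0 ?mulr_ge0 ?pi_ge0//=.
rewrite -mulrA ltr_pM2l ?pi_gt0// ltr_pdivrMr// ltr_pdivlMl//.
by rewrite -natrM ltr_nat /l mul2n ltnS leq_double.
Qed.

Let p_large j : \forall m \near \oo, (j <= p m)%N.
Proof.
have e0 : 0 < (j.*2.+1)%:R^-1 :> R by rewrite invr_gt0.
have h : \forall m \near \oo, `|0 - ((l m)%:R : R)^-1| < (j.*2.+1)%:R^-1.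
  by move/cvgrPdist_lt : cvg_lV; apply.
apply: filterS h => m; rewrite sub0r normrN gtr0_norm ?invr_gt0//.
rewrite ltf_pV2 ?posrE// ltr_nat ltnS => /ltnW.
by rewrite leq_double.
Qed.

Let angle_sqr m j : m%:R * (pi * j%:R / (l m)%:R) ^+ 2 = (pi * j%:R) ^+ 2 * (r m)^-1 :> R.
Proof. by rewrite /r invf_div expr_div_n mulrCA. Qed.

(** m x^2 tends to (pi j)^2 / tau for the angle x = pi j / l, and
cos^(2m) x lies between exp (- m x^2 / cos^2 x) and exp (- m x^2 cos^2 x), where
cos x tends to 1. *)
Let lim_fX j : fX m j @[m --> \oo] --> wgt j * expR (- (pi ^+ 2 / tau) * j%:R ^+ 2).
Proof.
have cx : cos (pi * j%:R / (l m)%:R) @[m --> \oo] --> (1 : R).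
  rewrite -[X in _ --> X](@cos0 R); apply: (continuous_cvg _ (@continuous_cos R 0)).
  by rewrite -[X in _ --> X](mulr0 (pi * j%:R)); apply: cvgM; [exact: cvg_cst|exact: cvg_lV].
have cx2 : cos (pi * j%:R / (l m)%:R) ^+ 2 @[m --> \oo] --> (1 : R).
  under eq_fun do rewrite expr2.
  have := cvgM cx cx; rewrite mulr1; exact.
have crm : (pi * j%:R) ^+ 2 * (r m)^-1 @[m --> \oo] --> (pi * j%:R) ^+ 2 / tau.
  by apply: cvgM; [exact: cvg_cst|exact: cvg_rV].
have lim : expR (- ((pi * j%:R) ^+ 2 / tau)) = expR (- (pi ^+ 2 / tau) * j%:R ^+ 2).
  by congr expR; rewrite exprMn; ring.
apply: (@squeeze_cvgr _ _ _ _
  (fun m => wgt j * expR (- ((pi * j%:R) ^+ 2 * (r m)^-1 / cos (pi * j%:R / (l m)%:R) ^+ 2)))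
  (fun m => wgt j * expR (- ((pi * j%:R) ^+ 2 * (r m)^-1 * cos (pi * j%:R / (l m)%:R) ^+ 2)))).
- apply: filterS (p_large j) => m jp; rewrite /fX jp -angle_sqr.
  have /andP[a0 a1] := angle_le jp.
  by rewrite !ler_wpM2l ?wgt_ge0// ?cos_pow_ge ?cos_pow_le ?a0//= ltW.
- apply: cvgM; [exact: cvg_cst|rewrite -lim].
  apply: (continuous_cvg _ (@continuous_expR R _)); apply: cvgN.
  by have := cvgM crm (cvgV (oner_neq0 R) cx2); rewrite invr1 mulr1; exact.
- apply: cvgM; [exact: cvg_cst|rewrite -lim].
  apply: (continuous_cvg _ (@continuous_expR R _)); apply: cvgN.
  by have := cvgM crm cx2; rewrite mulr1; exact.
Qed.

(** (k l)^2 / (m +- k l) tends to tau k^2, because l / m tends to 0. *)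
Let lim_fY k : fY m k @[m --> \oo] --> wgt k * expR (- tau * k%:R ^+ 2).
Proof.
have ck : k%:R * ((l m)%:R / m%:R) @[m --> \oo] --> (0 : R).
  by rewrite -[X in _ --> X](mulr0 k%:R); apply: cvgM; [exact: cvg_cst|exact: cvg_lm].
have c1 : 1 + k%:R * ((l m)%:R / m%:R) @[m --> \oo] --> (1 : R).
  by have := cvgD (cvg_cst (1 : R)) ck; rewrite addr0; exact.
have c2 : 1 - k%:R * ((l m)%:R / m%:R) @[m --> \oo] --> (1 : R).
  by have := cvgB (cvg_cst (1 : R)) ck; rewrite subr0; exact.
have ckr : k%:R ^+ 2 * r m @[m --> \oo] --> k%:R ^+ 2 * tau.
  by apply: cvgM; [exact: cvg_cst|exact: cvg_r].
have lim : expR (- (k%:R ^+ 2 * tau)) = expR (- tau * k%:R ^+ 2) by congr expR; ring.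
apply: (@squeeze_cvgr _ _ _ _
  (fun m => wgt k * expR (- (k%:R ^+ 2 * r m / (1 - k%:R * ((l m)%:R / m%:R)))))
  (fun m => wgt k * expR (- (k%:R ^+ 2 * r m / (1 + k%:R * ((l m)%:R / m%:R)))))).
- have hm : \forall m \near \oo, (0 < m)%N by exact: nbhs_infty_gt.
  have hk : \forall m \near \oo, `|0 - k%:R * ((l m)%:R / m%:R : R)| < 1.
    by move/cvgrPdist_lt : ck; apply.
  near=> m.
  have m0 : (0 < m)%N by near: m.
  have m1 : 0 < m%:R :> R by rewrite ltr0n.
  have klm : (k * l m < m)%N.
    have : `|0 - k%:R * ((l m)%:R / m%:R : R)| < 1 by near: m.
    rewrite sub0r normrN ger0_norm ?mulr_ge0 ?invr_ge0//.
    by rewrite mulrA ltr_pdivrMr// mul1r -natrM ltr_nat.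
  have M0 : 0 < (m - k * l m)%N%:R :> R by rewrite ltr0n subn_gt0.
  have E1 : k%:R ^+ 2 * r m / (1 - k%:R * ((l m)%:R / m%:R)) =
     (k * l m)%:R ^+ 2 / (m - k * l m)%N%:R.
    rewrite natrB ?(ltnW klm)// natrM in M0 *.
    by rewrite /r; field; rewrite !gt_eqF.
  have E2 : k%:R ^+ 2 * r m / (1 + k%:R * ((l m)%:R / m%:R)) =
     (k * l m)%:R ^+ 2 / (m + k * l m)%N%:R.
    rewrite natrD natrM /r; field.
    by rewrite !gt_eqF// ltr_wpDr// ?mulr_ge0.
  by rewrite E1 E2 /fY !ler_wpM2l ?wgt_ge0 ?binratio_ge ?binratio_le.
- apply: cvgM; [exact: cvg_cst|rewrite -lim].
  apply: (continuous_cvg _ (@continuous_expR R _)); apply: cvgN.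
  by have := cvgM ckr (cvgV (oner_neq0 R) c2); rewrite invr1 mulr1; exact.
- apply: cvgM; [exact: cvg_cst|rewrite -lim].
  apply: (continuous_cvg _ (@continuous_expR R _)); apply: cvgN.
  by have := cvgM ckr (cvgV (oner_neq0 R) c1); rewrite invr1 mulr1; exact.
Unshelve. all: by end_near. Qed.

Let r_bound : \forall m \near \oo, tau / 2 <= r m <= 2 * tau.
Proof.
have h : \forall m \near \oo, `|tau - r m| < tau / 2.
  by move/cvgrPdist_lt : cvg_r; apply; rewrite divr_gt0.
apply: filterS h => m; rewrite ltr_norml => /andP[h1 h2].
by apply/andP; split; lra.
Qed.

Let nat_le_sqr (n : nat) : n%:R <= n%:R ^+ 2 :> R.
Proof. by rewrite -natrX ler_nat; case: n => // n; rewrite expnS expn1 leq_pmulr. Qed.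

(** A geometric domination, uniform in m: on [0, pi/2] one has sin x >= x / 2, and
j <= j^2. *)
Let dom_X (c := pi ^+ 2 / (8 * tau)) : \forall m \near \oo, forall j,
  `|fX m j| <= wgt j * expR (- c * j%:R).
Proof.
apply: filterS r_bound => m /andP[h1 h2] j; rewrite /fX.
have w0 : 0 <= wgt j * expR (- c * j%:R) by rewrite mulr_ge0 ?wgt_ge0 ?expR_ge0.
case: ifPn => jp; last by rewrite normr0.
have /andP[a0 a1] := angle_le jp.
have pi0 := @pi_gt0 R.
have c0 : 0 <= cos ((pi : R) * j%:R / (l m)%:R).
  by apply: cos_ge0_pihalf; apply/andP; split; lra.
rewrite ger0_norm ?mulr_ge0 ?wgt_ge0 ?exprn_ge0// ler_wpM2l ?wgt_ge0//.
rewrite (le_trans (cos_pow_dom _ _)) ?a0 ?(ltW a1)// ler_expR mulNr lerN2 angle_sqr exprMn.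
have r0 : 0 < r m by rewrite (lt_le_trans _ h1)// divr_gt0.
rewrite (@le_trans _ _ (c * j%:R ^+ 2))//.
  by rewrite ler_wpM2l// divr_ge0 ?sqr_ge0// mulr_ge0// ltW.
rewrite /c [leRHS](_ : _ = pi ^+ 2 * j%:R ^+ 2 * (4 * r m)^-1); last by field; rewrite gt_eqF.
rewrite [leLHS](_ : _ = pi ^+ 2 * j%:R ^+ 2 * (8 * tau)^-1); last by field; rewrite gt_eqF.
rewrite ler_wpM2l ?mulr_ge0 ?pi_ge0//.
have q1 : 0 < 8 * tau by rewrite mulr_gt0.
have q2 : 0 < 4 * r m by rewrite mulr_gt0.
by rewrite lef_pV2 ?posrE//; move: h2; rewrite -/(r m); generalize (r m) => rm h2; lra.
Qed.

Let dom_Y (c := tau / 4) : \forall m \near \oo, forall k,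
  `|fY m k| <= wgt k * expR (- c * k%:R).
Proof.
have hm : \forall m \near \oo, (0 < m)%N by exact: nbhs_infty_gt.
near=> m.
have m0 : (0 < m)%N by near: m.
have /andP[h1 h2] : tau / 2 <= r m <= 2 * tau by near: m; exact: r_bound.
move=> k; rewrite /fY ger0_norm ?mulr_ge0 ?wgt_ge0 ?binratio_ge0//.
rewrite ler_wpM2l ?wgt_ge0// (le_trans (binratio_dom _ _ m0))// ler_expR mulNr lerN2.
rewrite (@le_trans _ _ (c * k%:R ^+ 2))//.
  by rewrite ler_wpM2l// divr_ge0// ltW.
rewrite natrM [leRHS](_ : _ = k%:R ^+ 2 * (r m / 2)); last first.
  by rewrite /r; field; rewrite gt_eqF// ltr0n.
by rewrite mulrC ler_wpM2l ?sqr_ge0// /c; lra.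
Unshelve. all: by end_near. Qed.

(** Both sides of the finite duality converge, by Tannery's theorem, so that its
normalising factor converges as well.  That factor, once multiplied by
sqrt m / l, is independent of tau. *)
Lemma jacobi_up_to_constant : exists S T : R,
  [/\ has_rsum (fun n => wgt n * expR (- (pi ^+ 2 / tau) * n%:R ^+ 2)) S,
     has_rsum (fun n => wgt n * expR (- tau * n%:R ^+ 2)) T &
     Num.sqrt m%:R * 'C(m + m, m)%:R / 2 ^+ (m + m) @[m --> \oo] -->
     S / T / Num.sqrt tau].
Proof.
have cX : 0 < pi ^+ 2 / (8 * tau) by rewrite divr_gt0 ?exprn_gt0 ?pi_gt0// mulr_gt0.
have cY : 0 < tau / 4 by rewrite divr_gt0.
have [UX hUX] := has_rsum_wgt_exp cX; have [UY hUY] := has_rsum_wgt_exp cY.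
have [S hS XS] := has_rsum_dominated_cvg hUX dom_X lim_fX has_X.
have [T hT YT] := has_rsum_dominated_cvg hUY dom_Y lim_fY has_Y.
exists S, T; split => //.
have T0 : 0 < T.
  rewrite (@lt_le_trans _ _ 1)//.
  have := has_rsum_partial [fset 0%N]%fset _ hT; rewrite big_seq_fset1.
  rewrite /wgt eqxx expr0n/= mulr0 expR0 mulr1; apply=> i.
  by rewrite mulr_ge0 ?wgt_ge0 ?expR_ge0.
have sV : Num.sqrt m%:R / (l m)%:R @[m --> \oo] --> (Num.sqrt tau)^-1.
  under eq_fun do rewrite -invf_div.
  by apply: cvgV => //; rewrite gt_eqF// sqrtr_gt0.
have YV : (Y m)^-1 @[m --> \oo] --> T^-1 by apply: cvgV => //; rewrite gt_eqF.
apply: cvg_trans (cvgM (cvgM XS YV) sV).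
apply: near_eq_cvg.
have hY : \forall m \near \oo, `|T - Y m| < T by move/cvgrPdist_lt : YT; apply.
apply: filterS hY => m; rewrite ltr_norml => /andP[_ h].
have Y0 : 0 < Y m by lra.
have d0 : 2 ^+ (m + m) != 0 :> R by rewrite expf_neq0.
rewrite /= XY; move: ('C(_, _)%:R) (2 ^+ (m + m)) d0 (l m)%:R (l0 m) (Y m) Y0.
move=> c d d0 a a0 y y0; field.
by rewrite d0 !gt_eqF.
Qed.
End fixed_tau.

(** The limit of the normalising factor is the same for tau = pi, where both theta
series coincide; this determines it. *)
Lemma jacobi_theta_nat (tau : R) : 0 < tau -> exists S T : R,
  [/\ has_rsum (fun n => wgt n * expR (- (pi ^+ 2 / tau) * n%:R ^+ 2)) S,
     has_rsum (fun n => wgt n * expR (- tau * n%:R ^+ 2)) T &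
     S = Num.sqrt (tau / pi) * T].
Proof.
move=> tau0; have pi0 := @pi_gt0 R.
have [S [T [hS hT ST]]] := jacobi_up_to_constant tau0.
have [S1 [T1 [hS1 hT1 ST1]]] := jacobi_up_to_constant pi0.
exists S, T; split => //.
have E : S / T / Num.sqrt tau = S1 / T1 / Num.sqrt pi.
  exact: (cvg_unique (@norm_hausdorff _ R) ST ST1).
have pos (u : R) V : has_rsum (fun n => wgt n * expR (u * n%:R ^+ 2)) V -> 0 < V.
  move=> hV; rewrite (@lt_le_trans _ _ 1)//.
  have := has_rsum_partial [fset 0%N]%fset _ hV; rewrite big_seq_fset1.
  rewrite /wgt eqxx expr0n/= mulr0 expR0 mulr1; apply=> i.
  by rewrite mulr_ge0 ?wgt_ge0 ?expR_ge0.
(* At tau = pi both exponents are equal. *)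
have ST11 : S1 = T1.
  apply: (has_rsum_uniq hS1); apply: eq_has_rsum hT1 => n.
  by rewrite expr2 mulfK ?gt_eqF.
rewrite {}ST11 divff ?gt_eqF ?(pos _ _ hT1)// mul1r in E.
have T0 : T != 0 by rewrite gt_eqF ?(pos _ _ hT).
have s0 : Num.sqrt tau != 0 by rewrite gt_eqF// sqrtr_gt0.
rewrite sqrtrM ?(ltW tau0)// sqrtrV ?(ltW pi0)//.
transitivity (S / T / Num.sqrt tau * Num.sqrt tau * T); first by rewrite divfK// divfK.
by rewrite E; ring.
Qed.

(** The previous formula with tau = pi t, unfolded to a sum over int. *)
Lemma jacobi_theta (t : R) : 0 < t -> exists S T : R,
  [/\ has_rsum (fun n : int => expR (- (pi * n%:~R ^+ 2 / t))) S,
     has_rsum (fun n : int => expR (- (pi * n%:~R ^+ 2 * t))) T &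
     S = Num.sqrt t * T].
Proof.
move=> t0; have pi0 := @pi_gt0 R.
have [S [T [hS hT E]]] := jacobi_theta_nat (mulr_gt0 pi0 t0).
exists S, T; split; last 1 first.
- by rewrite E mulrAC divff ?gt_eqF// mul1r.
- apply: eq_has_rsum (has_rsum_even _ hS) => [n /=|n]; last exact: expR_ge0.
  rewrite natr_absz intr_norm real_normK ?num_real//; congr expR.
  by move: (pi : R) pi0 => P P0; field; rewrite ?gt_eqF.
- have := @has_rsum_even _ (fun n => expR (- (pi * t) * n%:R ^+ 2)) _ (fun=> expR_ge0 _) hT.
  apply: eq_has_rsum => n /=.
  rewrite natr_absz intr_norm real_normK ?num_real//; congr expR.
  by move: (pi : R) pi0 => P P0; field; rewrite ?gt_eqF.
Qed.
End Jacobi.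

(** * Theta series with polynomial weights *)

(** A derivative follows from a second-order remainder.  The statement is over any
numeric field, for real and complex derivatives alike: series and integrals are
differentiated by summing or integrating a pointwise remainder. *)
Lemma is_derive_of_quadratic_bound (K : numFieldType) (f : K^o -> K^o) (x l C rho : K) :
  0 < rho -> 0 <= C -> (forall h : K, `|h| < rho -> `|f (x + h) - f x - h * l| <= C * `|h| ^+ 2) ->
  is_derive (x : K^o) (1 : K^o) f l.
Proof.
move=> rho0 C_ge0 hf.
have H : h^-1 *: ((f \o shift x) (h *: (1 : K^o)) - f x) @[h --> (0 : K^o)^'] --> (l : K^o).
  apply/cvgrPdist_lt => e e0.
  have C0 : 0 < C + 1 by rewrite ltr_wpDl.
  near=> h.
  have h0 : h != 0 by near: h; exact: nbhs_dnbhs_neq.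
  have n0 : 0 < `|h| by rewrite normr_gt0.
  have hr : `|h| < rho by near: h; apply: dnbhs0_lt.
  have he : `|h| < e / (C + 1) by near: h; apply: dnbhs0_lt; rewrite divr_gt0.
  have := hf h hr.
  rewrite /= /shift /GRing.scale/= mulr1 (addrC h) => B.
  have -> : l - h^-1 * (f (x + h) - f x) = - (h^-1 * (f (x + h) - f x - h * l)).
    by rewrite (mulrBr h^-1 _ (h * l)) mulKf// opprB.
  rewrite normrN normrM normfV -ltr_pdivlMl ?invr_gt0// invrK.
  rewrite (le_lt_trans B)// expr2 mulrA mulrC ltr_pM2l//.
  rewrite (@le_lt_trans _ _ ((C + 1) * `|h|))//; last by rewrite mulrC -ltr_pdivlMr.
  by rewrite ler_wpM2r// lerDl ler01.
by apply: DeriveDef; [apply/cvg_ex; exists l|exact: cvg_lim].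
Unshelve. all: by end_near. Qed.

Section ExpBounds.
Variable R : realType.
Implicit Types x a : R.

Lemma expR_taylor1 a : `|expR a - 1 - a| <= a ^+ 2 * expR `|a|.
Proof.
have h1 : 1 + a <= expR a by apply: expR_ge1Dx.
have h2 : expR a - 1 <= a * expR a.
  have : 1 - a <= expR (- a) by apply: expR_ge1Dx.
  rewrite expRN -(ler_pM2r (expR_gt0 a)) mulVf ?gt_eqF ?expR_gt0//; lra.
rewrite ger0_norm; last by lra.
have [a0|a0] := leP 0 a.
  rewrite (@le_trans _ _ (a * (a * expR a)))//; last by rewrite mulrA -expr2 ger0_norm.
  rewrite (@le_trans _ _ (a * (expR a - 1)))//; first by lra.
  by rewrite ler_wpM2l.
rewrite ltr0_norm// (@le_trans _ _ (a ^+ 2))//.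
  rewrite (@le_trans _ _ (a * (expR a - 1)))//; first by lra.
  by rewrite expr2 ler_wnM2l ?(ltW a0)//; lra.
by rewrite ler_peMr ?sqr_ge0// -[leLHS]expR0 ler_expR; lra.
Qed.

Lemma pow_le_expR m x : 0 <= x -> x ^+ m <= m`!%:R * expR x.
Proof.
move=> x0; case: m => [|m].
  by rewrite expr0 fact0 mul1r -[leLHS]expR0 ler_expR.
have := expR_ge1Dxn m x0 => h.
rewrite mulrC -ler_pdivrMr ?ltr0n ?fact_gt0//; lra.
Qed.
End ExpBounds.

Section Theta.
Variable R : realType.
Implicit Types (t : R) (n : int) (p : {poly R}).

Definition rsum (I : choiceType) (f : I -> R) : R := xget 0 [set s | has_rsum f s].

Lemma has_rsumE (I : choiceType) (f : I -> R) S : has_rsum f S -> rsum f = S.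
Proof. by move=> fS; apply: xget_unique => // s sS; exact: has_rsum_uniq sS fS. Qed.

Lemma has_rsumP (I : choiceType) (f : I -> R) S : has_rsum f S -> has_rsum f (rsum f).
Proof. by move=> fS; rewrite (has_rsumE fS). Qed.

(** The weight is a power of n^2, not of n: only even exponents occur, and
differentiation in t raises m by one. *)
Definition thterm m t n : R := (n%:~R ^+ 2) ^+ m * expR (- (pi * n%:~R ^+ 2 * t)).
Definition theta m t : R := rsum (thterm m t).

Lemma thterm_ge0 m t n : 0 <= thterm m t n.
Proof. by rewrite mulr_ge0 ?expR_ge0// exprn_ge0// sqr_ge0. Qed.

Lemma int_norm_le_sqr n : `|n%:~R| <= n%:~R ^+ 2 :> R.
Proof.
rewrite -intr_norm -[leRHS]real_normK ?num_real// -intr_norm -natr_absz -natrX ler_nat.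
by case: (absz n) => // k; rewrite expnS expn1 leq_pmulr.
Qed.

Lemma has_theta m t : 0 < t -> has_rsum (thterm m t) (theta m t).
Proof.
move=> t0; have pi0 := @pi_gt0 R.
(* Half of the exponential decay absorbs the power of n^2, the other half is summed. *)
set c := pi * t / 2; have c0 : 0 < c by rewrite divr_gt0// mulr_gt0.
have [U hU] := has_rsum_wgt_exp c0.
have {}hU := has_rsum_even (fun=> expR_ge0 _) hU.
have {}hU := has_rsumZ (m`!%:R / c ^+ m) hU.
have [S hS] : exists S, has_rsum (thterm m t) S.
  apply: (has_rsum_dom hU) => n; rewrite ger0_norm ?thterm_ge0//.
  set y : R := n%:~R ^+ 2; have y0 : 0 <= y by apply: sqr_ge0.
  have h := pow_le_expR m (mulr_ge0 (ltW c0) y0).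
  rewrite exprMn -ler_pdivlMl ?exprn_gt0// mulrA [_^-1 * _]mulrC in h.
  rewrite /thterm -/y (le_trans (ler_wpM2r (expR_ge0 _) h))// -[leLHS]mulrA ler_wpM2l ?divr_ge0 ?exprn_ge0 ?(ltW c0)//.
  rewrite -expRD ler_expR natr_absz.
  have : `|n|%:~R <= y by rewrite intr_norm; exact: int_norm_le_sqr.
  rewrite -(ler_pM2l c0) /c; lra.
exact: has_rsumP hS.
Qed.

(** Termwise differentiation.  The second-order remainder of exp at - pi n^2 t, for
|h| < t / 2, is dominated by the theta series of weight m + 2 at t / 2. *)
Lemma is_derive_theta m t : 0 < t -> is_derive t 1 (theta m) (- pi * theta m.+1 t).
Proof.
move=> t0; have pi0 := @pi_gt0 R; have t20 : 0 < t / 2 by rewrite divr_gt0.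
apply: (@is_derive_of_quadratic_bound R _ t _ (pi ^+ 2 * theta m.+2 (t / 2)) (t / 2)) => // [|h ht].
  by rewrite mulr_ge0 ?exprn_ge0 ?(ltW pi0)// (has_rsum_ge0 _ (has_theta _ t20))// => n; exact: thterm_ge0.
have th0 : 0 < t + h by move: ht; rewrite ltr_norml => /andP[]; lra.
have hS := has_rsumB (has_rsumB (has_theta m th0) (has_theta m t0))
  (has_rsumZ h (has_rsumZ (- pi) (has_theta m.+1 t0))).
have hU := has_rsumZ (pi ^+ 2 * `|h| ^+ 2) (has_theta m.+2 t20).
rewrite mulrAC; apply: (has_rsum_norm_le hU _ hS) => n /=.
rewrite /thterm; set y : R := n%:~R ^+ 2; have y0 : 0 <= y by apply: sqr_ge0.
rewrite [X in `|X|](_ : _ = y ^+ m * expR (- (pi * y * t)) *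
   (expR (- (pi * y * h)) - 1 - (- (pi * y * h)))); last first.
  by rewrite (mulrDr (pi * y)) opprD expRD exprS; ring.
have A0 : 0 <= y ^+ m * expR (- (pi * y * t)) by rewrite mulr_ge0 ?(exprn_ge0 _ y0) ?expR_ge0.
rewrite normrM (ger0_norm A0) (le_trans (ler_wpM2l A0 (expR_taylor1 _)))//.
rewrite [leLHS](_ : _ = pi ^+ 2 * `|h| ^+ 2 * (y ^+ m.+2 * (expR (- (pi * y * t)) * expR `|- (pi * y * h)|))); last first.
  rewrite real_normK ?num_real// (_ : y ^+ m.+2 = y ^+ m * y ^+ 2); last by rewrite -exprD addn2.
  by move: (expR `|_|) => E; ring.
have B0 : 0 <= pi ^+ 2 * `|h| ^+ 2 :> R by rewrite mulr_ge0 ?sqr_ge0 ?exprn_ge0.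
rewrite (ler_wpM2l B0)// (ler_wpM2l (exprn_ge0 _ y0))// -expRD ler_expR.
rewrite normrN normrM (ger0_norm (mulr_ge0 (ltW pi0) y0)).
have := ler_wpM2l (mulr_ge0 (ltW pi0) y0) (ltW ht); lra.
Qed.
End Theta.

(** * Inversion of the weighted theta series *)

Lemma is_derive_pow (R : realType) (f : R -> R) (x l : R) n : is_derive x 1 f l ->
  is_derive x 1 (fun y => f y ^+ n) (n%:R * f x ^+ n.-1 * l).
Proof. by move=> df; rewrite -exprfctE; apply: is_deriveX. Qed.

Section ThetaPoly.
Variable R : realType.
Implicit Types (t : R) (n : int) (p : {poly R}).

Definition polyterm p t n : R :=
  p.[pi * n%:~R ^+ 2 * t] * expR (- (pi * n%:~R ^+ 2 * t)).

(** The theta series weighted by a polynomial in pi n^2 t, written as a combination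
of the series theta i so that its derivative is known. *)
Definition Ltheta p t : R := \sum_(i < size p) p`_i * ((pi * t) ^+ i * theta i t).

Lemma has_rsum_polyterm p t : 0 < t -> has_rsum (polyterm p t) (Ltheta p t).
Proof.
move=> t0; have h : has_rsum (fun n => \sum_(i < size p) p`_i * ((pi * t) ^+ i * thterm i t n)) (Ltheta p t).
  by apply: has_rsum_sum => i; apply: has_rsumZ; apply: has_rsumZ; apply: has_theta.
apply: eq_has_rsum h => n; rewrite /polyterm horner_coef mulr_suml.
apply: eq_bigr => i _; rewrite /thterm -[RHS]mulrA; congr (_ * _).
rewrite [LHS]mulrA -exprMn; congr (_ ^+ _ * _); ring.
Qed.

(** This operator is the effect of t d/dt on the factor p of p (y) exp (- y), for y
proportional to t. *)
Lemma poly_euler p (y : R) : ('X * p^`() - 'X * p).[y] =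
  \sum_(i < size p) p`_i * (i%:R * y ^+ i - y ^+ i.+1).
Proof.
rewrite hornerD hornerN !hornerM hornerX.
have -> : p^`() = \sum_(i < size p) p`_i *: ('X^i)^`().
  rewrite -{1}[p]coefK poly_def raddf_sum /=.
  by apply: eq_bigr => i _; rewrite derivZ.
rewrite [p.[y]]horner_coef horner_sum !mulr_sumr -sumrB; apply: eq_bigr => i _.
rewrite hornerZ derivXn hornerMn hornerXn -mulr_natl exprS.
case: (nat_of_ord i) => [|k] /=; first by rewrite !expr0; ring.
by rewrite exprS; ring.
Qed.

Lemma is_derive_Ltheta p t : 0 < t ->
  is_derive t 1 (Ltheta p) (t^-1 * Ltheta ('X * p^`() - 'X * p) t).
Proof.
move=> t0.
(* D i is t times the derivative of the i-th summand. *)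
pose D (i : nat) := i%:R * ((pi * t) ^+ i * theta i t) - (pi * t) ^+ i.+1 * theta i.+1 t.
have E : Ltheta ('X * p^`() - 'X * p) t = \sum_(i < size p) p`_i * D i.
  apply: (has_rsum_uniq (has_rsum_polyterm _ t0)).
  have h : has_rsum (fun n => \sum_(i < size p) p`_i *
     (i%:R * ((pi * t) ^+ i * thterm i t n) - (pi * t) ^+ i.+1 * thterm i.+1 t n))
     (\sum_(i < size p) p`_i * D i).
    apply: has_rsum_sum => i; apply: has_rsumZ; apply: has_rsumB.
      by apply: has_rsumZ; apply: has_rsumZ; apply: has_theta.
    by apply: has_rsumZ; apply: has_theta.
  apply: eq_has_rsum h => n; rewrite /polyterm poly_euler mulr_suml.
  apply: eq_bigr => i _; rewrite /thterm -[RHS]mulrA; congr (_ * _).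
  rewrite (_ : pi * n%:~R ^+ 2 * t = (pi * t) * n%:~R ^+ 2); last by ring.
  set e := expR _; set u := _ * t; set y := _%:~R ^+ 2.
  clearbody e u y.
  by rewrite !exprMn !exprS; ring.
have dF (i : 'I_(size p)) : is_derive t 1 (fun t => p`_i * ((pi * t) ^+ i * theta i t))
     (p`_i * (t^-1 * D i)).
  have dth := is_derive_theta i t0.
  have dp : is_derive t 1 (fun t => (pi * t) ^+ i) (i%:R * (pi * t) ^+ i.-1 * pi).
    by apply: is_derive_pow; apply: is_derive_eq; rewrite /GRing.scale/=; move: (pi : R) => P; ring.
  apply: is_derive_eq; rewrite /GRing.scale/= /D.
  move: (theta _ _) (theta _ _) (pi : R) => u v P.
  case: (nat_of_ord i) => [|k] /=; rewrite ?expr0 ?expr1 ?exprS; field; by rewrite gt_eqF.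
rewrite E mulr_sumr.
have -> : Ltheta p = \sum_(i < size p) (fun t => p`_i * ((pi * t) ^+ i * theta i t)).
  by apply/funext => s; rewrite /Ltheta fct_sumE.
have -> : \sum_(i < size p) t^-1 * (p`_i * D i) = \sum_(i < size p) p`_i * (t^-1 * D i).
  by apply: eq_bigr => i _; ring.
exact: is_derive_sum.
Qed.

(** These polynomials in y = x^2 are the Hermite polynomials of order 2 m.  The
recurrence is the one which differentiation of the inversion formula imposes. *)
Fixpoint hermite_sqr m : {poly R} :=
  if m is m'.+1 then
    (-4) *: ((m'%:R + 2^-1) *: hermite_sqr m' + ('X * (hermite_sqr m')^`() - 'X * hermite_sqr m'))
  else 1.

Lemma LthetaD p q t : 0 < t -> Ltheta (p + q) t = Ltheta p t + Ltheta q t.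
Proof.
move=> t0; apply: (has_rsum_uniq (has_rsum_polyterm _ t0)).
apply: eq_has_rsum (has_rsumD (has_rsum_polyterm p t0) (has_rsum_polyterm q t0)) => n.
by rewrite /polyterm hornerD [RHS]mulrDl.
Qed.

Lemma LthetaZ (c : R) p t : 0 < t -> Ltheta (c *: p) t = c * Ltheta p t.
Proof.
move=> t0; apply: (has_rsum_uniq (has_rsum_polyterm _ t0)).
apply: eq_has_rsum (has_rsumZ c (has_rsum_polyterm p t0)) => n.
by rewrite /polyterm hornerZ [LHS]mulrA.
Qed.

(** By induction on m.  The derivative in t of the left hand side is
pi t^-2 theta (m + 1) (1/t); the derivative of the right hand side is
t^-1 (m + 1/2 + the operator y p' - y p) applied to the polynomial, which is the
recurrence up to the factor -4. *)
Theorem theta_inversion m t : 0 < t ->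
  theta m t^-1 = (- (4 * pi)^-1) ^+ m * Num.sqrt t * t ^+ m * Ltheta (hermite_sqr m) t.
Proof.
have pi0 := @pi_gt0 R.
elim: m t => [|m IH] t t0.
  have [S [T [hS hT E]]] := jacobi_theta t0.
  rewrite /hermite_sqr !expr0 mul1r mulr1 /Ltheta size_poly1 big_ord1 coefC eqxx expr0 !mul1r.
  rewrite (_ : theta 0 t^-1 = S); last first.
    apply: has_rsumE; apply: eq_has_rsum hS => n.
    by rewrite /thterm expr0 mul1r.
  rewrite E; congr (_ * _); apply/esym/has_rsumE; apply: eq_has_rsum hT => n.
  by rewrite /thterm expr0 mul1r.
have tV0 : 0 < t^-1 by rewrite invr_gt0.
pose c : R := (- (4 * pi)^-1) ^+ m.
have d1 : is_derive t 1 (fun t => theta m t^-1) (- pi * theta m.+1 t^-1 * (- t ^- 2)).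
  apply: (@is_derive1_comp _ (theta m) (fun t => t^-1)); first exact: is_derive_theta.
  by apply: is_derive_eq; first (by apply: is_deriveV; rewrite gt_eqF); rewrite /GRing.scale/= mulr1.
have d2 : is_derive t 1 (fun t => c * Num.sqrt t * t ^+ m * Ltheta (hermite_sqr m) t)
   (c * Num.sqrt t * t ^+ m * (t^-1 * (- 4^-1 * Ltheta (hermite_sqr m.+1) t))).
  have ds := is_derive1_sqrt t0.
  have dp : is_derive t 1 (fun t => t ^+ m) (m%:R * t ^+ m.-1 * 1) by apply: is_derive_pow.
  have dL := is_derive_Ltheta (hermite_sqr m) t0.
  have E1 : Ltheta (hermite_sqr m.+1) t = -4 * ((m%:R + 2^-1) * Ltheta (hermite_sqr m) t +
      Ltheta ('X * (hermite_sqr m)^`() - 'X * hermite_sqr m) t).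
    apply: etrans (LthetaZ _ _ t0) _; congr (_ * _).
    by apply: etrans (LthetaD _ _ t0) _; congr (_ + _); exact: LthetaZ.
  apply: is_derive_eq; rewrite E1.
  have s0 : 0 < Num.sqrt t by rewrite sqrtr_gt0.
  have st : t = Num.sqrt t ^+ 2 by rewrite sqr_sqrtr// ltW.
  rewrite /GRing.scale/=; set L1 := Ltheta (_ - _) t; set L2 := Ltheta (hermite_sqr m) t.
  move: st s0; move: (Num.sqrt t) => s -> s0.
  case: (m) => [|k] /=; rewrite ?expr0 ?exprS; field; by rewrite gt_eqF.
have d3 : is_derive t 1 (fun t => theta m t^-1)
   (c * Num.sqrt t * t ^+ m * (t^-1 * (- 4^-1 * Ltheta (hermite_sqr m.+1) t))).
  apply: near_eq_is_derive d2; near=> s.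
  by rewrite IH//; near: s; exact: lt_nbhsr.
have := @derive_val _ _ _ _ _ _ _ d1; rewrite (@derive_val _ _ _ _ _ _ _ d3) => E.
(* The equality of the two derivatives is solved for theta m.+1. *)
have -> : theta m.+1 t^-1 = - pi * theta m.+1 t^-1 * - t ^- 2 * (t ^+ 2 / pi).
  by move: (pi : R) pi0 => P P0; field; rewrite !gt_eqF.
rewrite -E !exprS /c.
by move: (pi : R) pi0 => P P0; field; rewrite !gt_eqF.
Unshelve. all: by end_near. Qed.
End ThetaPoly.

(** * Hermite polynomials of even order *)

Section HermitePoly.
Variable R : realType.
Implicit Types (x t : R).

Lemma is_derive_horner (p : {poly R}) x : is_derive x 1 (horner p) p^`().[x].
Proof.
elim/poly_ind: p x => [|p c IH] x.
  have -> : horner (0 : {poly R}) = fun=> 0 by apply/funext => y; rewrite horner0.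
  by rewrite deriv0 horner0; exact: is_derive_cst.
have -> : horner (p * 'X + c%:P) = fun y => p.[y] * y + c.
  by apply/funext => y; rewrite hornerMXaddC.
have dp := IH x.
apply: is_derive_eq; rewrite /GRing.scale/= derivMXaddC hornerD hornerMX; ring.
Qed.

(** The polynomial factor of the n-th derivative of exp (- x^2); this is the Hermite
polynomial of order n up to the sign (-1)^n. *)
Fixpoint gauss_poly (n : nat) : {poly R} :=
  if n is n'.+1 then (gauss_poly n')^`() - 2 *: ('X * gauss_poly n') else 1.

Definition gauss_deriv n x : R := (gauss_poly n).[x] * expR (- x ^+ 2).

Lemma is_derive_gauss_deriv n x : is_derive x 1 (gauss_deriv n) (gauss_deriv n.+1 x).
Proof.
have dp := is_derive_horner (gauss_poly n) x.
have de : is_derive x 1 (fun x => expR (- x ^+ 2)) (expR (- x ^+ 2) * (- (2 * x))).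
  apply: (@is_derive1_comp _ expR (fun x => - x ^+ 2)).
  by apply: is_derive_eq; rewrite /GRing.scale/=; ring.
apply: is_derive_eq; rewrite /GRing.scale/= /gauss_deriv/= hornerD hornerN hornerZ hornerM hornerX.
ring.
Qed.

(** The relation H_(n+1)' = 2 (n + 1) H_n, which turns the first-order recurrence
into a three-term one. *)
Lemma deriv_gauss_polyS n : (gauss_poly n.+1)^`() = - (2 * n.+1%:R) *: gauss_poly n.
Proof.
elim: n => [|n IH].
  by rewrite /= mulr1 derivB derivZ derivX derivC deriv0 sub0r mulr1 scaleNr.
rewrite [gauss_poly n.+2]/= -/(gauss_poly n.+1) derivB derivZ derivM derivX mul1r IH derivZ.
have -> : (gauss_poly n)^`() = gauss_poly n.+1 + 2 *: ('X * gauss_poly n) by rewrite /= subrK.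
move: (gauss_poly n.+1) (gauss_poly n) => G g; rewrite -[n.+2%:R]natr1 -!mul_polyC.
move: (n.+1%:R : R) => a; rewrite !(polyCN, polyCD, polyCM); ring.
Qed.

(** Two steps of the recurrence of gauss_poly, simplified with its derivative, are
one step of the recurrence of hermite_sqr composed with x^2. *)
Lemma gauss_poly_even m x : (gauss_poly (m + m)).[x] = (hermite_sqr R m).[x ^+ 2].
Proof.
suff : gauss_poly (m + m) = hermite_sqr R m \Po 'X^2 by move=> ->; rewrite horner_comp hornerXn.
elim: m => [|m IH]; first by rewrite /= comp_polyC.
rewrite addSn addnS.
have -> : gauss_poly (m + m).+2 = (gauss_poly (m + m).+1)^`() - 2 *: ('X * gauss_poly (m + m).+1) by [].
rewrite deriv_gauss_polyS.
have -> : gauss_poly (m + m).+1 = (gauss_poly (m + m))^`() - 2 *: ('X * gauss_poly (m + m)) by [].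
rewrite /= IH deriv_comp derivXn /= expr1.
rewrite comp_polyZ comp_polyD comp_polyZ comp_polyB !comp_polyM comp_polyX.
move: (hermite_sqr R m \Po _) ((hermite_sqr R m)^`() \Po _) => P P'.
have -> : 2 * (m + m).+1%:R = 2 * 2 * (m%:R + 2^-1) :> R.
  by rewrite -(natr1 (m + m)) natrD; field.
rewrite -!mul_polyC; move: (m%:R + 2^-1 : R) => b.
have -> : -4 = - (2 * 2) :> R by ring.
rewrite !(polyCN, polyCM) (_ : 2%:P = 2 :> {poly R}); last by rewrite rmorph_nat.
move: (b%:P) => {}b.
ring.
Qed.

End HermitePoly.

Section HermiteMulti.
Variables (R : realType) (d : nat).
Implicit Types (x y : 'rV[R]_d) (kappa : 'I_d -> nat).

Definition gaussprod kappa x : R := \prod_(j < d) gauss_deriv (kappa j) (x 0 j).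

(** A product of functions of separate variables is differentiated in one
coordinate at a time, the others being constants. *)
Lemma derive_gaussprod kappa (j : 'I_d) :
  (fun x => 'D_(delta_mx 0 j) (gaussprod kappa) x) =
  gaussprod (fun i => kappa i + (i == j))%N.
Proof.
apply/funext => x.
pose c := \prod_(i < d | i != j) gauss_deriv (kappa i) (x 0 i).
have E (s : R) : gaussprod kappa (s *: delta_mx 0 j + x) = c * gauss_deriv (kappa j) (s + x 0 j).
  rewrite /gaussprod (bigD1 j)//= mulrC !mxE !eqxx mulr1; congr (_ * _).
  apply: eq_bigr => i ij; rewrite !mxE eqxx /= (negbTE ij).
  by rewrite mulr0 add0r.
have dg := is_derive_gauss_deriv (kappa j) (x 0 j).
have dc : is_derive (x 0 j) 1 (fun s => c * gauss_deriv (kappa j) s) (c * gauss_deriv (kappa j).+1 (x 0 j)).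
  by apply: is_derive_eq; rewrite /GRing.scale/=; ring.
have -> : 'D_(delta_mx 0 j) (gaussprod kappa) x = 'D_1 (fun s => c * gauss_deriv (kappa j) s) (x 0 j).
  apply: (congr1 (fun f : R -> R => lim (f h @[h --> 0^']))); apply/funext => h.
  rewrite /= /shift /= E [h *: 1]mulr1; congr (_ *: (_ - _)).
  by have := E 0; rewrite scale0r !add0r.
rewrite derive_val /gaussprod [RHS](bigD1 j)//= eqxx addn1 mulrC; congr (_ * _).
by apply: eq_bigr => i /negbTE ->; rewrite addn0.
Qed.

Lemma iter_derive_gaussprod n kappa (j : 'I_d) :
  iter n (fun h : 'rV[R]_d -> R => 'D_(delta_mx 0 j) h) (gaussprod kappa) =
  gaussprod (fun i => kappa i + n * (i == j))%N.
Proof.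
elim: n => [|n IH] /=.
  by congr gaussprod; apply/funext => i; rewrite mul0n addn0.
rewrite IH derive_gaussprod; congr gaussprod; apply/funext => i.
by rewrite -addnA mulSn [(n * _ + _)%N]addnC.
Qed.

Lemma enorm_sqr x : enorm x ^+ 2 = \sum_(j < d) x 0 j ^+ 2.
Proof. by rewrite sqr_sqrtr// sumr_ge0// => j _; apply: sqr_ge0. Qed.

Lemma expRN_enorm x : expR (- enorm x ^+ 2) = \prod_(j < d) expR (- x 0 j ^+ 2).
Proof. by rewrite enorm_sqr -sumrN expR_sum. Qed.

Lemma partial_derive_gauss (gamma : 'rV[nat]_d) x :
  partial_derive gamma (fun y => expR (- enorm y ^+ 2)) x =
  gaussprod (fun j => gamma 0 j) x.
Proof.
rewrite /partial_derive.
have -> : (fun y => expR (- enorm y ^+ 2)) = gaussprod (fun=> 0%N).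
  by apply/funext => y; rewrite expRN_enorm; apply: eq_bigr => j _; rewrite /gauss_deriv hornerC mul1r.
suff E s : uniq s -> foldr (fun (j : 'I_d) (g : 'rV[R]_d -> R) =>
    iter (gamma 0 j) (fun h : 'rV[R]_d -> R => 'D_(delta_mx 0 j) h) g)
    (gaussprod (fun=> 0%N)) s = gaussprod (fun j => if j \in s then gamma 0 j else 0%N).
  rewrite E ?enum_uniq//; congr (gaussprod _ _); apply/funext => j.
  by rewrite mem_enum.
elim: s => [//|k s IH] /= /andP[ks us].
rewrite (IH us) iter_derive_gaussprod; congr gaussprod; apply/funext => i.
rewrite inE; have [->|ik] := eqVneq i k; first by rewrite (negbTE ks) add0n muln1.
by rewrite muln0 addn0.
Qed.

Lemma Hermite_prod (gamma : 'rV[nat]_d) x :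
  Hermite gamma x = (-1) ^+ norm1 gamma * \prod_(j < d) (gauss_poly R (gamma 0 j)).[x 0 j].
Proof.
rewrite /Hermite partial_derive_gauss -mulrA; congr (_ * _).
rewrite /gaussprod big_split/= -expRN_enorm mulrCA -expRD subrr expR0 mulr1//.
Qed.

Lemma Hermite_even (alpha : 'rV[nat]_d) x :
  Hermite (alpha *+ 2) x = \prod_(j < d) (hermite_sqr R (alpha 0 j)).[x 0 j ^+ 2].
Proof.
have E j : (alpha *+ 2) 0 j = (alpha 0%R j + alpha 0%R j)%N by rewrite mulmxnE.
rewrite Hermite_prod; have -> : norm1 (alpha *+ 2) = (norm1 alpha * 2)%N.
  by rewrite /norm1 big_distrl/=; apply: eq_bigr => j _; rewrite E addnn muln2.
rewrite mulnC exprM sqrrN expr1n expr1n mul1r.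
by apply: eq_bigr => j _; rewrite E gauss_poly_even.
Qed.

Lemma hermite_sqr0_neq0 m : (hermite_sqr R m).[0] != 0.
Proof.
elim: m => [|m IH]; first by rewrite hornerC oner_neq0.
rewrite /= hornerZ hornerD hornerZ hornerD hornerN !hornerM hornerX !mul0r subrr addr0.
by rewrite !mulf_neq0 ?oppr_eq0 ?pnatr_eq0// gt_eqF// ltr_wpDl.
Qed.

Lemma Hermite_even0_neq0 (alpha : 'rV[nat]_d) : Hermite (alpha *+ 2) (0 : 'rV[R]_d) != 0.
Proof.
rewrite Hermite_even; apply/prodf_neq0 => j _.
by rewrite mxE expr0n hermite_sqr0_neq0.
Qed.
End HermiteMulti.

(** * Theta series over the lattice *)

Section LatticeProduct.
Variables (R : realType) (d : nat).
Implicit Types (f u : 'I_d -> int -> R) (n : 'rV[int]_d) (N : nat).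

(** The lattice points with coordinates in [- N, N]: on a box the sum of a product
is the product of the sums. *)
Definition box N : {fset 'rV[int]_d} :=
  seq_fset tt [seq (\row_j val (g j) : 'rV[int]_d) | g : {ffun 'I_d -> zwin N} <- enum {ffun 'I_d -> zwin N}].

Lemma in_box N n : (n \in box N) = [forall j, n 0 j \in zwin N].
Proof.
rewrite seq_fsetE; apply/mapP/forallP => [[g _ ->] j|h]; first by rewrite mxE fsvalP.
exists [ffun j => [` h j]%fset]; first by rewrite mem_enum.
by apply/rowP => j; rewrite mxE ffunE.
Qed.

Lemma sum_box f N : \sum_(n <- box N) \prod_(j < d) f j (n 0 j) =
  \prod_(j < d) \sum_(k <- zwin N) f j k.
Proof.
rewrite (perm_big _ (seq_fset_perm _ _)) undup_id; last first.
  rewrite map_inj_uniq ?enum_uniq// => g h /rowP gh; apply/ffunP => j.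
  by apply/val_inj; have := gh j; rewrite !mxE.
rewrite big_map big_enum/=.
under [RHS]eq_bigr do rewrite big_seq_fsetE/=.
rewrite bigA_distr_bigA/=; apply: eq_bigr => g _.
by apply: eq_bigr => j _; rewrite mxE.
Qed.

Lemma sub_box (A : {fset 'rV[int]_d}) : exists N, (A `<=` box N)%fset.
Proof.
exists (\max_(n <- A) \max_(j < d) absz (n 0%R j))%N; apply/fsubsetP => n nA.
rewrite in_box; apply/forallP => j; rewrite in_zwin (big_fsetD1 n)//=.
apply: leq_trans (leq_maxl _ _).
exact: (leq_bigmax (F := fun j => absz (n 0%R j))).
Qed.

Lemma near_in_box n : \forall N \near \oo, n \in box N.
Proof.
exists (\max_(j < d) absz (n 0%R j))%N => // N /= hN; rewrite in_box.
apply/forallP => j; rewrite in_zwin (leq_trans _ hN)//.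
exact: (leq_bigmax (F := fun j => absz (n 0%R j))).
Qed.

Lemma cvg_sum_box f (S : 'I_d -> R) : (forall j, has_rsum (f j) (S j)) ->
  \sum_(n <- box N) \prod_(j < d) f j (n 0 j) @[N --> \oo] --> \prod_(j < d) S j.
Proof.
move=> fS; under eq_fun do rewrite sum_box.
apply: cvg_big => [|j _]; first exact: mul_continuous.
exact: has_rsum_cvg (fS j) near_in_zwin.
Qed.

(** Sums over boxes are products of partial sums, and boxes exhaust the lattice. *)
Lemma has_rsum_prod_ge0 u (U : 'I_d -> R) : (forall j k, 0 <= u j k) ->
  (forall j, has_rsum (u j) (U j)) ->
  has_rsum (fun n => \prod_(j < d) u j (n 0 j)) (\prod_(j < d) U j).
Proof.
move=> u0 uU.
have p0 n : 0 <= \prod_(j < d) u j (n 0 j) by apply: prodr_ge0 => j _.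
have [V hV] : exists V, has_rsum (fun n => \prod_(j < d) u j (n 0 j)) V.
  apply: (@has_rsum_bounded _ _ _ (\prod_(j < d) U j)) => // A.
  have [N AN] := sub_box A; rewrite (le_trans (fset_sum_le p0 AN))// sum_box.
  apply: ler_prod => j _; rewrite sumr_ge0//=.
  exact: has_rsum_partial (uU j).
suff -> : \prod_(j < d) U j = V by [].
exact: (cvg_unique (@norm_hausdorff _ R) (cvg_sum_box uU) (has_rsum_cvg hV near_in_box)).
Qed.

Lemma has_rsum_prod f u (S U : 'I_d -> R) : (forall j k, `|f j k| <= u j k) ->
  (forall j, has_rsum (u j) (U j)) -> (forall j, has_rsum (f j) (S j)) ->
  has_rsum (fun n => \prod_(j < d) f j (n 0 j)) (\prod_(j < d) S j).
Proof.
move=> fu uU fS.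
have u0 j k : 0 <= u j k by apply: le_trans (fu j k).
have [V hV] : exists V, has_rsum (fun n => \prod_(j < d) f j (n 0 j)) V.
  apply: (has_rsum_dom (has_rsum_prod_ge0 u0 uU)) => n.
  by rewrite normr_prod; apply: ler_prod => j _; rewrite normr_ge0 fu.
suff -> : \prod_(j < d) S j = V by [].
exact: (cvg_unique (@norm_hausdorff _ R) (cvg_sum_box fS) (has_rsum_cvg hV near_in_box)).
Qed.
End LatticeProduct.

Section PolyBound.
Variable R : realType.

(** Each y^i is absorbed by exp (y / 2), at the cost of i! 2^i. *)
Lemma poly_expR_bound (p : {poly R}) : exists2 C : R, 0 <= C &
  forall y, 0 <= y -> `|p.[y]| * expR (- y) <= C * expR (- (y / 2)).
Proof.
exists (\sum_(i < size p) `|p`_i| * (i`!%:R * 2 ^+ i)).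
  by apply: sumr_ge0 => i _; rewrite !mulr_ge0.
move=> y y0; have E : expR (- y) = expR (- (y / 2)) * expR (- (y / 2)).
  by rewrite -expRD; congr expR; field.
rewrite E mulrA ler_wpM2r ?expR_ge0// horner_coef expRN ler_pdivrMr ?expR_gt0//.
rewrite (le_trans (ler_norm_sum _ _ _))// mulr_suml; apply: ler_sum => i _.
rewrite normrM -mulrA ler_wpM2l// normrX (ger0_norm y0).
have h := pow_le_expR i (divr_ge0 y0 (ler0n R 2)).
rewrite expr_div_n ler_pdivrMr ?exprn_gt0// in h.
by rewrite (le_trans h)//; rewrite mulrAC.
Qed.
End PolyBound.

Section LatticeTheta.
Variables (R : realType) (d : nat) (alpha : 'rV[nat]_d).
Implicit Types (t : R) (n : 'rV[int]_d).
Let a := norm1 alpha.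

Definition ltheta_term t n : R :=
  monomial (alpha *+ 2) (vecR R n) * expR (- enorm (vecR R n) ^+ 2 * pi * t).

Definition ltheta_dual_term t n : R :=
  expR (- enorm (vecR R n) ^+ 2 * pi * t)
  * Hermite (alpha *+ 2) (Num.sqrt (pi * t) *: vecR R n).

Lemma ltheta_termE t n :
  ltheta_term t n = \prod_(j < d) thterm (alpha 0 j) t (n 0 j).
Proof.
rewrite /ltheta_term /thterm big_split/=; congr (_ * _).
  apply: eq_bigr => j _; rewrite mulmxnE !mxE -exprM; congr (_ ^+ _).
  by rewrite mulnC -mulr_natr natn.
rewrite -expR_sum sumrN -mulr_suml -mulr_sumr enorm_sqr; congr expR.
rewrite !mulNr [in LHS](mulrC _ pi); congr (- (_ * _ * _)).
by apply: eq_bigr => j _; rewrite mxE.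
Qed.

Lemma ltheta_dual_termE t n : 0 < t ->
  ltheta_dual_term t n = \prod_(j < d) polyterm (hermite_sqr R (alpha 0 j)) t (n 0 j).
Proof.
move=> t0; rewrite /ltheta_dual_term Hermite_even mulrC big_split/=; congr (_ * _).
  apply: eq_bigr => j _; congr horner; rewrite !mxE exprMn sqr_sqrtr ?mulr_ge0 ?pi_ge0 ?(ltW t0)//.
  by rewrite mulrAC.
rewrite -expR_sum sumrN -mulr_suml -mulr_sumr enorm_sqr; congr expR.
rewrite !mulNr [in LHS](mulrC _ pi); congr (- (_ * _ * _)).
by apply: eq_bigr => j _; rewrite mxE.
Qed.

Definition ltheta t : R := \prod_(j < d) theta (alpha 0 j) t.
Definition ltheta_dual t : R := \prod_(j < d) Ltheta (hermite_sqr R (alpha 0 j)) t.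

Lemma ltheta_term_ge0 t n : 0 <= ltheta_term t n.
Proof. by rewrite ltheta_termE; apply: prodr_ge0 => j _; apply: thterm_ge0. Qed.

Lemma has_ltheta t : 0 < t -> has_rsum (ltheta_term t) (ltheta t).
Proof.
move=> t0.
have h := @has_rsum_prod_ge0 R d (fun j => thterm (alpha 0 j) t) _
  (fun j => thterm_ge0 _ _) (fun j => has_theta _ t0).
by apply: eq_has_rsum h => n; rewrite ltheta_termE.
Qed.

(** The polynomial growth of the Hermite factor costs half of the Gaussian decay;
this is the domination used for all sums over the dual side. *)
Lemma ltheta_dual_bound : exists2 C : R, 0 <= C & forall t n, 0 < t ->
  `|ltheta_dual_term t n| <= C * expR (- enorm (vecR R n) ^+ 2 * pi * (t / 2)).
Proof.
have /choice[C hC] j : exists C : R, 0 <= C /\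
    forall y, 0 <= y -> `|(hermite_sqr R (alpha 0 j)).[y]| * expR (- y) <= C * expR (- (y / 2)).
  by have [C C0 h] := poly_expR_bound (hermite_sqr R (alpha 0 j)); exists C.
exists (\prod_(j < d) C j) => [|t n t0]; first by apply: prodr_ge0 => j _; case: (hC j).
have pi0 := @pi_gt0 R.
rewrite ltheta_dual_termE// normr_prod enorm_sqr.
rewrite (_ : expR _ = \prod_(j < d) expR (- (pi * (n 0 j)%:~R ^+ 2 * t / 2))); last first.
  rewrite -expR_sum; congr expR; rewrite -sumrN !mulr_suml; apply: eq_bigr => j _.
  by rewrite mxE; ring.
rewrite -big_split/=; apply: ler_prod => j _; rewrite normr_ge0/= normrM.
rewrite (ger0_norm (expR_ge0 _)); apply: (hC j).2.
by rewrite mulr_ge0 ?(ltW t0)// mulr_ge0 ?(ltW pi0)// sqr_ge0.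
Qed.

Lemma has_ltheta_dual t : 0 < t -> has_rsum (ltheta_dual_term t) (ltheta_dual t).
Proof.
move=> t0; have t20 : 0 < t / 2 by rewrite divr_gt0.
have pi0 := @pi_gt0 R.
have /choice[C hC] j : exists C : R, 0 <= C /\
    forall y, 0 <= y -> `|(hermite_sqr R (alpha 0 j)).[y]| * expR (- y) <= C * expR (- (y / 2)).
  by have [C C0 h] := poly_expR_bound (hermite_sqr R (alpha 0 j)); exists C.
have h := @has_rsum_prod R d (fun j => polyterm (hermite_sqr R (alpha 0 j)) t)
  (fun j k => C j * thterm 0 (t / 2) k) _ _ _
  (fun j => has_rsumZ (C j) (has_theta 0 t20)) (fun j => has_rsum_polyterm _ t0).
apply: eq_has_rsum (h _) => [n|j k]; first by rewrite ltheta_dual_termE.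
rewrite /polyterm normrM (ger0_norm (expR_ge0 _)) /thterm expr0 mul1r [_ * (t / 2)]mulrA.
apply: (hC j).2.
by rewrite mulr_ge0 ?(ltW t0)// mulr_ge0 ?(ltW pi0)// sqr_ge0.
Qed.

(** The one-dimensional formulas, multiplied over the coordinates. *)
Lemma ltheta_inversion t : 0 < t ->
  ltheta t^-1 = (- (4 * pi)^-1) ^+ a * Num.sqrt t ^+ d * t ^+ a * ltheta_dual t.
Proof.
move=> t0; rewrite /ltheta; under eq_bigr do rewrite theta_inversion//.
rewrite !big_split/= prodr_const card_ord /ltheta_dual; congr (_ * _ * _ * _).
  by rewrite prodrXr.
by rewrite prodrXr.
Qed.
End LatticeTheta.

(** * Exchange of sums and Lebesgue integrals *)

Section Integrals.
Variable R : realType.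
Local Notation RR := (measurableTypeR R).
Implicit Types (D E : set RR) (f g : RR -> R).
Local Notation mu := (@lebesgue_measure R).

Definition integ D f := mu.-integrable D (EFin \o f).

Lemma integ_measurable D f : integ D f -> measurable_fun D f.
Proof. by move=> /integrableP[/measurable_EFinP]. Qed.

Lemma integ_dom D f g : measurable D -> measurable_fun D f ->
  (forall t, D t -> `|f t| <= g t) -> integ D g -> integ D f.
Proof.
move=> mD mf fg; apply: le_integrable => // [|t Dt /=]; first exact/measurable_EFinP.
by rewrite lee_fin (le_trans (fg t Dt))// ler_norm.
Qed.

Lemma integD D f g : measurable D -> integ D f -> integ D g -> integ D (fun t => f t + g t).
Proof. by move=> mD fi gi; have := integrableD mD fi gi. Qed.

Lemma integZ D (c : R) f : measurable D -> integ D f -> integ D (fun t => c * f t).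
Proof. by move=> mD fi; have := integrableZl mD c fi. Qed.

Lemma integ_eq D f g : measurable D -> (forall t, D t -> f t = g t) -> integ D f -> integ D g.
Proof. by move=> mD fg; apply: (eq_integrable mD) => t /set_mem Dt; rewrite /= fg. Qed.

Lemma integB D f g : measurable D -> integ D f -> integ D g -> integ D (fun t => f t - g t).
Proof. by move=> mD fi gi; have := integrableB mD fi gi. Qed.

Lemma integ_norm D f : integ D f -> integ D (fun t => `|f t|).
Proof. by move=> fi; have := integrable_abse fi. Qed.

Lemma integ_sum (I : choiceType) (A : {fset I}) D (f : I -> RR -> R) : measurable D ->
  (forall i, integ D (f i)) -> integ D (fun t => \sum_(i <- A) f i t).
Proof.
move=> mD fi; elim: (enum_fset A) => [|i s IH].
  by apply: (eq_integrable mD) (integrable0 mu D) => t _ /=; rewrite big_nil.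
by apply: (eq_integrable mD) (integD mD (fi i) IH) => t _ /=; rewrite big_cons.
Qed.

Lemma Rintegral_fset_sum (I : choiceType) (A : {fset I}) D (f : I -> RR -> R) :
  measurable D -> (forall i, integ D (f i)) ->
  (\int[mu]_(t in D) (\sum_(i <- A) f i t)) = \sum_(i <- A) \int[mu]_(t in D) f i t.
Proof.
move=> mD fi.
suff [] : integ D (fun t => \sum_(i <- enum_fset A) f i t) /\
  (\int[mu]_(t in D) (\sum_(i <- enum_fset A) f i t)) =
  \sum_(i <- enum_fset A) \int[mu]_(t in D) f i t by [].
elim: (enum_fset A) => [|i s [IH1 IH2]].
  split; first by apply: (eq_integrable mD) (integrable0 mu D) => t _ /=; rewrite big_nil.
  by rewrite big_nil; under eq_Rintegral do rewrite big_nil; rewrite Rintegral_cst// mul0r.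
split; first by apply: (eq_integrable mD) (integD mD (fi i) IH1) => t _ /=; rewrite big_cons.
by rewrite big_cons -IH2 -(RintegralD mD (fi i) IH1); apply: eq_Rintegral => t _; rewrite big_cons.
Qed.

Lemma Rintegral_dominated_cvg D (f : nat -> RR -> R) g h : measurable D ->
  (forall n, measurable_fun D (f n)) ->
  (forall t, D t -> f n t @[n --> \oo] --> g t) -> integ D h ->
  (forall n t, D t -> `|f n t| <= h t) ->
  integ D g /\ \int[mu]_(t in D) f n t @[n --> \oo] --> \int[mu]_(t in D) g t.
Proof.
move=> mD mf fg ih fh.
have mg : measurable_fun D g by apply: (measurable_fun_cvg mf).
have mf' n : measurable_fun D (EFin \o f n) by apply/measurable_EFinP.
have mg' : measurable_fun D (EFin \o g) by apply/measurable_EFinP.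
have h1 : {ae mu, forall t, D t -> (EFin \o f n) t @[n --> \oo] --> (EFin \o g) t}.
  by apply: aeW => t Dt; apply: cvg_EFin; [near=> n|exact: fg].
have h2 : {ae mu, forall t, forall n, D t -> (`|(EFin \o f n) t| <= (EFin \o h) t)%E}.
  by apply: aeW => t n Dt /=; rewrite lee_fin fh.
have [ig _ c] := dominated_convergence mD mf' mg' h1 ih h2.
split => //; apply: fine_cvg; rewrite [X in _ --> X](_ : _ = \int[mu]_(x in D) (EFin \o g) x)%E.
  exact: c.
by rewrite fineK//; exact: integrable_fin_num.
Unshelve. all: by end_near. Qed.

(** Integrals over increasing compact intervals converge to the improper one, by
domination by |f|. *)
Lemma Rintegral_exhaust D (E : nat -> set RR) f : measurable D ->
  (forall n, measurable (E n)) -> (forall n, E n `<=` D) ->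
  (forall t, D t -> \forall n \near \oo, E n t) -> integ D f ->
  \int[mu]_(t in E n) f t @[n --> \oo] --> \int[mu]_(t in D) f t.
Proof.
move=> mD mE ED DE fi.
have EE n : \int[mu]_(t in E n) f t = \int[mu]_(t in D) (f \_ (E n)) t.
  by rewrite -Rintegral_mkcondr; congr Rintegral; rewrite setIC setIidl.
under eq_fun do rewrite EE.
apply: (Rintegral_dominated_cvg mD _ _ (integ_norm fi) _).2 => [n|t Dt|n t Dt].
- apply/measurable_restrict => //; apply: measurable_funS (integ_measurable fi) => //.
- apply: cvg_near_cst; apply: filterS (DE t Dt) => n Ent.
  by rewrite patchE mem_set.
- by rewrite patchE; case: ifP => // _; rewrite normr0.
Qed.

(** Monotone convergence, used to derive integrability on a half-line from bounded
integrals over compact intervals. *)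
Lemma integ_exhaust D (E : nat -> set RR) f (M : R) : measurable D ->
  (forall n, measurable (E n)) -> (forall n m, (n <= m)%N -> E n `<=` E m) ->
  D = \bigcup_n E n -> (forall t, D t -> 0 <= f t) -> measurable_fun D f ->
  (forall n, integ (E n) f) -> (forall n, \int[mu]_(t in E n) f t <= M) -> integ D f.
Proof.
move=> mD mE ndE DE f0 mf fi fM.
have ED n : E n `<=` D by rewrite DE; exact: bigcup_sup.
apply/integrableP; split; first exact/measurable_EFinP.
rewrite (eq_integral (EFin \o f)) => [|t /set_mem Dt]; last by rewrite /= ger0_norm// f0.
have c : (\int[mu]_(t in E n) (EFin \o f) t @[n --> \oo] --> \int[mu]_(t in D) (EFin \o f) t)%E.
  rewrite DE; apply: ge0_nondecreasing_set_cvg_integral => //.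
  - by move=> n m nm; apply/subsetPset; exact: ndE.
  - by move=> n; apply/measurable_EFinP; exact: integ_measurable.
  - by move=> n t Et; rewrite /= lee_fin f0//; exact: ED Et.
rewrite (@le_lt_trans _ _ M%:E)// ?ltry// -(cvg_lim _ c)//.
apply: lime_le; first by apply/cvg_ex; eexists; exact: c.
near=> n; have := fM n; rewrite -lee_fin /Rintegral fineK//.
exact: (integrable_fin_num (mE n) (fi n)).
Unshelve. all: by end_near. Qed.

(** Term by term integration under a summable domination.  Countability of the index
type is used to extract an exhausting sequence of finite sets, along which
dominated convergence applies; the tail of the sum of integrals is then
controlled by the tail of the dominating one. *)
Lemma has_rsum_Rintegral (I : countType) D (u f : I -> RR -> R) (U F : RR -> R) :
  measurable D -> (forall i t, D t -> `|f i t| <= u i t) ->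
  (forall t, D t -> has_rsum (u^~ t) (U t)) ->
  (forall t, D t -> has_rsum (f^~ t) (F t)) ->
  (forall i, measurable_fun D (u i)) -> (forall i, measurable_fun D (f i)) ->
  integ D U ->
  [/\ forall i, integ D (f i), integ D F &
     has_rsum (fun i => \int[mu]_(t in D) f i t) (\int[mu]_(t in D) F t)].
Proof.
move=> mD fu uU fF mu_ mf iU.
have u0 i t : D t -> 0 <= u i t by move=> Dt; apply: le_trans (fu i t Dt).
pose u' i t := if t \in D then u i t else 0.
have u'E i t : D t -> u' i t = u i t by move=> Dt; rewrite /u' mem_set.
have partial (A : {fset I}) t : D t -> \sum_(i <- A) u i t <= U t.
  move=> Dt; have -> : \sum_(i <- A) u i t = \sum_(i <- A) u' i t by apply: eq_bigr => i _; rewrite u'E.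
  have h1 : has_rsum (u'^~ t) (U t) by apply: eq_has_rsum (uU t Dt) => i; rewrite u'E.
  by have := has_rsum_partial A _ h1; apply => i; rewrite u'E ?u0.
have absu i t : D t -> `|u i t| <= u i t by move=> Dt; rewrite ger0_norm// u0.
have iu i : integ D (u i).
  apply: (integ_dom mD (mu_ i) _ iU) => t Dt; rewrite ger0_norm ?u0//.
  by have := partial [fset i]%fset t Dt; rewrite big_seq_fset1.
have if_ i : integ D (f i) by apply: (integ_dom mD (mf i) _ (iu i)) => t Dt; exact: fu.
pose e N : {fset I} := seq_fset tt (pmap (@choice.unpickle I) (iota 0 N)).
have ne i : \forall N \near \oo, i \in e N.
  exists (choice.pickle i).+1 => // N /= hN; rewrite seq_fsetE mem_pmap; apply/mapP.
  by exists (choice.pickle i); rewrite ?mem_iota ?choice.pickleK.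
have [iF _] : integ D F /\ _ := Rintegral_dominated_cvg (f := fun N t => \sum_(i <- e N) f i t) mD
   (fun N => integ_measurable (integ_sum (e N) mD if_))
   (fun t Dt => has_rsum_cvg (fF t Dt) ne) iU
   (fun N t Dt => le_trans (ler_norm_sum _ _ _) (le_trans (ler_sum _ (fun i _ => fu i t Dt)) (partial _ t Dt))).
have [_ cU] : integ D U /\ _ := Rintegral_dominated_cvg (f := fun N t => \sum_(i <- e N) u i t) mD
   (fun N => integ_measurable (integ_sum (e N) mD iu))
   (fun t Dt => has_rsum_cvg (uU t Dt) ne) iU
   (fun N t Dt => le_trans (ler_norm_sum _ _ _) (le_trans (ler_sum _ (fun i _ => absu i t Dt)) (partial _ t Dt))).
have iFe (B : {fset I}) : integ D (fun t => F t - \sum_(i <- B) f i t) by apply: integB => //; exact: integ_sum.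
have iUe (B : {fset I}) : integ D (fun t => U t - \sum_(i <- B) u i t) by apply: integB => //; exact: integ_sum.
split => // eps eps0.
move/cvgrPdist_lt : cU => /(_ eps eps0) cU.
near \oo => N; exists (e N) => B eB.
have hN : `|\int[mu]_(t in D) U t - \int[mu]_(t in D) (\sum_(i <- e N) u i t)| < eps by near: N.
apply: le_lt_trans hN.
rewrite -Rintegral_fset_sum// -RintegralB//; last exact: integ_sum.
rewrite -RintegralB//; last exact: integ_sum.
rewrite (le_trans (le_normr_Rintegral _ _))//; first exact: iFe.
rewrite (le_trans _ (ler_norm _))// le_Rintegral//; [exact/integ_norm/iFe|exact: iUe|].
move=> t Dt; rewrite (@le_trans _ _ (U t - \sum_(i <- B) u i t))//.
  have -> : \sum_(i <- B) u i t = \sum_(i <- B) u' i t by apply: eq_bigr => i _; rewrite u'E.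
  apply: (has_rsum_tail (v := f^~ t)) (fF t Dt) => [|i]; last by rewrite u'E// fu.
  by apply: eq_has_rsum (uU t Dt) => i; rewrite u'E.
rewrite lerB// (eq_bigr (u'^~ t)) => [|i _]; last by rewrite u'E.
rewrite [leRHS](eq_bigr (u'^~ t)) => [|i _]; last by rewrite u'E.
by apply: fset_sum_le => // i; rewrite u'E ?u0.
Unshelve. all: by end_near. Qed.
End Integrals.

(** * Integrals over half-lines *)

Section PosIntegrals.
Variable R : realType.
Local Notation mu := (@lebesgue_measure R).
Local Notation RR := (measurableTypeR R).
Implicit Types (D : set RR) (f g : R -> R) (a b c p t : R).

(** Continuity on ]0, +oo[, the regularity of all integrands below; it is stable by
products and gives measurability and local integrability. *)
Definition cont_pos f := forall t, 0 < t -> {for t, continuous f}.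

Lemma cont_pos_within f a b : 0 < a -> cont_pos f -> {within `[a, b], continuous f}.
Proof.
move=> a0 cf; apply: continuous_in_subspaceT => t /[!inE]/=; rewrite in_itv/= => /andP[at_ _].
by apply: cf; exact: lt_le_trans at_.
Qed.

Lemma cont_pos_measurable D f : measurable D -> (forall t, D t -> 0 < t) ->
  cont_pos f -> measurable_fun D f.
Proof.
move=> mD D0 cf; have h : measurable_fun (`]0, +oo[%classic : set RR) f.
  apply: open_continuous_measurable_fun; first exact: interval_open.
  by move=> t; rewrite inE/= in_itv/= andbT => /cf.
apply: measurable_funS h => //.
by move=> t /D0 /=; rewrite in_itv/= andbT.
Qed.

Lemma cont_pos_integ f a b : 0 < a -> cont_pos f -> integ `[a, b] f.
Proof.
move=> a0 cf; apply: continuous_compact_integrable; first exact: segment_compact.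
exact: cont_pos_within.
Qed.

Lemma is_derive_cont f t l : is_derive t 1 f l -> {for t, continuous f}.
Proof. by move=> df; apply: differentiable_continuous; apply/derivable1_diffP. Qed.

Lemma FTC_pos F f a b : 0 < a -> a < b -> (forall t, 0 < t -> is_derive t 1 F (f t)) ->
  cont_pos f -> \int[mu]_(t in `[a, b]) f t = F b - F a.
Proof.
move=> a0 ab dF cf.
have cF t : 0 < t -> {for t, continuous F} by move=> /dF; exact: is_derive_cont.
have b0 := lt_trans a0 ab.
rewrite /Rintegral (@continuous_FTC2 _ f F a b ab)//.
- exact: cont_pos_within.
- split.
  + by move=> t; rewrite in_itv/= => /andP[at_ _]; have [] := dF t (lt_trans a0 at_).
  + exact/cvg_at_right_filter/cF.
  + exact/cvg_at_left_filter/cF.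
- by move=> t; rewrite in_itv/= => /andP[at_ _]; have [_] := dF t (lt_trans a0 at_); rewrite derive1E.
Qed.

Lemma Rintegral_scale c a b f : 0 < c -> 0 < a -> a < b -> cont_pos f ->
  \int[mu]_(t in `[c * a, c * b]) f t = \int[mu]_(t in `[a, b]) (c * f (c * t)).
Proof.
move=> c0 a0 ab cf.
have dc t : is_derive t 1 (fun t => c * t) c.
  by apply: is_derive_eq; rewrite /GRing.scale/=; ring.
have dE : derive1 (fun t : R => c * t) = fun=> c.
  by apply/funext => t; rewrite derive1E derive_val.
have cc t : {for t, continuous (fun t => c * t)} by exact: is_derive_cont.
rewrite /Rintegral; congr fine.
rewrite (@integration_by_substitution_increasing _ (fun t => c * t) f a b (ltW ab)).
- by apply: eq_integral => t _; rewrite fctE /= dE mulrC.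
- by move=> x y _ _ xy; rewrite ltr_pM2l.
- by move=> t _; rewrite dE; exact: cvg_cst.
- by rewrite dE; exact: is_cvg_cst.
- by rewrite dE; exact: is_cvg_cst.
- split; first by move=> t _; have [] := dc t.
  + exact/cvg_at_right_filter/cc.
  + exact/cvg_at_left_filter/cc.
- by apply: cont_pos_within; rewrite ?mulr_gt0.
Qed.

Lemma Rintegral_inv a b f : 0 < a -> a < b -> cont_pos f ->
  \int[mu]_(t in `[b^-1, a^-1]) f t = \int[mu]_(t in `[a, b]) (t ^- 2 * f t^-1).
Proof.
move=> a0 ab cf; have b0 := lt_trans a0 ab.
have dV t : 0 < t -> is_derive t 1 (fun t : R => t^-1) (- t ^- 2).
  move=> t0; apply: is_derive_eq; first by apply: is_deriveV; rewrite gt_eqF.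
  by rewrite /GRing.scale/= mulr1.
have dE t : 0 < t -> derive1 (fun t : R => t^-1) t = - t ^- 2.
  by move=> t0; rewrite derive1E; have [_] := dV t t0.
have cV t : 0 < t -> {for t, continuous (fun t : R => t^-1)}.
  by move=> /dV; exact: is_derive_cont.
have cV2 t : 0 < t -> - x ^- 2 @[x --> t] --> - t ^- 2.
  move=> t0; apply: cvgN; apply: cvgV; first by rewrite expf_neq0// gt_eqF.
  exact: exprn_continuous.
have cdE t : 0 < t -> derive1 (fun t : R => t^-1) x @[x --> t] --> - t ^- 2.
  move=> t0; apply: cvg_trans (cV2 t t0); apply: near_eq_cvg.
  near=> x; rewrite dE//; near: x; exact: lt_nbhsr.
rewrite /Rintegral; congr fine.
rewrite (@integration_by_substitution_decreasing _ (fun t : R => t^-1) f a b (ltW ab)).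
- apply: eq_integral => t /set_mem/=; rewrite in_itv/= => /andP[at_ _].
  have t0 := lt_le_trans a0 at_.
  by rewrite !fctE /= dE// opprK mulrC.
- move=> x y; rewrite !in_itv/= => /andP[ax _] /andP[ay _] xy.
  by rewrite ltf_pV2// posrE ?(lt_le_trans a0).
- move=> t; rewrite in_itv/= => /andP[at_ _]; have t0 := lt_trans a0 at_.
  by rewrite /continuous_at dE//; exact: cdE.
- by apply/cvg_ex; exists (- a ^- 2); apply/cvg_at_right_filter/cdE.
- by apply/cvg_ex; exists (- b ^- 2); apply/cvg_at_left_filter/cdE.
- split.
  + by move=> t; rewrite in_itv/= => /andP[at_ _]; have [] := dV t (lt_trans a0 at_).
  + exact/cvg_at_right_filter/cV.
  + exact/cvg_at_left_filter/cV.
- by apply: cont_pos_within; rewrite ?invr_gt0.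
Unshelve. all: by end_near. Qed.

(** The real case of rpowC, total in t, with the same exponent laws. *)
Definition pw p t : R := expR (p * ln t).

Lemma pw_gt0 p t : 0 < pw p t. Proof. exact: expR_gt0. Qed.
Lemma pw_ge0 p t : 0 <= pw p t. Proof. exact: expR_ge0. Qed.
Hint Resolve pw_gt0 pw_ge0 : core.

Lemma pwD p q t : pw (p + q) t = pw p t * pw q t.
Proof. by rewrite /pw mulrDl expRD. Qed.

Lemma pwN p t : pw (- p) t = (pw p t)^-1.
Proof. by rewrite /pw mulNr expRN. Qed.

Lemma pw1 t : 0 < t -> pw 1 t = t.
Proof. by move=> t0; rewrite /pw mul1r lnK// posrE. Qed.

Lemma pwX n t : 0 < t -> pw n%:R t = t ^+ n.
Proof. by move=> t0; rewrite /pw expRM_natl lnK// posrE. Qed.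

Lemma pwV p t : 0 < t -> pw p t^-1 = pw (- p) t.
Proof. by move=> t0; rewrite /pw lnV ?posrE// mulrN mulNr. Qed.

Lemma pw_half t : 0 < t -> pw (1 / 2) t = Num.sqrt t.
Proof.
move=> t0; have e : pw (1 / 2) t ^+ 2 = t.
  by rewrite expr2 -pwD -[RHS]pw1//; congr pw; field.
by rewrite -[in RHS]e sqrtr_sqr ger0_norm.
Qed.

Lemma pw_le p q t : 1 <= t -> p <= q -> pw p t <= pw q t.
Proof. by move=> t1 pq; rewrite ler_expR ler_wpM2r// ln_ge0. Qed.

Lemma is_derive_pw p t : 0 < t -> is_derive t 1 (pw p) (p * pw (p - 1) t).
Proof.
move=> t0; have dl := is_derive1_ln t0.
have dm : is_derive t 1 (fun t => p * ln t) (p * t^-1).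
  by apply: is_derive_eq; rewrite /GRing.scale/=; ring.
have dc := @is_derive1_comp R expR (fun t => p * ln t) t _ _ (is_derive_expR (p * ln t)) dm.
apply: (is_derive_eq dc).
by rewrite pwD pwN pw1// /pw; ring.
Qed.

Lemma cont_pw p : cont_pos (pw p).
Proof. by move=> t /(@is_derive_pw p); exact: is_derive_cont. Qed.

(** The fundamental theorem on an exhausting sequence of compact intervals, with the
boundary values as limits. *)
Lemma FTC_improper D (u v : nat -> R) F f A B : measurable D ->
  (forall n, 0 < u n) -> (forall n, u n < v n) ->
  (forall n, `[u n, v n] `<=` D) ->
  (forall t, D t -> \forall n \near \oo, u n <= t <= v n) ->
  (forall t, 0 < t -> is_derive t 1 F (f t)) -> cont_pos f -> integ D f ->
  F (u n) @[n --> \oo] --> A -> F (v n) @[n --> \oo] --> B ->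
  \int[mu]_(t in D) f t = B - A.
Proof.
move=> mD u0 uv uvD Duv dF cf fi FA FB.
have h1 : \int[mu]_(t in `[u n, v n]) f t @[n --> \oo] --> \int[mu]_(t in D) f t.
  apply: Rintegral_exhaust => // t Dt; exact: Duv.
apply: (cvg_unique (@norm_hausdorff _ R) h1).
have -> : (fun n => \int[mu]_(t in `[u n, v n]) f t) = fun n => F (v n) - F (u n).
  by apply/funext => n; rewrite (FTC_pos (u0 n) (uv n) dF cf).
exact: cvgB.
Qed.

Lemma near_large t : \forall n \near \oo, t <= (n.+2)%:R.
Proof.
exists (Num.truncn `|t|) => // n /= tn.
rewrite (le_trans (ler_norm t))// (@le_trans _ _ (Num.truncn `|t|).+1%:R)//.
  by have /andP[_ /ltW] := truncn_itv (normr_ge0 t).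
by rewrite ler_nat ltnS (leq_trans tn).
Qed.

Lemma near_small t : 0 < t -> \forall n \near \oo, (n.+2)%:R^-1 <= t.
Proof.
move=> t0; apply: filterS (near_large t^-1) => n h.
by rewrite -[t]invrK lef_pV2// posrE ?invr_gt0.
Qed.

Lemma subset_1n n : `[1, n.+2%:R] `<=` (`[1, +oo[%classic : set R).
Proof. by move=> t; rewrite /= !in_itv/= andbT => /andP[]. Qed.

Lemma subset_n1 n : `[n.+2%:R^-1, 1] `<=` (`]0, 1]%classic : set R).
Proof.
move=> t; rewrite /= !in_itv/= => /andP[h ->]; rewrite andbT.
by rewrite (lt_le_trans _ h)// invr_gt0.
Qed.

Lemma subset_nn n : `[n.+2%:R^-1, n.+2%:R] `<=` (`]0, +oo[%classic : set R).
Proof.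
move=> t; rewrite /= !in_itv/= => /andP[h _]; rewrite andbT.
by rewrite (lt_le_trans _ h)// invr_gt0.
Qed.

Lemma ltr1n2 n : 1 < n.+2%:R :> R. Proof. by rewrite ltr1n. Qed.
Lemma ltrVn1 n : n.+2%:R^-1 < 1 :> R. Proof. by rewrite invf_lt1 ?ltr1n. Qed.

Lemma pw_prim p : p != -1 -> forall t, 0 < t ->
  is_derive t 1 (fun t => (p + 1)^-1 * pw (p + 1) t) (pw p t).
Proof.
move=> p1 t t0; have dp := is_derive_pw (p + 1) t0.
apply: is_derive_eq; rewrite /GRing.scale/= addrK.
by move: (pw p t) => w; field; rewrite addr_eq0.
Qed.

Lemma integ_pw_1y p : p < -1 -> integ `[1, +oo[ (pw p).
Proof.
move=> p1; apply: (@integ_exhaust _ _ (fun n => `[1, n.+2%:R]%classic) _ (- (p + 1)^-1)) => //.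
- move=> n m nm t /=; rewrite !in_itv/= => /andP[-> /le_trans]; apply.
  by rewrite ler_nat !ltnS.
- apply/seteqP; split => [t t1|t [n _]]; last exact: subset_1n.
  have [n _ /(_ n (leqnn _)) hn] := near_large t.
  by exists n => //=; move: t1; rewrite /= !in_itv/= andbT => ->.
- apply: cont_pos_measurable => // [t|]; last exact: cont_pw.
  by rewrite /= in_itv/= andbT; exact: lt_le_trans.
- by move=> n; apply: cont_pos_integ => //; exact: cont_pw.
- move=> n; rewrite (FTC_pos _ (ltr1n2 n) (pw_prim _) (@cont_pw p))// ?lt_eqF//.
  rewrite {2}/pw ln1 mulr0 expR0 mulr1 gerDr.
  by rewrite mulr_le0_ge0// invr_le0; lra.
Qed.

Lemma integ_pw_01 p : -1 < p -> integ `]0, 1] (pw p).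
Proof.
move=> p1; apply: (@integ_exhaust _ _ (fun n => `[n.+2%:R^-1, 1]%classic) _ (p + 1)^-1) => //.
- move=> n m nm t /=; rewrite !in_itv/= => /andP[h ->]; rewrite andbT (le_trans _ h)//.
  by rewrite lef_pV2 ?posrE// ler_nat !ltnS.
- apply/seteqP; split => [t t1|t [n _]]; last exact: subset_n1.
  move: t1; rewrite /= in_itv/= => /andP[t0 t1].
  have [n _ /(_ n (leqnn _)) hn] := near_small t0.
  by exists n => //=; rewrite !in_itv/= t1 hn.
- apply: cont_pos_measurable => // [t|]; last exact: cont_pw.
  by rewrite /= in_itv/= => /andP[].
- by move=> n; apply: cont_pos_integ; [rewrite invr_gt0|exact: cont_pw].
- move=> n; rewrite (FTC_pos _ (ltrVn1 n) (pw_prim _) (@cont_pw p))// ?gt_eqF// ?invr_gt0//.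
  rewrite {1}/pw ln1 mulr0 expR0 mulr1 gerBl.
  by rewrite mulr_ge0// invr_ge0; lra.
Qed.

Lemma cont_expRM c : cont_pos (fun t => expR (- c * t)).
Proof.
move=> t _; apply: (@continuous_comp _ _ _ (fun t => - c * t) expR); last exact: continuous_expR.
by apply: cvgM; [exact: cvg_cst|exact: cvg_id].
Qed.

Lemma cont_posM f g : cont_pos f -> cont_pos g -> cont_pos (fun t => f t * g t).
Proof. by move=> cf cg t t0; apply: cvgM; [exact: cf|exact: cg]. Qed.

Lemma pw_le_expR p c : 0 < c -> exists2 K : R, 0 <= K &
  forall t, 1 <= t -> pw p t <= K * expR (c * t).
Proof.
move=> c0; pose N := (Num.truncn `|p|).+1.
exists (N`!%:R / c ^+ N) => [|t t1]; first by rewrite divr_ge0// exprn_ge0// ltW.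
have t0 : 0 < t by rewrite (lt_le_trans _ t1).
rewrite (@le_trans _ _ (pw N%:R t))//.
  apply: pw_le => //; rewrite (le_trans (ler_norm p))//.
  by have /andP[_ /ltW] := truncn_itv (normr_ge0 p).
have := pow_le_expR N (mulr_ge0 (ltW c0) (ltW t0)).
rewrite pwX// exprMn mulrC -ler_pdivlMr ?exprn_gt0// => h.
by rewrite (le_trans h)// mulrAC.
Qed.

(** The exponential beats t^(p + 2), so that t^-2 dominates. *)
Lemma integ_pw_exp_1y p c : 0 < c -> integ `[1, +oo[ (fun t => pw p t * expR (- c * t)).
Proof.
move=> c0; have [K K0 hK] := pw_le_expR (p + 2) c0.
apply: (integ_dom (g := fun t => K * pw (-2) t)) => //.
- apply: cont_pos_measurable => // [t|].
    by rewrite /= in_itv/= andbT; exact: lt_le_trans.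
  by apply: cont_posM; [exact: cont_pw|exact: cont_expRM].
- move=> t; rewrite /= in_itv/= andbT => t1.
  rewrite ger0_norm ?mulr_ge0 ?expR_ge0//.
  rewrite mulNr expRN ler_pdivrMr ?expR_gt0// mulrAC pwN ler_pdivlMr// -pwD.
  exact: hK.
- by apply: integZ => //; apply: integ_pw_1y; lra.
Qed.

(** The substitution is made on compact intervals, whose images also exhaust the
half-line. *)
Lemma Rintegral_scale_0y c f : 0 < c -> cont_pos f -> integ `]0, +oo[ f ->
  integ `]0, +oo[ (fun t => c * f (c * t)) ->
  \int[mu]_(t in `]0, +oo[) f t = \int[mu]_(t in `]0, +oo[) (c * f (c * t)).
Proof.
move=> c0 cf i1 i2.
have n0 n : 0 < n.+2%:R^-1 :> R by rewrite invr_gt0.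
have nn n : n.+2%:R^-1 < n.+2%:R :> R by apply: lt_trans (ltrVn1 n) (ltr1n2 n).
have h2 : \int[mu]_(t in `[n.+2%:R^-1, n.+2%:R]) (c * f (c * t)) @[n --> \oo] -->
   \int[mu]_(t in `]0, +oo[) (c * f (c * t)).
  apply: Rintegral_exhaust => // [n|t]; first exact: subset_nn.
  rewrite /= in_itv/= andbT => t0.
  apply: filterS2 (near_large t) (near_small t0) => n a b.
  by rewrite in_itv/= a b.
apply: (cvg_unique (@norm_hausdorff _ R) _ h2).
have -> : (fun n => \int[mu]_(t in `[n.+2%:R^-1, n.+2%:R]) (c * f (c * t))) =
  fun n => \int[mu]_(t in `[c * n.+2%:R^-1, c * n.+2%:R]) f t.
  by apply/funext => n; rewrite Rintegral_scale.
apply: Rintegral_exhaust => // [n|t].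
- move=> t; rewrite /= !in_itv/= => /andP[h _]; rewrite andbT.
  by rewrite (lt_le_trans _ h)// mulr_gt0.
- rewrite /= in_itv/= andbT => t0; have t1 : 0 < t / c by rewrite divr_gt0.
  apply: filterS2 (near_large (t / c)) (near_small t1) => n.
  by rewrite in_itv/= ler_pdivrMr// ler_pdivlMr// ![c * _]mulrC => -> ->.
Qed.

Lemma Rintegral_inv_01 f : cont_pos f -> integ `]0, 1] f ->
  integ `[1, +oo[ (fun t => t ^- 2 * f t^-1) ->
  \int[mu]_(t in `]0, 1]) f t = \int[mu]_(t in `[1, +oo[) (t ^- 2 * f t^-1).
Proof.
move=> cf i1 i2.
have h2 : \int[mu]_(t in `[1, n.+2%:R]) (t ^- 2 * f t^-1) @[n --> \oo] -->
   \int[mu]_(t in `[1, +oo[) (t ^- 2 * f t^-1).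
  apply: Rintegral_exhaust => // [n|t]; first exact: subset_1n.
  rewrite /= in_itv/= andbT => t1; apply: filterS (near_large t) => n a.
  by rewrite in_itv/= a t1.
apply: (cvg_unique (@norm_hausdorff _ R) _ h2).
have -> : (fun n => \int[mu]_(t in `[1, n.+2%:R]) (t ^- 2 * f t^-1)) =
  fun n => \int[mu]_(t in `[n.+2%:R^-1, 1]) f t.
  by apply/funext => n; rewrite -(Rintegral_inv _ (ltr1n2 n) cf)// invr1.
apply: Rintegral_exhaust => // [n|t]; first exact: subset_n1.
rewrite /= in_itv/= => /andP[t0 t1]; apply: filterS (near_small t0) => n a.
by rewrite in_itv/= a t1.
Qed.
End PosIntegrals.

Local Open Scope complex_scope.

(** * Complex series, exponential and powers *)

Section ComplexBasics.
Variable R : realType.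
Implicit Types (z w : R[i]) (x y a b s t : R).
Local Notation Re := (@complex.Re R).
Local Notation Im := (@complex.Im R).

Lemma cReM z w : Re (z * w) = Re z * Re w - Im z * Im w. Proof. by case: z; case: w. Qed.
Lemma cImM z w : Im (z * w) = Re z * Im w + Im z * Re w. Proof. by case: z; case: w. Qed.
Lemma cReD z w : Re (z + w) = Re z + Re w. Proof. by case: z; case: w. Qed.
Lemma cImD z w : Im (z + w) = Im z + Im w. Proof. by case: z; case: w. Qed.
Lemma cReN z : Re (- z) = - Re z. Proof. by case: z. Qed.
Lemma cImN z : Im (- z) = - Im z. Proof. by case: z. Qed.
Lemma cRe_sum (I : Type) (s : seq I) (P : pred I) (f : I -> R[i]) :
  Re (\sum_(i <- s | P i) f i) = \sum_(i <- s | P i) Re (f i).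
Proof. by apply: (big_morph Re cReD). Qed.
Lemma cIm_sum (I : Type) (s : seq I) (P : pred I) (f : I -> R[i]) :
  Im (\sum_(i <- s | P i) f i) = \sum_(i <- s | P i) Im (f i).
Proof. by apply: (big_morph Im cImD). Qed.

Lemma complex_eq z w : Re z = Re w -> Im z = Im w -> z = w.
Proof. by move=> hr hi; apply/eqP; rewrite eq_complex hr hi !eqxx. Qed.

Lemma normc_le z : `|z| <= (`|Re z| + `|Im z|)%:C.
Proof.
rewrite normc_def lecR -[leRHS]ger0_norm ?addr_ge0// -sqrtr_sqr ler_wsqrtr//.
by rewrite sqrrD !real_normK ?num_real// addrAC lerDl mulrn_wge0// mulr_ge0.
Qed.

Lemma normc_ge_Im z : (`|Im z|)%:C <= `|z|.
Proof. by rewrite normc_def lecR -sqrtr_sqr ler_wsqrtr// lerDr sqr_ge0. Qed.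

Lemma normc_lt_ReIm z (r : R) : `|z| < r%:C -> `|Re z| < r /\ `|Im z| < r.
Proof.
move=> h; split; rewrite -ltcR; apply: le_lt_trans h; [exact: normc_ge_Re|exact: normc_ge_Im].
Qed.

(** Complex sums are reduced to the sums of the real and imaginary parts, the
restriction to P becoming an extension by 0. *)
Lemma has_csum_of_real (I : choiceType) (P : pred I) (f : I -> R[i]) z :
  has_rsum (fun i => if P i then Re (f i) else 0) (Re z) ->
  has_rsum (fun i => if P i then Im (f i) else 0) (Im z) -> has_csum P f z.
Proof.
move=> hr hi; rewrite /has_csum; have FF := @summability.totally_filter I.
apply/(@cvgrPdist_lt (R[i]) (R[i])^o _ _ FF) => e e0.
have eE : e = (complex.Re e)%:C by rewrite RRe_real// gtr0_real.
have e2 : 0 < complex.Re e / 2 by rewrite divr_gt0// -ltcR -eE.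
have [A hA] := hr _ e2; have [B hB] := hi _ e2.
exists (A `|` B)%fset => // C /=; rewrite fsubUset => /andP[/hA{}hA /hB{}hB].
rewrite (le_lt_trans (normc_le _))// eE ltcR cReD cImD cReN cImN cRe_sum cIm_sum.
by rewrite (splitr (complex.Re e)) ltrD// -?big_mkcond// big_mkcond.
Qed.

Lemma has_csum_uniq (I : choiceType) (P : pred I) (f : I -> R[i]) z w :
  has_csum P f z -> has_csum P f w -> z = w.
Proof.
move=> hz hw.
have PF := @summability.totally_filter I.
exact: (@cvg_unique _ (@norm_hausdorff _ (R[i])^o) _ _ _ _ hz hw).
Qed.

Lemma csumE (I : choiceType) (P : pred I) (f : I -> R[i]) z :
  has_csum P f z -> csum P f = z.
Proof. by move=> fz; apply: xget_unique => // w fw; exact: has_csum_uniq fw fz. Qed.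

Lemma cexpD z w : cexp (z + w) = cexp z * cexp w.
Proof.
apply: complex_eq; rewrite /cexp ?cReM ?cImM ?cReD ?cImD /= expRD ?cosD ?sinD; ring.
Qed.

Lemma cexp0 : cexp 0 = 1 :> R[i].
Proof. by apply: complex_eq; rewrite /cexp /= expR0 cos0 sin0; ring. Qed.

Lemma cexp_neq0 z : cexp z != 0.
Proof.
apply/negP => /eqP h; have : cexp (z + - z) = 1 by rewrite subrr cexp0.
by rewrite cexpD h mul0r => /eqP; rewrite eq_sym oner_eq0.
Qed.

Lemma cexp_real x : cexp x%:C = (expR x)%:C.
Proof. by apply: complex_eq; rewrite /cexp /= cos0 sin0; ring. Qed.

Lemma Re_rpowC t z : Re (rpowC t z) = pw (Re z) t * cos (Im z * ln t).
Proof. by rewrite /rpowC /cexp /pw !cReM !cImM /= !mulr0 !mul0r !subr0 !add0r. Qed.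

Lemma Im_rpowC t z : Im (rpowC t z) = pw (Re z) t * sin (Im z * ln t).
Proof. by rewrite /rpowC /cexp /pw !cImM !cReM /= !mulr0 !mul0r !subr0 !add0r addr0. Qed.

Lemma rpowCD t z w : rpowC t (z + w) = rpowC t z * rpowC t w.
Proof. by rewrite /rpowC mulrDl cexpD. Qed.

Lemma rpowC0 (t : R) : rpowC t 0 = 1.
Proof. by rewrite /rpowC mul0r cexp0. Qed.

Lemma rpowC_neq0 t z : rpowC t z != 0.
Proof. exact: cexp_neq0. Qed.

Lemma rpowCN t z : rpowC t (- z) = (rpowC t z)^-1.
Proof.
apply: (mulfI (rpowC_neq0 t z)).
by rewrite -rpowCD subrr rpowC0 divff// rpowC_neq0.
Qed.

Lemma rpowC_real t x : rpowC t x%:C = (pw x t)%:C.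
Proof. by rewrite /rpowC -rmorphM/= cexp_real. Qed.

Lemma rpowC1 t : 0 < t -> rpowC t 1 = t%:C.
Proof. by move=> t0; rewrite (rpowC_real t 1) pw1. Qed.

Lemma rpowCM s t z : 0 < s -> 0 < t -> rpowC (s * t) z = rpowC s z * rpowC t z.
Proof.
by move=> s0 t0; rewrite /rpowC lnM ?posrE// rmorphD/= mulrDr cexpD.
Qed.

Lemma rpowCV t z : 0 < t -> rpowC t^-1 z = rpowC t (- z).
Proof. by move=> t0; rewrite /rpowC lnV ?posrE// rmorphN/= mulrN mulNr. Qed.

Lemma abs_sin_le b : `|sin b| <= `|b|.
Proof.
wlog b0 : b / 0 <= b.
  move=> H; have [|/ltW b0] := leP 0 b; first exact: H.
  by rewrite -normrN -sinN -[leRHS]normrN; apply: H; rewrite oppr_ge0.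
rewrite (ger0_norm b0); have [b1|b1] := leP b 1.
  have pi2 := @pi_ge2 R.
  by rewrite ger0_norm ?sin_le// sin_ge0_pi//; lra.
by rewrite (le_trans (sin_max b))// ltW.
Qed.

Lemma abs_cos1_le b : `|cos b - 1| <= b ^+ 2.
Proof.
have -> : cos b - 1 = - (2 * sin (b / 2) ^+ 2).
  by rewrite {1}(_ : b = b / 2 + b / 2) ?cosD -?expr2; [have := cos2Dsin2 (b / 2); lra|field].
rewrite normrN ger0_norm; last by rewrite mulr_ge0// sqr_ge0.
have h : sin (b / 2) ^+ 2 <= (b / 2) ^+ 2.
  by rewrite -(real_normK (num_real (sin _))) -(real_normK (num_real (b / 2))) lerXn2r ?nnegrE// abs_sin_le.
have := sqr_ge0 b; lra.
Qed.

(** From x cos x <= sin x <= x and the quadratic bound on 1 - cos x. *)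
Lemma abs_sin_sub_le b : `|sin b - b| <= 2 * b ^+ 2.
Proof.
wlog b0 : b / 0 <= b.
  move=> H; have [|/ltW b0] := leP 0 b; first exact: H.
  have := H (- b); rewrite sinN sqrrN opprK -normrN opprD opprK; apply.
  by rewrite oppr_ge0.
have pi2 := @pi_ge2 R.
have h1 := sin_le b0.
rewrite distrC ger0_norm ?subr_ge0//; have [b1|b1] := leP b 1; last first.
  have := sin_geN1 b; have : b <= b ^+ 2 by rewrite expr2 ler_peMl// ltW.
  lra.
have h2 : b * cos b <= sin b by apply: xcos_le_sin; lra.
have h3 := abs_cos1_le b; have {h3} : 1 - cos b <= b ^+ 2.
  by rewrite -[leLHS]opprB (le_trans _ h3)// -normrN ler_norm.
have : b * b ^+ 2 <= b ^+ 2 by rewrite ler_piMl// sqr_ge0.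
move=> h3 h4; have := ler_wpM2l b0 h4; rewrite mulrBr mulr1; have := sqr_ge0 b; lra.
Qed.

Lemma abs_expR_sub1_le a : `|expR a - 1| <= `|a| * expR `|a|.
Proof.
have [a0|a0] := leP 0 a.
  rewrite !ger0_norm// ?subr_ge0 -?[leLHS]expR0 ?ler_expR//.
  have : 1 - a <= expR (- a) by apply: expR_ge1Dx.
  rewrite expRN -(ler_pM2r (expR_gt0 a)) mulVf ?gt_eqF ?expR_gt0//; lra.
rewrite distrC ger0_norm ?subr_ge0 ?expR_le1 ?(ltW a0)// ltr0_norm//.
have h1 : 1 + a <= expR a by apply: expR_ge1Dx.
have h2 : 1 <= expR (- a) by rewrite -[leLHS]expR0 ler_expR; lra.
rewrite (@le_trans _ _ (- a))//; first by lra.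
by rewrite ler_peMr//; lra.
Qed.

(** The second-order remainder of the complex exponential, from those of exp, cos
and sin.  The norm is replaced by the sum of the absolute values of the
coordinates, which is compatible with scaling by a real logarithm. *)
Lemma cexp_taylor1 z (H := (`|Re z| + `|Im z|)) :
  `|Re (cexp z - 1 - z)| <= 4 * H ^+ 2 * expR H /\
  `|Im (cexp z - 1 - z)| <= 4 * H ^+ 2 * expR H.
Proof.
case: z @H => a b /=; set H := `|a| + `|b|.
have a0 := normr_ge0 a; have b0 := normr_ge0 b.
have E1 : 1 <= expR `|a| by rewrite -[leLHS]expR0 ler_expR.
have Ea : expR a <= expR `|a| by rewrite ler_expR ler_norm.
have EH : expR `|a| <= expR H by rewrite ler_expR lerDl.
have ea0 := expR_ge0 a; have eA0 := expR_ge0 `|a|.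
have a2 : a ^+ 2 = `|a| ^+ 2 by rewrite real_normK ?num_real.
have b2 : b ^+ 2 = `|b| ^+ 2 by rewrite real_normK ?num_real.
have key (X : R) : X <= 4 * H ^+ 2 * expR `|a| -> X <= 4 * H ^+ 2 * expR H.
  move=> h; rewrite (le_trans h)// ler_wpM2l// mulr_ge0// exprn_ge0// addr_ge0//.
split; apply: key.
- rewrite (_ : _ - _ = (expR a - 1 - a) + expR a * (cos b - 1)); last by ring.
  rewrite (le_trans (ler_normD _ _))// normrM (ger0_norm ea0).
  have h1 := expR_taylor1 a; have h2 := ler_pM ea0 (normr_ge0 _) Ea (abs_cos1_le b).
  have h3 : 4 * H ^+ 2 * expR `|a| = a ^+ 2 * expR `|a| + expR `|a| * b ^+ 2 +
     expR `|a| * (3 * `|a| ^+ 2 + 3 * `|b| ^+ 2 + 8 * (`|a| * `|b|)).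
    by rewrite /H a2 b2; ring.
  have h4 : 0 <= expR `|a| * (3 * `|a| ^+ 2 + 3 * `|b| ^+ 2 + 8 * (`|a| * `|b|)).
    by rewrite mulr_ge0// !addr_ge0// ?mulr_ge0 ?exprn_ge0.
  lra.
- rewrite (_ : _ - _ = expR a * (sin b - b) + b * (expR a - 1)); last by ring.
  rewrite (le_trans (ler_normD _ _))// !normrM (ger0_norm ea0).
  have h1 := ler_wpM2l b0 (abs_expR_sub1_le a).
  have h2 := ler_pM ea0 (normr_ge0 _) Ea (abs_sin_sub_le b).
  have h3 : 4 * H ^+ 2 * expR `|a| = expR `|a| * (2 * b ^+ 2) + `|b| * (`|a| * expR `|a|) +
     expR `|a| * (4 * `|a| ^+ 2 + 2 * `|b| ^+ 2 + 7 * (`|a| * `|b|)).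
    by rewrite /H b2; ring.
  have h4 : 0 <= expR `|a| * (4 * `|a| ^+ 2 + 2 * `|b| ^+ 2 + 7 * (`|a| * `|b|)).
    by rewrite mulr_ge0// !addr_ge0// ?mulr_ge0 ?exprn_ge0.
  lra.
Qed.
End ComplexBasics.

(** * Complex integrals and holomorphy of Mellin transforms *)

Lemma sqr_add_le (R : realType) (x y : R) : (x + y) ^+ 2 <= 2 * (x ^+ 2 + y ^+ 2).
Proof.
have := sqr_ge0 (x - y); rewrite (_ : (x - y) ^+ 2 = 2 * (x ^+ 2 + y ^+ 2) - (x + y) ^+ 2); last by ring.
by rewrite subr_ge0.
Qed.

Section CIntegral.
Variable R : realType.
Local Notation mu := (@lebesgue_measure R).
Local Notation RR := (measurableTypeR R).
Local Notation Re := (@complex.Re R).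
Local Notation Im := (@complex.Im R).
Implicit Types (D : set RR) (f g : RR -> R[i]) (c s z : R[i]).

Lemma eq_cintegral D f g : (forall t, D t -> f t = g t) -> cintegral D f = cintegral D g.
Proof.
by move=> fg; rewrite /cintegral; congr (_ +i* _); apply: eq_Rintegral => t /set_mem Dt; rewrite fg.
Qed.

Lemma eq_cintegrable D f g : measurable D -> (forall t, D t -> f t = g t) ->
  cintegrable D f -> cintegrable D g.
Proof.
move=> mD fg [h1 h2]; split; [apply: (integ_eq mD _ h1)|apply: (integ_eq mD _ h2)];
  by move=> t Dt; rewrite fg.
Qed.

Lemma cintegrableD D f g : measurable D -> cintegrable D f -> cintegrable D g ->
  cintegrable D (fun t => f t + g t).
Proof.
move=> mD [f1 f2] [g1 g2]; split.
  by apply: (integ_eq mD _ (integD mD f1 g1)) => t _; rewrite cReD.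
by apply: (integ_eq mD _ (integD mD f2 g2)) => t _; rewrite cImD.
Qed.

Lemma cintegralD D f g : measurable D -> cintegrable D f -> cintegrable D g ->
  cintegral D (fun t => f t + g t) = cintegral D f + cintegral D g.
Proof.
move=> mD [f1 f2] [g1 g2]; apply: complex_eq; rewrite ?cReD ?cImD /cintegral /=.
  by rewrite -(RintegralD mD f1 g1); apply: eq_Rintegral => t _; rewrite cReD.
by rewrite -(RintegralD mD f2 g2); apply: eq_Rintegral => t _; rewrite cImD.
Qed.

Lemma cintegrableZ D c f : measurable D -> cintegrable D f -> cintegrable D (fun t => c * f t).
Proof.
move=> mD [f1 f2]; split.
  by apply: (integ_eq mD _ (integB mD (integZ (Re c) mD f1) (integZ (Im c) mD f2))) => t _; rewrite cReM.
by apply: (integ_eq mD _ (integD mD (integZ (Re c) mD f2) (integZ (Im c) mD f1))) => t _; rewrite cImM.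
Qed.

Lemma cintegralZ D c f : measurable D -> cintegrable D f ->
  cintegral D (fun t => c * f t) = c * cintegral D f.
Proof.
move=> mD [f1 f2]; apply: complex_eq; rewrite ?cReM ?cImM /cintegral /=.
  rewrite -(RintegralZl (Re c) mD f1) -(RintegralZl (Im c) mD f2).
  rewrite -(RintegralB mD (integZ (Re c) mD f1) (integZ (Im c) mD f2)).
  by apply: eq_Rintegral => t _; rewrite cReM.
rewrite -(RintegralZl (Re c) mD f2) -(RintegralZl (Im c) mD f1).
rewrite -(RintegralD mD (integZ (Re c) mD f2) (integZ (Im c) mD f1)).
by apply: eq_Rintegral => t _; rewrite cImM.
Qed.

Lemma cintegrableB D f g : measurable D -> cintegrable D f -> cintegrable D g ->
  cintegrable D (fun t => f t - g t).
Proof.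
move=> mD fi gi; apply: (eq_cintegrable mD _ (cintegrableD mD fi (cintegrableZ (-1) mD gi))) => t _.
by rewrite mulN1r.
Qed.

Lemma cintegralB D f g : measurable D -> cintegrable D f -> cintegrable D g ->
  cintegral D (fun t => f t - g t) = cintegral D f - cintegral D g.
Proof.
move=> mD fi gi; rewrite -[X in _ + X]mulN1r -(cintegralZ (-1) mD gi).
rewrite -(cintegralD mD fi (cintegrableZ (-1) mD gi)).
by apply: eq_cintegral => t _; rewrite mulN1r.
Qed.

(** Bounding both coordinates loses a factor 2, which is harmless for derivatives. *)
Lemma normc_cintegral_le D f (g : RR -> R) : measurable D -> cintegrable D f -> integ D g ->
  (forall t, D t -> `|Re (f t)| <= g t /\ `|Im (f t)| <= g t) ->
  `|cintegral D f| <= (2 * \int[mu]_(t in D) g t)%:C.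
Proof.
move=> mD [f1 f2] gi fg; rewrite (le_trans (normc_le _))// lecR /cintegral/=.
rewrite mulr_natl mulr2n lerD//.
  rewrite (le_trans (le_normr_Rintegral mD f1))//.
  by apply: le_Rintegral => // [|t /fg[]//]; exact: (integ_norm f1).
rewrite (le_trans (le_normr_Rintegral mD f2))//.
by apply: le_Rintegral => // [|t /fg[]//]; exact: (integ_norm f2).
Qed.

Lemma cintegral_setU D1 D2 f : measurable D1 -> measurable D2 -> [disjoint D1 & D2] ->
  cintegrable (D1 `|` D2) f ->
  cintegral (D1 `|` D2) f = cintegral D1 f + cintegral D2 f.
Proof.
move=> m1 m2 d [f1 f2]; apply: complex_eq; rewrite ?cReD ?cImD /cintegral /=.
  exact: Rintegral_setU.
exact: Rintegral_setU.
Qed.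
End CIntegral.

Section Mellin.
Variable R : realType.
Local Notation mu := (@lebesgue_measure R).
Local Notation RR := (measurableTypeR R).
Local Notation Re := (@complex.Re R).
Local Notation Im := (@complex.Im R).
Variable D : set RR.
Hypotheses (mD : measurable D) (D0 : forall t, D t -> 0 < t).
Implicit Types (phi : RR -> R) (s h : R[i]) (t : R).

(** The Mellin transform with exponent s in place of s - 1, over an arbitrary domain:
the integral over ]0, +oo[ is split later. *)
Definition mellin phi s : R[i] := cintegral D (fun t => (phi t)%:C * rpowC t s).

Lemma measurable_mellin_Re phi s : measurable_fun D phi ->
  measurable_fun D (fun t => Re ((phi t)%:C * rpowC t s)).
Proof.
move=> mphi; rewrite (_ : (fun t => _) = fun t => phi t * (pw (Re s) t * cos (Im s * ln t))); last first.
  by apply/funext => t; rewrite cReM Re_rpowC /= mul0r subr0.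
apply: measurable_funM => //; apply: cont_pos_measurable => // t t0.
apply: cont_posM => // [|{t0}t t0]; first exact: cont_pw.
apply: (@continuous_comp _ _ _ (fun t => Im s * ln t) cos); last exact: continuous_cos.
by apply: cvgM; [exact: cvg_cst|exact: continuous_ln].
Qed.

Lemma measurable_mellin_Im phi s : measurable_fun D phi ->
  measurable_fun D (fun t => Im ((phi t)%:C * rpowC t s)).
Proof.
move=> mphi; rewrite (_ : (fun t => _) = fun t => phi t * (pw (Re s) t * sin (Im s * ln t))); last first.
  by apply/funext => t; rewrite cImM Im_rpowC /= mul0r addr0.
apply: measurable_funM => //; apply: cont_pos_measurable => // t t0.
apply: cont_posM => // [|{t0}t t0]; first exact: cont_pw.
apply: (@continuous_comp _ _ _ (fun t => Im s * ln t) sin); last exact: continuous_sin.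
by apply: cvgM; [exact: cvg_cst|exact: continuous_ln].
Qed.

Lemma Re_mellin_le phi s t : `|Re ((phi t)%:C * rpowC t s)| <= `|phi t| * pw (Re s) t.
Proof.
rewrite cReM Re_rpowC /= mul0r subr0 normrM ler_wpM2l// normrM (ger0_norm (pw_ge0 _ _)).
by rewrite ler_piMr ?pw_ge0// cos_max.
Qed.

Lemma Im_mellin_le phi s t : `|Im ((phi t)%:C * rpowC t s)| <= `|phi t| * pw (Re s) t.
Proof.
rewrite cImM Im_rpowC /= mul0r addr0 normrM ler_wpM2l// normrM (ger0_norm (pw_ge0 _ _)).
by rewrite ler_piMr ?pw_ge0// sin_max.
Qed.

Lemma mellin_integrable phi s : measurable_fun D phi ->
  integ D (fun t => `|phi t| * pw (Re s) t) ->
  cintegrable D (fun t => (phi t)%:C * rpowC t s).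
Proof.
move=> mphi ip; split.
  by apply: (integ_dom mD (measurable_mellin_Re s mphi) _ ip) => t _; exact: Re_mellin_le.
by apply: (integ_dom mD (measurable_mellin_Im s mphi) _ ip) => t _; exact: Im_mellin_le.
Qed.

(** The integrand is phi t * t^s and t^(s+h) = t^s exp (h ln t); the remainder of
order 2 of exp is bounded by |h|^2 (ln t)^2 exp (|h| |ln t|), and for |h| < eps / 4
the last two factors are absorbed by t^eps + t^(-eps). *)
Lemma is_derive_mellin phi s (eps : R) : 0 < eps -> measurable_fun D phi ->
  integ D (fun t => `|phi t| * pw (Re s + eps) t) ->
  integ D (fun t => `|phi t| * pw (Re s - eps) t) ->
  is_derive (s : (R[i])^o) (1 : (R[i])^o) (mellin phi : (R[i])^o -> (R[i])^o)
    (mellin (fun t => phi t * ln t) s).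
Proof.
move=> e0 mphi i1 i2.
pose g t := `|phi t| * pw (Re s + eps) t + `|phi t| * pw (Re s - eps) t.
have gi : integ D g by exact: integD.
have gE t : g t = `|phi t| * pw (Re s) t * (pw eps t + pw (- eps) t).
  by rewrite /g !pwD; ring.
have g0 t : 0 <= g t by rewrite addr_ge0// mulr_ge0// pw_ge0.
have absln t : expR (eps * `|ln t|) <= pw eps t + pw (- eps) t.
  rewrite /pw; have := expR_ge0 (eps * ln t); have := expR_ge0 (- eps * ln t).
  case: (ger0P (ln t)) => _; rewrite ?mulrN -?mulNr; lra.
have ln2 t : ln t ^+ 2 * expR (eps / 2 * `|ln t|) <= 8 / eps ^+ 2 * (pw eps t + pw (- eps) t).
  apply: le_trans (ler_wpM2l _ (absln t)); last by rewrite divr_ge0// exprn_ge0// ltW.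
  have := pow_le_expR 2 (mulr_ge0 (ltW (divr_gt0 e0 (ltr0n R 2))) (normr_ge0 (ln t))).
  rewrite exprMn real_normK ?num_real// => h.
  have -> : eps * `|ln t| = eps / 2 * `|ln t| + eps / 2 * `|ln t| by field.
  rewrite expRD mulrA ler_wpM2r ?expR_ge0// mulrAC ler_pdivlMr ?exprn_gt0//.
  have -> : ln t ^+ 2 * eps ^+ 2 = 4 * ((eps / 2) ^+ 2 * ln t ^+ 2) by field.
  by rewrite (_ : 8 * _ = 4 * (2`!%:R * expR (eps / 2 * `|ln t|))) ?ler_wpM2l//; rewrite !factS fact0; ring.
have mln : measurable_fun D (@ln R).
  by apply: cont_pos_measurable => // t t0; exact: continuous_ln.
have mphil : measurable_fun D (fun t => phi t * ln t) by exact: measurable_funM.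
have pw_mid (a : R) t : `|a| <= eps -> pw (Re s + a) t <= pw (Re s) t * (pw eps t + pw (- eps) t).
  move=> ae; rewrite pwD ler_wpM2l ?pw_ge0// (le_trans _ (absln t))// ler_expR.
  by rewrite (le_trans (ler_norm _))// normrM ler_wpM2r.
have iz z : `|Re z| <= eps -> cintegrable D (fun t => (phi t)%:C * rpowC t (s + z)).
  move=> ze; apply: mellin_integrable => //.
  apply: (integ_dom mD _ _ gi) => [|t Dt].
    apply: measurable_funM; first exact: measurableT_comp.
    by apply: cont_pos_measurable => //; exact: cont_pw.
  rewrite ger0_norm ?mulr_ge0 ?pw_ge0// gE -mulrA ler_wpM2l// cReD.
  exact: pw_mid.
have i0 : cintegrable D (fun t => (phi t)%:C * rpowC t s).
  by have := iz 0; rewrite addr0; apply; rewrite normr0 ltW.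
have il : cintegrable D (fun t => (phi t * ln t)%:C * rpowC t s).
  apply: mellin_integrable => //.
  apply: (integ_dom mD (g := fun t => (1 / eps) * g t)) => [|t Dt|]; last exact: integZ.
    apply: measurable_funM; first exact: measurableT_comp.
    by apply: cont_pos_measurable => //; exact: cont_pw.
  rewrite ger0_norm ?mulr_ge0 ?pw_ge0// gE normrM.
  have h : `|ln t| <= (1 / eps) * (pw eps t + pw (- eps) t).
    rewrite mulrAC mul1r ler_pdivlMr// mulrC (le_trans _ (absln t))//.
    by rewrite (le_trans _ (expR_ge1Dx _))// lerDr.
  have h' := ler_wpM2l (mulr_ge0 (normr_ge0 (phi t)) (pw_ge0 (Re s) t)) h.
  by rewrite mulrAC (le_trans h')// mulrCA.
set I0 := \int[mu]_(t in D) g t.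
have I00 : 0 <= I0 by apply: Rintegral_ge0 => t _.
pose K := 8 / eps ^+ 2 * I0.
have K0 : 0 <= K by rewrite mulr_ge0// divr_ge0// exprn_ge0// ltW.
apply: (@is_derive_of_quadratic_bound _ _ _ _ ((64 * K)%:C) ((eps / 4)%:C)) => //.
- by rewrite ltcR divr_gt0.
- by rewrite lecR mulr_ge0.
move=> h hh; have [hr hi] := normc_lt_ReIm hh.
pose H := `|Re h| + `|Im h|; have H0 : 0 <= H by rewrite addr_ge0.
have He : H <= eps / 2 by rewrite /H; lra.
have ih : cintegrable D (fun t => (phi t)%:C * rpowC t (s + h)) by apply: iz; lra.
have ihl := cintegrableZ h mD il.
rewrite /mellin -(cintegralB mD ih i0) -(cintegralZ h mD il).
rewrite -(cintegralB mD (cintegrableB mD ih i0) ihl).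
have E t : (phi t)%:C * rpowC t (s + h) - (phi t)%:C * rpowC t s - h * ((phi t * ln t)%:C * rpowC t s) =
    ((phi t)%:C * rpowC t s) * (cexp (h * (ln t)%:C) - 1 - h * (ln t)%:C).
  by rewrite rpowCD rmorphM/= /(rpowC t h); ring.
have bnd t : D t -> (4 * H ^+ 2 * (`|ln t|) ^+ 2) * expR (H * `|ln t|) <= 4 * H ^+ 2 * (8 / eps ^+ 2 * (pw eps t + pw (- eps) t)).
  move=> Dt; rewrite -mulrA ler_wpM2l ?mulr_ge0 ?exprn_ge0//.
  rewrite real_normK ?num_real// (le_trans _ (ln2 t))// ler_wpM2l ?sqr_ge0//.
  by rewrite ler_expR ler_wpM2r.
have bnd2 t (X Y : R) : D t -> `|X| <= `|phi t| * pw (Re s) t ->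
   `|Y| <= 4 * (H * `|ln t|) ^+ 2 * expR (H * `|ln t|) ->
   `|X * Y| <= 32 / eps ^+ 2 * H ^+ 2 * g t.
  move=> Dt hX hY; rewrite normrM.
  have A0 : 0 <= `|phi t| * pw (Re s) t by rewrite mulr_ge0// pw_ge0.
  have h1 := ler_pM (normr_ge0 X) (normr_ge0 Y) hX hY.
  rewrite exprMn in h1; have h2 := ler_wpM2l A0 (bnd t Dt).
  rewrite -[4 * H ^+ 2 * _]mulrA in h2; rewrite (le_trans h1)// (le_trans h2)//.
  by rewrite gE le_eqVlt; apply/orP; left; apply/eqP; field; rewrite gt_eqF.
have bnd3 (A B : R[i]) t : D t -> `|Re A| <= `|phi t| * pw (Re s) t ->
   `|Im A| <= `|phi t| * pw (Re s) t ->
   `|Re B| <= 4 * (H * `|ln t|) ^+ 2 * expR (H * `|ln t|) ->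
   `|Im B| <= 4 * (H * `|ln t|) ^+ 2 * expR (H * `|ln t|) ->
   `|Re (A * B)| <= 64 / eps ^+ 2 * H ^+ 2 * g t /\ `|Im (A * B)| <= 64 / eps ^+ 2 * H ^+ 2 * g t.
  move=> Dt a1 a2 b1 b2.
  have -> : 64 / eps ^+ 2 * H ^+ 2 * g t =
      32 / eps ^+ 2 * H ^+ 2 * g t + 32 / eps ^+ 2 * H ^+ 2 * g t by field; rewrite gt_eqF.
  rewrite cReM cImM; split.
    by rewrite (le_trans (ler_normB _ _))// lerD// bnd2.
  by rewrite (le_trans (ler_normD _ _))// lerD// bnd2.
have ic := cintegrableB mD (cintegrableB mD ih i0) ihl.
have ig2 : integ D (fun t => 64 / eps ^+ 2 * H ^+ 2 * g t) by apply: integZ.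
have := normc_cintegral_le mD ic ig2.
move=> /(_ _)/le_trans; apply.
  move=> t Dt; rewrite E; apply: bnd3 => //; [exact: Re_mellin_le|exact: Im_mellin_le|..].
    have [] := cexp_taylor1 (h * (ln t)%:C).
    rewrite cReM cImM /= !mulr0 subr0 add0r !normrM -mulrDl => + _; exact.
  have [] := cexp_taylor1 (h * (ln t)%:C).
  rewrite cReM cImM /= !mulr0 subr0 add0r !normrM -mulrDl => _; exact.
rewrite (RintegralZl _ mD gi) -/I0 -add_Re2_Im2 -rmorphM lecR.
have hH : H ^+ 2 <= 2 * (Re h ^+ 2 + Im h ^+ 2).
  rewrite -(real_normK (num_real (Re h))) -(real_normK (num_real (Im h))).
  exact: sqr_add_le.
set S := Re h ^+ 2 + Im h ^+ 2 in hH *.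
have S0 : 0 <= S by rewrite addr_ge0// sqr_ge0.
rewrite (_ : 2 * _ = 16 * (K * H ^+ 2)); last by rewrite /K; ring.
rewrite (le_trans (ler_wpM2l (ler0n R 16) (ler_wpM2l K0 hH)))//.
rewrite -subr_ge0 (_ : _ - _ = 32 * (K * S)); last by ring.
by rewrite mulr_ge0// mulr_ge0.
Qed.
End Mellin.

(** * Euler's integral *)

Section ScaleReal.
Variable R : realType.
Lemma cReZ (x : R) (z : R[i]) : complex.Re (x%:C * z) = x * complex.Re z.
Proof. by case: z => a b /=; rewrite mul0r subr0. Qed.
Lemma cImZ (x : R) (z : R[i]) : complex.Im (x%:C * z) = x * complex.Im z.
Proof. by case: z => a b /=; rewrite mul0r addr0. Qed.
End ScaleReal.

Section GammaReal.
Variable R : realType.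
Local Notation mu := (@lebesgue_measure R).
Local Notation RR := (measurableTypeR R).
Local Notation Re := (@complex.Re R).
Local Notation Im := (@complex.Im R).
Implicit Types (D : set RR) (z s : R[i]) (t p : R).

Lemma integ_setU D1 D2 (f : RR -> R) : measurable D1 -> measurable D2 ->
  integ D1 f -> integ D2 f -> integ (D1 `|` D2) f.
Proof.
move=> m1 m2 i1 i2; have m12 := measurableU _ _ m1 m2.
have mf : measurable_fun (D1 `|` D2) f.
  by apply/measurable_funU => //; split; exact: integ_measurable.
apply/(integrable_mkcond _ m12).
have j1 := (integrable_mkcond _ m1).1 i1; have j2 := (integrable_mkcond _ m2).1 i2.
have j := integrableD measurableT (integrable_abse j1) (integrable_abse j2).
apply: (le_integrable measurableT _ _ j).
  have mf' : measurable_fun (D1 `|` D2) (EFin \o f) by exact/measurable_EFinP.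
  exact: (measurable_restrictT _ m12).1 mf'.
move=> t _ /=; rewrite !patchE.
case: (boolP (t \in D1)) => t1; case: (boolP (t \in D2)) => t2; rewrite ?in_setU ?t1 ?t2 ?(negbTE t1) ?(negbTE t2)/=.
- by rewrite lee_fin [leRHS]ger0_norm ?addr_ge0// lerDl.
- by rewrite normr0 addr0 normr_id.
- by rewrite normr0 add0r normr_id.
- by rewrite lee_fin normr0.
Qed.

Definition posR : set RR := `]0, +oo[%classic.
Lemma measurable_posR : measurable posR. Proof. exact: measurable_itv. Qed.
Lemma posR_gt0 t : posR t -> 0 < t. Proof. by rewrite /posR /= in_itv/= andbT. Qed.
Lemma gt0_posR t : 0 < t -> posR t. Proof. by rewrite /posR /= in_itv/= andbT. Qed.

Lemma posR_split : posR = `]0, 1]%classic `|` `[1, +oo[%classic.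
Proof.
apply/seteqP; split => t; rewrite /posR /= !in_itv/= !andbT.
  by move=> t0; case: (leP t 1) => [|/ltW]; [left; rewrite t0|right].
by case=> [/andP[]|/(lt_le_trans _)]//; apply.
Qed.

Lemma cont_expRN : cont_pos (fun t : R => expR (- t)).
Proof.
by move=> t t0; apply: (@continuous_comp _ _ _ (fun t => - t) expR); [exact: opp_continuous|exact: continuous_expR].
Qed.

Lemma integ_gamma p : -1 < p -> integ posR (fun t => expR (- t) * pw p t).
Proof.
move=> p1; rewrite posR_split; apply: integ_setU => //.
  have m01 : forall t : R, `]0, 1]%classic t -> 0 < t.
    by move=> t; rewrite /= in_itv/= => /andP[].
  apply: (integ_dom (g := pw p)) => // [|t t1|]; last exact: integ_pw_01.
    by apply: cont_pos_measurable => //; apply: cont_posM; [exact: cont_expRN|exact: cont_pw].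
  rewrite ger0_norm ?mulr_ge0 ?expR_ge0 ?pw_ge0// ler_piMl ?pw_ge0//.
  by rewrite expR_le1 oppr_le0 ltW// m01.
have := @integ_pw_exp_1y R p 1 ltr01; apply: integ_eq => // t _.
by rewrite mulrC mulN1r.
Qed.

Lemma integ_gamma_abs p : -1 < p -> integ posR (fun t => `|expR (- t)| * pw p t).
Proof.
by move=> p1; apply: (integ_eq measurable_posR _ (integ_gamma p1)) => t _; rewrite ger0_norm ?expR_ge0.
Qed.

Lemma measurable_expRN : measurable_fun posR (fun t : R => expR (- t)).
Proof.
apply: cont_pos_measurable; [exact: measurable_posR|exact: posR_gt0|exact: cont_expRN].
Qed.

Lemma Euler_integralE z : Euler_integral z = mellin posR (fun t => expR (- t)) (z - 1).
Proof. by []. Qed.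

Lemma Euler_integrable z : -1 < Re z ->
  cintegrable posR (fun t => (expR (- t))%:C * rpowC t z).
Proof.
move=> z1; apply: mellin_integrable; [exact: measurable_posR|exact: posR_gt0|
  exact: measurable_expRN|exact: integ_gamma_abs].
Qed.

(** Real and imaginary parts, so that the real fundamental theorem applies to
primitives with complex values. *)
Lemma is_derive_Re_rpowC z t : 0 < t ->
  is_derive t 1 (fun t => Re (rpowC t z)) (Re (z * rpowC t (z - 1))) /\
  is_derive t 1 (fun t => Im (rpowC t z)) (Im (z * rpowC t (z - 1))).
Proof.
move=> t0; have dp := is_derive_pw (Re z) t0; have dl := is_derive1_ln t0.
have dm : is_derive t 1 (fun t => Im z * ln t) (Im z * t^-1).
  by apply: is_derive_eq; rewrite /GRing.scale/=; ring.
have dc := @is_derive1_comp R cos (fun t => Im z * ln t) t _ _ (is_derive_cos (Im z * ln t)) dm.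
have ds := @is_derive1_comp R sin (fun t => Im z * ln t) t _ _ (is_derive_sin (Im z * ln t)) dm.
have -> : (fun t => Re (rpowC t z)) = (pw (Re z) * (cos \o (fun t => Im z * ln t)))%R.
  by apply/funext => s; rewrite Re_rpowC.
have -> : (fun t => Im (rpowC t z)) = (pw (Re z) * (sin \o (fun t => Im z * ln t)))%R.
  by apply/funext => s; rewrite Im_rpowC.
have e1 : Re (z - 1) = Re z - 1 by rewrite cReD cReN.
have e2 : Im (z - 1) = Im z by rewrite cImD cImN oppr0 addr0.
have ew : pw (Re z) t = pw (Re z - 1) t * t by rewrite -{3}(pw1 t0) -pwD subrK.
split.
  apply: (is_derive_eq (is_deriveM dp dc)).
  rewrite /GRing.scale/= cReM Re_rpowC Im_rpowC e1 e2 ew.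
  by field; rewrite gt_eqF.
apply: (is_derive_eq (is_deriveM dp ds)).
rewrite /GRing.scale/= cImM Re_rpowC Im_rpowC e1 e2 ew.
by field; rewrite gt_eqF.
Qed.

Lemma cvg_pw_neg (x : R) : 0 < x -> pw (- x) (n.+2)%:R @[n --> \oo] --> (0 : R).
Proof.
move=> x0; apply/cvgrPdist_le => e e0.
apply: filterS (near_large (pw x^-1 e^-1)) => n h.
rewrite sub0r normrN ger0_norm ?pw_ge0//.
have h2 : x^-1 * ln e^-1 <= ln n.+2%:R.
  by rewrite -[leLHS]expRK ler_ln ?posrE ?expR_gt0.
rewrite /pw -[leRHS](lnK (x := e)) ?posrE// ler_expR.
have := ler_wpM2l (ltW x0) h2; rewrite lnV ?posrE// mulVKf ?gt_eqF//; lra.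
Qed.

Lemma cvg_pw_exp (x : R) : expR (- (n.+2)%:R) * pw x (n.+2)%:R @[n --> \oo] --> (0 : R).
Proof.
have [K K0 hK] := @pw_le_expR R (x + 1) 1 ltr01.
have c : K * pw (-1) (n.+2)%:R @[n --> \oo] --> (0 : R).
  by rewrite -[X in _ --> X](mulr0 K); apply: cvgM; [exact: cvg_cst|exact: cvg_pw_neg].
apply: squeeze_cvgr (cvg_cst 0) c; apply: nearW => n.
rewrite mulr_ge0 ?expR_ge0 ?pw_ge0//=.
have := hK n.+2%:R; rewrite ler1n => /(_ isT); rewrite mul1r pwD => h.
rewrite pwN ler_pdivlMr ?pw_gt0// -mulrA expRN mulrC ler_pdivrMr ?expR_gt0//.
Qed.

Lemma cvg_pw_small (x : R) : 0 < x ->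
  expR (- (n.+2)%:R^-1) * pw x (n.+2)%:R^-1 @[n --> \oo] --> (0 : R).
Proof.
move=> x0; apply: squeeze_cvgr (cvg_cst 0) (cvg_pw_neg x0); apply: nearW => n.
rewrite mulr_ge0 ?expR_ge0 ?pw_ge0//= pwV// ler_piMl ?pw_ge0//.
Qed.

(** Integration by parts: z exp (- t) t^(z-1) - exp (- t) t^z is the derivative of
exp (- t) t^z, which vanishes at both ends. *)
Lemma Euler_integralS z : 0 < Re z -> Euler_integral (z + 1) = z * Euler_integral z.
Proof.
move=> z0; rewrite !Euler_integralE addrK.
have ez : -1 < Re (z - 1) by rewrite cReD cReN /=; lra.
have ez2 : -1 < Re z by lra.
have i1 := Euler_integrable ez; have i2 := Euler_integrable ez2.
have mP := measurable_posR.
have i3 := cintegrableZ z mP i1; have i4 := cintegrableB mP i3 i2.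
(* The difference of the two integrands is an exact derivative. *)
suff h : cintegral posR (fun t => z * ((expR (- t))%:C * rpowC t (z - 1)) - (expR (- t))%:C * rpowC t z) = 0.
  apply/esym/eqP; rewrite -subr_eq0 /mellin -(cintegralZ z mP i1) -(cintegralB mP i3 i2).
  exact/eqP.
have n0 n : 0 < n.+2%:R^-1 :> R by rewrite invr_gt0.
have nn n : n.+2%:R^-1 < n.+2%:R :> R by apply: lt_trans (ltrVn1 R n) (ltr1n2 R n).
have cover t : posR t -> \forall n \near \oo, n.+2%:R^-1 <= t <= n.+2%:R.
  move=> /posR_gt0 t0.
  by apply: filterS2 (near_large t) (near_small t0) => n -> ->.
have dE (t : R) : is_derive t 1 (fun t : R => expR (- t)) (- expR (- t)).
  apply: (is_derive_eq (@is_derive1_comp R expR (fun t => - t) t _ _ _ _)).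
  by rewrite mulrN1.
have d1 t : 0 < t -> is_derive t 1 (fun t => Re ((expR (- t))%:C * rpowC t z))
    (Re (z * ((expR (- t))%:C * rpowC t (z - 1)) - (expR (- t))%:C * rpowC t z)).
  move=> t0; have [dr _] := is_derive_Re_rpowC z t0.
  have -> : (fun t => Re ((expR (- t))%:C * rpowC t z)) = fun t => expR (- t) * Re (rpowC t z).
    by apply/funext => s; rewrite cReZ.
  apply: (is_derive_eq (is_deriveM (dE t) dr)).
  rewrite [LHS](_ : _ = expR (- t) * Re (z * rpowC t (z - 1)) + Re (rpowC t z) * (- expR (- t)))//.
  move: (rpowC t z) (rpowC t (z - 1)) (expR (- t)) => w w' e.
  by rewrite !(cReD, cReN, cReZ, cImZ, cReM, cImM)/=; ring.
have d2 t : 0 < t -> is_derive t 1 (fun t => Im ((expR (- t))%:C * rpowC t z))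
    (Im (z * ((expR (- t))%:C * rpowC t (z - 1)) - (expR (- t))%:C * rpowC t z)).
  move=> t0; have [_ dr] := is_derive_Re_rpowC z t0.
  have -> : (fun t => Im ((expR (- t))%:C * rpowC t z)) = fun t => expR (- t) * Im (rpowC t z).
    by apply/funext => s; rewrite cImZ.
  apply: (is_derive_eq (is_deriveM (dE t) dr)).
  rewrite [LHS](_ : _ = expR (- t) * Im (z * rpowC t (z - 1)) + Im (rpowC t z) * (- expR (- t)))//.
  move: (rpowC t z) (rpowC t (z - 1)) (expR (- t)) => w w' e.
  by rewrite !(cImD, cImN, cReZ, cImZ, cReM, cImM)/=; ring.
have cR w : cont_pos (fun t => Re (rpowC t w)).
  by move=> t t0; have [d _] := is_derive_Re_rpowC w t0; exact: is_derive_cont d.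
have cI w : cont_pos (fun t => Im (rpowC t w)).
  by move=> t t0; have [_ d] := is_derive_Re_rpowC w t0; exact: is_derive_cont d.
have cst (a : R) : cont_pos (fun=> a) by move=> t t0; exact: cvg_cst.
have cD (f g : R -> R) : cont_pos f -> cont_pos g -> cont_pos (fun t => f t + g t).
  by move=> cf cg t t0; apply: cvgD; [exact: cf|exact: cg].
have c1 : cont_pos (fun t => Re (z * ((expR (- t))%:C * rpowC t (z - 1)) - (expR (- t))%:C * rpowC t z)).
  rewrite (_ : (fun t => _) = fun t => expR (- t) * (Re z * Re (rpowC t (z - 1)) +
     (- Im z) * Im (rpowC t (z - 1)) + (-1) * Re (rpowC t z))); last first.
    apply/funext => t; move: (rpowC t z) (rpowC t (z - 1)) (expR (- t)) => w w' e.
    by rewrite !(cReD, cReN, cReZ, cImZ, cReM, cImM)/=; ring.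
  exact: (cont_posM (@cont_expRN) (cD _ _ (cD _ _ (cont_posM (cst (Re z)) (cR (z - 1)))
    (cont_posM (cst (- Im z)) (cI (z - 1)))) (cont_posM (cst (-1)) (cR z)))).
have c2 : cont_pos (fun t => Im (z * ((expR (- t))%:C * rpowC t (z - 1)) - (expR (- t))%:C * rpowC t z)).
  rewrite (_ : (fun t => _) = fun t => expR (- t) * (Re z * Im (rpowC t (z - 1)) +
     Im z * Re (rpowC t (z - 1)) + (-1) * Im (rpowC t z))); last first.
    apply/funext => t; move: (rpowC t z) (rpowC t (z - 1)) (expR (- t)) => w w' e.
    by rewrite !(cImD, cImN, cReZ, cImZ, cReM, cImM)/=; ring.
  exact: (cont_posM (@cont_expRN) (cD _ _ (cD _ _ (cont_posM (cst (Re z)) (cI (z - 1)))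
    (cont_posM (cst (Im z)) (cR (z - 1)))) (cont_posM (cst (-1)) (cI z)))).
have lim (f : R -> R) (u : nat -> R) : (forall t, `|f t| <= `|expR (- t)| * pw (Re z) t) ->
    expR (- u n) * pw (Re z) (u n) @[n --> \oo] --> (0 : R) -> f (u n) @[n --> \oo] --> (0 : R).
  move=> hf hu; apply/cvgrPdist_le => e e0; move/cvgrPdist_le : hu => /(_ e e0).
  apply: filterS => n; rewrite !sub0r !normrN; apply: le_trans.
  by rewrite (le_trans (hf _))// ger0_norm ?expR_ge0// ler_norm.
have lim1 f hf := lim f _ hf (cvg_pw_small z0).
have lim2 f hf := lim f _ hf (cvg_pw_exp (Re z)).
case: i4 => i4r i4i.
have hr t := Re_mellin_le (fun t : R => expR (- t)) z t.
have hi t := Im_mellin_le (fun t : R => expR (- t)) z t.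
have HR := FTC_improper mP n0 nn (@subset_nn R) cover d1 c1 i4r (lim1 _ hr) (lim2 _ hr).
have HI := FTC_improper mP n0 nn (@subset_nn R) cover d2 c2 i4i (lim1 _ hi) (lim2 _ hi).
by rewrite subr0 in HR HI; apply: complex_eq; [exact: HR|exact: HI].
Qed.
End GammaReal.

(** * Euler's integral has no zeros *)

Section GammaNonzero.
Variable R : realType.
Local Notation mu := (@lebesgue_measure R).
Local Notation RR := (measurableTypeR R).
Local Notation Re := (@complex.Re R).
Local Notation Im := (@complex.Im R).
Local Notation E := (@Euler_integral R).
Implicit Types (z s : R[i]) (t p : R).

(** Euler's integral at real arguments, for which positivity is available. *)
Definition realGamma p : R := \int[mu]_(t in @posR R) (expR (- t) * pw (p - 1) t).

Lemma Euler_integral_real p : E p%:C = (realGamma p)%:C.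
Proof.
have e1 : Re (p%:C - 1 : R[i]) = p - 1 by rewrite cReD cReN.
have e2 : Im (p%:C - 1 : R[i]) = 0 by rewrite cImD cImN /= oppr0 addr0.
apply: complex_eq.
  transitivity (\int[mu]_(t in @posR R) Re ((expR (- t))%:C * rpowC t (p%:C - 1))) => //.
  by apply: eq_Rintegral => t _; rewrite cReZ Re_rpowC e1 e2 mul0r cos0 mulr1.
transitivity (\int[mu]_(t in @posR R) Im ((expR (- t))%:C * rpowC t (p%:C - 1))) => //.
transitivity (\int[mu]_(t in @posR R) (0 : R)).
  by apply: eq_Rintegral => t _; rewrite cImZ Im_rpowC e2 mul0r sin0 !mulr0.
by rewrite Rintegral_cst ?mul0r//; exact: measurable_posR.
Qed.

Lemma realGammaS p : 0 < p -> realGamma (p + 1) = p * realGamma p.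
Proof.
move=> p0; have := @Euler_integralS R p%:C p0.
rewrite -[X in _ + X](_ : (1 : R)%:C = 1)// -rmorphD/= !Euler_integral_real -rmorphM.
by move/(congr1 Re).
Qed.

Lemma integ_realGamma p : 0 < p -> integ (@posR R) (fun t => expR (- t) * pw (p - 1) t).
Proof. by move=> p0; apply: integ_gamma; lra. Qed.

Lemma realGamma_gt0 p : 1 <= p -> 0 < realGamma p.
Proof.
move=> p1; have p0 : 0 < p by lra.
have m12 : measurable (`[1, 2]%classic : set RR) by exact: measurable_itv.
have mP := @measurable_posR R.
have sub : (`[1, 2]%classic : set RR) `<=` @posR R.
  by move=> t; rewrite /= in_itv/= => /andP[t1 _]; apply: gt0_posR; lra.
have i12 := integrableS mP m12 sub (integ_realGamma p0).
have f0 t : 0 <= expR (- t) * pw (p - 1) t by rewrite mulr_ge0 ?expR_ge0 ?pw_ge0.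
rewrite (@lt_le_trans _ _ (\int[mu]_(t in `[1, 2]) expR (-2)))//.
  rewrite Rintegral_cst// mulr_gt0 ?expR_gt0//.
  by rewrite [X in fine X](@lebesgue_measure_itv R `[1, 2])/= lte_fin ltr1n/=; lra.
rewrite (@le_trans _ _ (\int[mu]_(t in `[1, 2]) (expR (- t) * pw (p - 1) t)))//.
  apply: le_Rintegral => //.
    by apply: cont_pos_integ => // t _; exact: cvg_cst.
  move=> t; rewrite /= in_itv/= => /andP[t1 t2].
  rewrite -[leLHS]mulr1 ler_pM ?expR_ge0 ?ler_expR ?lerN2//.
  by rewrite -[leLHS]expR0 ler_expR mulr_ge0 ?ln_ge0//; lra.
rewrite /realGamma /Rintegral fine_le//.
- exact: (integrable_fin_num m12 i12).
- exact: (integrable_fin_num mP (integ_realGamma p0)).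
- apply: ge0_subset_integral => //.
  + by apply/measurable_EFinP; apply: integ_measurable; exact: integ_realGamma.
  + by move=> t _; rewrite lee_fin.
Qed.

(** v^2 <= (2 sinh (v/2))^2. *)
Lemma sqr_le_expR (v : R) : v ^+ 2 <= expR v + expR (- v) - 2.
Proof.
wlog v0 : v / 0 <= v.
  move=> H; have [|/ltW v0] := leP 0 v; first exact: H.
  by have := H (- v); rewrite sqrrN opprK [expR v + _]addrC; apply; rewrite oppr_ge0.
have h : 2 * (v / 2) <= expR (v / 2) - expR (- (v / 2)).
  apply: (@le_of_derive_le R (fun s : R => 2 * s) (fun s : R => expR s - expR (- s)) (fun=> 2)
    (fun s : R => expR s + expR (- s)) (v / 2)) => //.
  - by lra.
  - by move=> x; apply: is_derive_eq; rewrite /GRing.scale/=; ring.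
  - move=> x; have dN := @is_derive1_comp R expR (fun t => - t) x _ _ (is_derive_expR (- x)) (is_deriveN (is_derive_id x 1)).
    by apply: is_derive_eq; rewrite mulrN1 opprK.
  - by move=> y _; have := expR_ge1Dx y; have := expR_ge1Dx (- y); lra.
  - by rewrite mulr0 oppr0 subrr.
have h2 : 0 <= 2 * (v / 2) by lra.
have := lerXn2r 2 h2 (le_trans h2 h) h.
rewrite (_ : 2 * (v / 2) = v); last by field.
rewrite sqrrB -!expRM_natl mulrN (_ : 2 * (v / 2) = v); last by field.
rewrite -expRD subrr expR0 => /le_trans; apply.
by rewrite -[1 *+ 2]mulr_natl; lra.
Qed.

Lemma Euler_integral_shift z (m : nat) : 0 < Re z -> E z = 0 -> E (z + m%:R) = 0.
Proof.
move=> z0 Ez; elim: m => [|m IH]; first by rewrite addr0.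
rewrite -natr1 addrA Euler_integralS ?IH ?mulr0//.
by rewrite cReD -[m%:R](rmorph_nat (real_complex R)) /= ltr_wpDr.
Qed.

(** If E z = 0 then E vanishes at w + 1 = z + m, with w = M + i y and M > y^2 for a
suitable m.  Put v = ln (t / M).  The real part of M^(-iy) t^(iy) is
cos (y v) >= 1 - (y v)^2, and v^2 <= t / M + M / t - 2.  Integrated against
exp (- t) t^M, the right hand side is a combination of values of the real Gamma
function at M, M + 1 and M + 2, which equals Gamma (M + 1) (1 - y^2 / M) > 0. *)
Lemma Euler_integral_neq0 z : 0 < Re z -> E z != 0.
Proof.
move=> z0; apply/negP => /eqP Ez.
set y := Im z.
(* m is chosen such that M > y^2. *)
pose m := (Num.truncn (y ^+ 2 + 1)).+1.
pose M := Re z + m%:R - 1.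
have mP := @measurable_posR R.
have hm : y ^+ 2 + 1 < m%:R.
  by have /andP[] := truncn_itv (addr_ge0 (sqr_ge0 y) ler01).
have My : y ^+ 2 < M by rewrite /M; lra.
have M0 : 0 < M by rewrite (le_lt_trans _ My)// sqr_ge0.
pose w : R[i] := z + m%:R - 1.
have wE : w = M +i* y.
  apply: complex_eq; rewrite /w ?cReD ?cImD ?cReN ?cImN -[m%:R](rmorph_nat (real_complex R)) /=.
    by rewrite /M.
  by rewrite oppr0 !addr0.
clearbody M.
have Ew : mellin (@posR R) (fun t => expR (- t)) w = 0.
  by rewrite -Euler_integralE Euler_integral_shift.
have iw : cintegrable (@posR R) (fun t => (expR (- t))%:C * rpowC t w).
  by apply: Euler_integrable; rewrite wE /=; lra.
(* This factor makes the phase of t^(iy) vanish at the mode t = M. *)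
pose c := rpowC M (- (0 +i* y)).
have := cintegralZ c mP iw; rewrite -/(mellin _ _ _) Ew mulr0 => /(congr1 Re).
move=> H0.
have H : \int[mu]_(t in @posR R) Re (c * ((expR (- t))%:C * rpowC t w)) = 0 by exact: H0.
have i1 : integ (@posR R) (fun t => expR (- t) * pw M t) by apply: integ_gamma; lra.
have i2 : integ (@posR R) (fun t => expR (- t) * pw (M + 1) t) by apply: integ_gamma; lra.
have i3 : integ (@posR R) (fun t => expR (- t) * pw (M - 1) t) by apply: integ_gamma; lra.
have e1 : \int[mu]_(t in @posR R) (expR (- t) * pw M t) = realGamma (M + 1) by rewrite /realGamma addrK.
have e2 : \int[mu]_(t in @posR R) (expR (- t) * pw (M + 1) t) = realGamma (M + 1 + 1) by rewrite /realGamma addrK.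
have e3 : \int[mu]_(t in @posR R) (expR (- t) * pw (M - 1) t) = realGamma M by [].
have ib := integB mP i1 (integZ (y ^+ 2) mP (integB mP (integD mP (integZ M^-1 mP i2) (integZ M mP i3)) (integZ 2 mP i1))).
have low : \int[mu]_(t in @posR R) (expR (- t) * pw M t - y ^+ 2 * (M^-1 * (expR (- t) * pw (M + 1) t)
     + M * (expR (- t) * pw (M - 1) t) - 2 * (expR (- t) * pw M t))) <= 0.
  rewrite -H; apply: le_Rintegral => //.
    by have [] := cintegrableZ c mP iw.
  move=> t /posR_gt0 t0.
  have -> : c * ((expR (- t))%:C * rpowC t w) = (expR (- t) * pw M t)%:C * rpowC (t / M) (0 +i* y).
    rewrite rpowCM ?invr_gt0// rpowCV// wE.
    have -> : M +i* y = M%:C + (0 +i* y) by apply: complex_eq; rewrite ?cReD ?cImD /= ?addr0 ?add0r.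
    by rewrite rpowCD rpowC_real rmorphM/= /c; ring.
  rewrite cReZ Re_rpowC /= /(pw 0) mul0r expR0 mul1r.
  set v := ln (t / M); set Q := expR (- t) * pw M t.
  have Q0 : 0 <= Q by rewrite mulr_ge0 ?expR_ge0 ?pw_ge0.
  have ev : expR v = t / M by rewrite lnK// posrE divr_gt0.
  have evN : expR (- v) = M / t by rewrite expRN ev invf_div.
  have -> : M^-1 * (expR (- t) * pw (M + 1) t) + M * (expR (- t) * pw (M - 1) t) - 2 * Q = Q * (expR v + expR (- v) - 2).
    rewrite /Q ev evN (pwD M 1) (pwD M (-1)) pwN pw1//; move: (expR (- t)) (pw M t) => e q.
    by field; rewrite !gt_eqF.
  rewrite mulrCA -[X in X - _]mulr1 -mulrBr ler_wpM2l//.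
  have h1 := sqr_le_expR v; have h2 := ler_wpM2l (sqr_ge0 y) h1.
  have := abs_cos1_le (y * v); rewrite exprMn distrC => h3.
  have := le_trans (ler_norm _) h3; lra.
have M1 : 0 < M + 1 by lra.
move: low; rewrite (RintegralB mP i1 (integZ _ mP (integB mP (integD mP (integZ M^-1 mP i2) (integZ M mP i3)) (integZ 2 mP i1)))).
rewrite (RintegralZl _ mP (integB mP (integD mP (integZ M^-1 mP i2) (integZ M mP i3)) (integZ 2 mP i1))).
rewrite (RintegralB mP (integD mP (integZ M^-1 mP i2) (integZ M mP i3)) (integZ 2 mP i1)).
rewrite (RintegralD mP (integZ M^-1 mP i2) (integZ M mP i3)).
rewrite (RintegralZl _ mP i1) (RintegralZl _ mP i2) (RintegralZl _ mP i3) e1 e2 e3.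
rewrite (realGammaS M1) -(realGammaS M0).
have G0 : 0 < realGamma (M + 1) by apply: realGamma_gt0; lra.
rewrite (_ : _ - _ = realGamma (M + 1) * ((M - y ^+ 2) / M)); last by field; rewrite gt_eqF.
by rewrite leNgt mulr_gt0// divr_gt0// subr_gt0.
Qed.
End GammaNonzero.

(** * The reciprocal of the Gamma function is entire *)

Section Entire.
Variable R : realType.
Local Notation Re := (@complex.Re R).
Local Notation Im := (@complex.Im R).
Local Notation C := (R[i])^o.
Implicit Types (f g : R[i] -> R[i]) (z s : R[i]).

(** Complex differentiability at a point, as it appears in the definition of
holomorphic functions. *)
Definition cdiff f z := derivable (f : C -> C) (z : C) (1 : C).

Lemma cdiff_of_is_derive f z l : is_derive (z : C) (1 : C) (f : C -> C) l -> cdiff f z.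
Proof. by case. Qed.

Lemma cdiff_cst (c : R[i]) z : cdiff (fun=> c) z.
Proof. exact: (derivable_cst (c : C) (z : C) (1 : C)). Qed.

Lemma cdiff_id z : cdiff id z.
Proof. exact: (@derivable_id _ C (z : C) (1 : C)). Qed.

Lemma cdiffD f g z : cdiff f z -> cdiff g z -> cdiff (fun s => f s + g s) z.
Proof. exact: (@derivableD _ C C). Qed.

Lemma cdiffM f g z : cdiff f z -> cdiff g z -> cdiff (fun s => f s * g s) z.
Proof. exact: (@derivableM (R[i]) C f g). Qed.

Lemma cdiffN f z : cdiff f z -> cdiff (fun s => - f s) z.
Proof. exact: (@derivableN _ C C). Qed.

Lemma cdiffB f g z : cdiff f z -> cdiff g z -> cdiff (fun s => f s - g s) z.
Proof. by move=> cf /cdiffN; exact: cdiffD. Qed.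

Lemma cdiffV f z : f z != 0 -> cdiff f z -> cdiff (fun s => (f s)^-1) z.
Proof. exact: (@derivableV (R[i]) C f). Qed.

Lemma cdiff_comp f g z : cdiff g z -> cdiff f (g z) -> cdiff (fun s => f (g s)) z.
Proof.
move=> /derivable1_diffP dg /derivable1_diffP df; apply/derivable1_diffP.
exact: (@differentiable_comp _ C C C).
Qed.

Lemma cdiff_prod n (f : 'I_n -> R[i] -> R[i]) z : (forall k, cdiff (f k) z) ->
  cdiff (fun s => \prod_(k < n) f k s) z.
Proof.
elim: n f => [|n IH] f df.
  by under eq_fun do rewrite big_ord0; exact: cdiff_cst.
by under eq_fun do rewrite big_ord_recr/=; apply: cdiffM => //; exact: IH.
Qed.

Lemma cdiff_near f g z : (\forall s \near (z : C), f s = g s) -> cdiff f z -> cdiff g z.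
Proof. by move=> fg; apply: (@near_eq_derivable _ C C). Qed.

Lemma cdiff_continuous f z : cdiff f z -> {for (z : C), continuous (f : C -> C)}.
Proof. by move=> /derivable1_diffP; exact: differentiable_continuous. Qed.

Lemma near_Re_gt (a : R) z : a < Re z -> \forall s \near (z : C), a < Re s.
Proof.
move=> az; have e0 : 0 < (Re z - a)%:C :> R[i] by rewrite ltcR subr_gt0.
apply: filterS (@nbhsx_ballx _ C z _ e0) => s; rewrite /ball/= => h.
have [+ _] := normc_lt_ReIm h; rewrite cReD cReN => /ltr_normlW; lra.
Qed.

Lemma cdiff_cexp z : cdiff (@cexp R) z.
Proof.
apply: (@cdiff_of_is_derive _ _ (cexp z)).
pose K : R := 16 * (`|Re (cexp z)| + `|Im (cexp z)|) * expR 2.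
have K0 : 0 <= K by rewrite !mulr_ge0 ?addr_ge0 ?expR_ge0.
apply: (@is_derive_of_quadratic_bound _ _ _ _ K%:C 1) => //; first by rewrite lecR.
move=> h; rewrite -[1]/(1%:C) => /normc_lt_ReIm[hr hi].
rewrite cexpD (_ : _ - _ = cexp z * (cexp h - 1 - h)); last by ring.
rewrite normrM; have [tr ti] := cexp_taylor1 h; set H := `|Re h| + `|Im h| in tr ti.
have H0 : 0 <= H by rewrite addr_ge0.
have H2 : expR H <= expR 2 by rewrite ler_expR /H; lra.
have hH : H ^+ 2 <= 2 * (Re h ^+ 2 + Im h ^+ 2).
  by rewrite -(real_normK (num_real (Re h))) -(real_normK (num_real (Im h))); exact: sqr_add_le.
have b : `|cexp h - 1 - h| <= (16 * expR 2 * (Re h ^+ 2 + Im h ^+ 2))%:C.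
  rewrite (le_trans (normc_le _))// lecR (le_trans (lerD tr ti))//.
  rewrite -mulr2n -mulr_natl.
  have h1 := ler_pM (sqr_ge0 H) (expR_ge0 _) hH H2.
  by rewrite -mulrA; move: h1; rewrite -mulrA => h1; lra.
rewrite (le_trans (ler_pM (normr_ge0 _) (normr_ge0 _) (normc_le _) b))//.
by rewrite -add_Re2_Im2 -!rmorphM lecR /K le_eqVlt; apply/orP; left; apply/eqP; ring.
Qed.

Lemma cdiff_rpowC (t : R) z : cdiff (rpowC t) z.
Proof.
apply: (@cdiff_comp (@cexp R) (fun s => s * (ln t)%:C)); last exact: cdiff_cexp.
by apply: cdiffM; [exact: cdiff_id|exact: cdiff_cst].
Qed.

Lemma cdiff_Euler_integral z : 0 < Re z -> cdiff (@Euler_integral R) z.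
Proof.
move=> z0; rewrite (_ : @Euler_integral R = fun s => mellin (@posR R) (fun t => expR (- t)) (s - 1)); last first.
  by apply/funext => s; rewrite Euler_integralE.
apply: (@cdiff_comp (mellin (@posR R) (fun t => expR (- t))) (fun s => s - 1)).
  by apply: cdiffB; [exact: cdiff_id|exact: cdiff_cst].
have e0 : 0 < Re z / 2 by rewrite divr_gt0.
have eR : Re (z - 1) = Re z - 1 by rewrite cReD cReN.
apply: cdiff_of_is_derive.
apply: (@is_derive_mellin R (@posR R) (@measurable_posR R) (@posR_gt0 R) _ _ (Re z / 2)) => //.
- exact: measurable_expRN.
- by apply: integ_gamma_abs; rewrite eR; lra.
- by apply: integ_gamma_abs; rewrite eR; lra.
Qed.

Lemma Re_natD z n : Re (z + n%:R) = Re z + n%:R.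
Proof. by rewrite cReD -[n%:R in LHS](rmorph_nat (real_complex R)). Qed.

(** The definition of Gamma uses the least admissible shift; any larger one gives the
same value, by the functional equation of Euler's integral.  A fixed shift is
needed for differentiability, since the least one jumps. *)
Lemma Gamma_inv z N : 0 < Re z + N%:R ->
  (Gamma z)^-1 = (\prod_(k < N) (z + k%:R)) / Euler_integral (z + N%:R).
Proof.
rewrite /Gamma; set n := Num.truncn _ => zN.
have zn : 0 < Re z + n%:R.
  have [h|h] := leP 0 (1 - Re z).
    by have /andP[_] := truncn_itv h; rewrite -/n -natr1; lra.
  by rewrite ltr_wpDr//; lra.
have nN : (n <= N)%N.
  have [h|h] := leP 0 (1 - Re z).
    by rewrite -ltnS truncn_lt_nat// -natr1; lra.
  by rewrite /n (_ : Num.truncn _ = 0%N)//; apply/truncn0Pn; rewrite -ltNge; lra.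
rewrite invf_div; elim: N nN zN => [|N IH]; first by rewrite leqn0 => /eqP ->.
rewrite leq_eqVlt => /predU1P[<-//|]; rewrite ltnS => nN zN.
have zN' : 0 < Re z + N%:R.
  by rewrite (lt_le_trans zn)// lerD2l ler_nat.
rewrite IH// big_ord_recr/= -natr1 addrA Euler_integralS ?Re_natD//.
have e1 : z + N%:R != 0.
  by apply/negP => /eqP/(congr1 Re); rewrite Re_natD /= => e; rewrite e ltxx in zN'.
have e2 : Euler_integral (z + N%:R) != 0 by apply: Euler_integral_neq0; rewrite Re_natD.
by field; rewrite e1 e2.
Qed.

Lemma cdiff_Gamma_inv z : cdiff (fun s => (Gamma s)^-1) z.
Proof.
pose N := (Num.truncn `|Re z|).+1.
have zN : 0 < Re z + N%:R.
  have /andP[_] := truncn_itv (normr_ge0 (Re z)); rewrite -/N => h.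
  by have := ler_norm (- Re z); rewrite normrN; lra.
have near : \forall s \near (z : C),
    (\prod_(k < N) (s + k%:R)) / Euler_integral (s + N%:R) = (Gamma s)^-1.
  apply: filterS (@near_Re_gt (- N%:R) z _) => [s hs|]; last by lra.
  by rewrite (@Gamma_inv _ N)//; lra.
apply: (cdiff_near near); apply: cdiffM.
  by apply: cdiff_prod => k; apply: cdiffD; [exact: cdiff_id|exact: cdiff_cst].
apply: cdiffV; first by apply: Euler_integral_neq0; rewrite Re_natD.
apply: (@cdiff_comp (@Euler_integral R) (fun s => s + N%:R)).
  by apply: cdiffD; [exact: cdiff_id|exact: cdiff_cst].
by apply: cdiff_Euler_integral; rewrite Re_natD.
Qed.

(** The functional equation, valid everywhere for the reciprocal since the junk
values of Gamma at its poles are 0. *)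
Lemma Gamma_inv_S z : (Gamma z)^-1 = z / Gamma (z + 1).
Proof.
pose N := (Num.truncn `|Re z|).+1.
have zN : 0 < Re z + N%:R.
  have /andP[_] := truncn_itv (normr_ge0 (Re z)); rewrite -/N => h.
  by have := ler_norm (- Re z); rewrite normrN; lra.
have zN1 : 0 < Re z + N.+1%:R by rewrite -natr1; lra.
rewrite (Gamma_inv zN1) (@Gamma_inv (z + 1) N); last by rewrite cReD /=; lra.
rewrite big_ord_recl/= addr0 -!mulrA; congr (_ * (_ / Euler_integral _)).
  by apply: eq_bigr => k _; rewrite /bump/= add1n -natr1; ring.
by rewrite -natr1; ring.
Qed.

(** With a fixed shift, 1/Gamma is a product of the factors z + k and of the inverse
of a non-zero Euler integral. *)
Lemma Gamma_neq0 z : ~ Gamma_pole z -> Gamma z != 0.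
Proof.
move=> zp; rewrite -invr_eq0.
pose N := (Num.truncn `|Re z|).+1.
have zN : 0 < Re z + N%:R.
  have /andP[_] := truncn_itv (normr_ge0 (Re z)); rewrite -/N => h.
  by have := ler_norm (- Re z); rewrite normrN; lra.
rewrite (Gamma_inv zN) mulf_neq0//; last first.
  by rewrite invr_eq0 Euler_integral_neq0// Re_natD.
apply/prodf_neq0 => k _; apply/negP => /eqP h; apply: zp; exists k.
by apply/eqP; rewrite -addr_eq0 h.
Qed.
End Entire.

(** * Mellin transforms of series and changes of variable *)

Section MellinTools.
Variable R : realType.
Local Notation mu := (@lebesgue_measure R).
Local Notation RR := (measurableTypeR R).
Local Notation Re := (@complex.Re R).
Local Notation Im := (@complex.Im R).
Implicit Types (D : set RR) (phi psi : RR -> R) (s z w : R[i]) (t p c : R).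

Definition ge1R : set RR := `[1, +oo[%classic.

Lemma measurable_ge1R : measurable ge1R. Proof. exact: measurable_itv. Qed.

Lemma ge1R_ge1 t : ge1R t -> 1 <= t. Proof. by rewrite /ge1R /= in_itv/= andbT. Qed.

Lemma ge1R_gt0 t : ge1R t -> 0 < t. Proof. by move/ge1R_ge1; exact: lt_le_trans. Qed.

(** Term by term Mellin transforms.  Terms outside P are replaced by 0 so that the
summation exchange, stated for full sums, applies to the real and to the
imaginary part. *)
Lemma mellin_csum (I : countType) (P : pred I) D (f u : I -> RR -> R) (F U : RR -> R) s :
  measurable D -> (forall t, D t -> 0 < t) ->
  (forall i t, D t -> `|f i t| <= u i t) ->
  (forall t, D t -> has_rsum (fun i => if P i then u i t else 0) (U t)) ->
  (forall t, D t -> has_rsum (fun i => if P i then f i t else 0) (F t)) ->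
  (forall i, measurable_fun D (u i)) -> (forall i, measurable_fun D (f i)) ->
  integ D (fun t => U t * pw (Re s) t) ->
  [/\ forall i, P i -> cintegrable D (fun t => (f i t)%:C * rpowC t s),
      cintegrable D (fun t => (F t)%:C * rpowC t s) &
      has_csum P (fun i => mellin D (f i) s) (mellin D F s)].
Proof.
move=> mD D0 fu uU fF mu_ mf iU.
(* The domination includes the modulus of t^s. *)
pose v i t := (if P i then u i t else 0) * pw (Re s) t.
have cp : cont_pos (@pw R (Re s)) by exact: cont_pw.
have mpw := cont_pos_measurable mD D0 cp.
have mv i : measurable_fun D (v i).
  rewrite /v; case: (P i); first by apply: measurable_funM => //; exact: mu_.
  by apply: measurable_funM => //; exact: measurable_cst.
have vU t : D t -> has_rsum (v^~ t) (U t * pw (Re s) t).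
  move=> Dt; rewrite mulrC.
  by apply: (eq_has_rsum _ (has_rsumZ (pw (Re s) t) (uU t Dt))) => i; exact: mulrC.
have u0 i t : D t -> 0 <= u i t by move=> Dt; apply: le_trans (fu i t Dt).
pose fr i t := if P i then Re ((f i t)%:C * rpowC t s) else 0.
pose fi i t := if P i then Im ((f i t)%:C * rpowC t s) else 0.
have [] := @has_rsum_Rintegral R I D v fr (fun t => U t * pw (Re s) t)
   (fun t => Re ((F t)%:C * rpowC t s)) mD.
- move=> i t Dt; rewrite /fr /v; case: (P i); last by rewrite normr0 mul0r.
  by rewrite (le_trans (Re_mellin_le _ _ _))// ler_wpM2r ?pw_ge0// fu.
- exact: vU.
- move=> t Dt; rewrite (cReZ (F t)) mulrC.
  apply: (eq_has_rsum _ (has_rsumZ (Re (rpowC t s)) (fF t Dt))) => i.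
  by rewrite /fr; case: (P i); [rewrite (cReZ (f i t)) mulrC|rewrite mulr0].
- exact: mv.
- move=> i; rewrite /fr; case: (P i); last exact: measurable_cst.
  exact: (measurable_mellin_Re mD D0 s (mf i)).
- exact: iU.
move=> ir iFr hr.
have [] := @has_rsum_Rintegral R I D v fi (fun t => U t * pw (Re s) t)
   (fun t => Im ((F t)%:C * rpowC t s)) mD.
- move=> i t Dt; rewrite /fi /v; case: (P i); last by rewrite normr0 mul0r.
  by rewrite (le_trans (Im_mellin_le _ _ _))// ler_wpM2r ?pw_ge0// fu.
- exact: vU.
- move=> t Dt; rewrite (cImZ (F t)) mulrC.
  apply: (eq_has_rsum _ (has_rsumZ (Im (rpowC t s)) (fF t Dt))) => i.
  by rewrite /fi; case: (P i); [rewrite (cImZ (f i t)) mulrC|rewrite mulr0].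
- exact: mv.
- move=> i; rewrite /fi; case: (P i); last exact: measurable_cst.
  exact: (measurable_mellin_Im mD D0 s (mf i)).
- exact: iU.
move=> ii iFi hi.
split => [i Pi||].
- split; first by have := ir i; rewrite /fr Pi.
  by have := ii i; rewrite /fi Pi.
- by split.
apply: has_csum_of_real.
  apply: eq_has_rsum hr => i; rewrite /fr /mellin /cintegral/=.
  by case: (P i) => //; rewrite /Rintegral integral0.
apply: eq_has_rsum hi => i; rewrite /fi /mellin /cintegral/=.
by case: (P i) => //; rewrite /Rintegral integral0.
Qed.

Lemma has_csumZ (I : choiceType) (P : pred I) (f : I -> R[i]) z (b : R[i]) :
  has_csum P f z -> has_csum P (fun i => b * f i) (b * z).
Proof.
rewrite /has_csum => h.
under eq_fun do rewrite -mulr_sumr.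
exact: (@cvgMr (R[i]) _ _ (@summability.totally_filter I) _ b _ h).
Qed.

Lemma cont_pos_Re_rpowC z : cont_pos (fun t => Re (rpowC t z)).
Proof. by move=> t t0; have [d _] := is_derive_Re_rpowC z t0; exact: is_derive_cont d. Qed.

Lemma cont_pos_Im_rpowC z : cont_pos (fun t => Im (rpowC t z)).
Proof. by move=> t t0; have [_ d] := is_derive_Re_rpowC z t0; exact: is_derive_cont d. Qed.

Lemma cont_pos_mellin_Re phi z : cont_pos phi ->
  cont_pos (fun t => Re ((phi t)%:C * rpowC t z)).
Proof.
move=> cphi; rewrite (_ : (fun t => _) = fun t => phi t * Re (rpowC t z)).
  exact: (cont_posM cphi (@cont_pos_Re_rpowC z)).
by apply/funext => t; rewrite (cReZ (phi t)).
Qed.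

Lemma cont_pos_mellin_Im phi z : cont_pos phi ->
  cont_pos (fun t => Im ((phi t)%:C * rpowC t z)).
Proof.
move=> cphi; rewrite (_ : (fun t => _) = fun t => phi t * Im (rpowC t z)).
  exact: (cont_posM cphi (@cont_pos_Im_rpowC z)).
by apply/funext => t; rewrite (cImZ (phi t)).
Qed.

Lemma mellin_inv phi z : cont_pos phi ->
  cintegrable `]0, 1] (fun t => (phi t)%:C * rpowC t z) ->
  cintegrable ge1R (fun t => (phi t^-1)%:C * rpowC t (- z - 2)) ->
  mellin `]0, 1] phi z = mellin ge1R (fun t => phi t^-1) (- z - 2).
Proof.
move=> cphi [i1 i2] [j1 j2].
have E t : ge1R t -> (t ^- 2)%:C * ((phi t^-1)%:C * rpowC t^-1 z) =
    (phi t^-1)%:C * rpowC t (- z - 2).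
  move=> /ge1R_gt0 t0; rewrite rpowCV// rpowCD mulrCA; congr (_ * _); rewrite mulrC; congr (_ * _).
  have -> : (- 2 : R[i]) = (- 2%:R)%:C by rewrite rmorphN rmorph_nat.
  by rewrite rpowC_real pwN pwX.
have m1 := measurable_ge1R.
apply: complex_eq; rewrite /mellin /cintegral/=.
  rewrite (Rintegral_inv_01 (f := fun t => Re ((phi t)%:C * rpowC t z)))//.
  - by apply: eq_Rintegral => t /set_mem Dt; rewrite -(cReZ (t ^- 2)) E.
  - exact: cont_pos_mellin_Re.
  - by apply: (integ_eq m1 _ j1) => t Dt; rewrite -(cReZ (t ^- 2)) E.
rewrite (Rintegral_inv_01 (f := fun t => Im ((phi t)%:C * rpowC t z)))//.
- by apply: eq_Rintegral => t /set_mem Dt; rewrite -(cImZ (t ^- 2)) E.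
- exact: cont_pos_mellin_Im.
- by apply: (integ_eq m1 _ j2) => t Dt; rewrite -(cImZ (t ^- 2)) E.
Qed.

Lemma integ_gamma_scale c p : 0 < c -> -1 < p ->
  integ (@posR R) (fun t => `|expR (- c * t)| * pw p t).
Proof.
move=> c0 p1; rewrite posR_split; apply: integ_setU => //.
  have m01 : forall t : R, `]0, 1]%classic t -> 0 < t.
    by move=> t; rewrite /= in_itv/= => /andP[].
  apply: (integ_dom (g := pw p)) => // [|t t1|]; last exact: integ_pw_01.
    apply: cont_pos_measurable => //; apply: cont_posM; last exact: cont_pw.
    by move=> t t0; apply: cvg_norm; exact: cont_expRM.
  rewrite !normrM !normr_id !ger0_norm ?expR_ge0 ?pw_ge0// ler_piMl ?pw_ge0//.
  by rewrite expR_le1 mulNr oppr_le0 mulr_ge0 ?(ltW c0)// ltW// m01.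
have := @integ_pw_exp_1y R p c c0; apply: integ_eq => // t _.
by rewrite mulrC ger0_norm ?expR_ge0.
Qed.

Lemma cexpR_integrable c z : 0 < c -> -1 < Re z ->
  cintegrable (@posR R) (fun t => (expR (- c * t))%:C * rpowC t z).
Proof.
move=> c0 z1; apply: (mellin_integrable (@measurable_posR R) (@posR_gt0 R)).
  exact: (cont_pos_measurable (@measurable_posR R) (@posR_gt0 R) (@cont_expRM R c)).
exact: integ_gamma_scale.
Qed.

Lemma mellin_expR_scale c z : 0 < c -> 0 < Re z ->
  mellin (@posR R) (fun t => expR (- c * t)) (z - 1) = rpowC c (- z) * Euler_integral z.
Proof.
move=> c0 z0; have z1 : -1 < Re (z - 1) by rewrite cReD cReN/=; lra.
have mP := @measurable_posR R.
have iE := Euler_integrable z1.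
have ic := cexpR_integrable c0 z1.
have E t : posR t -> c%:C * ((expR (- (c * t)))%:C * rpowC (c * t) (z - 1)) =
    rpowC c z * ((expR (- c * t))%:C * rpowC t (z - 1)).
  move=> /posR_gt0 t0; rewrite rpowCM// mulNr.
  rewrite -{3}(subrK 1 z) [rpowC c (_ + 1)]rpowCD rpowC1//.
  by move: (rpowC c _) (rpowC t _) (expR _)%:C => x y e; ring.
have [k1 k2] := cintegrableZ (rpowC c z) mP ic.
suff -> : Euler_integral z = rpowC c z * mellin (@posR R) (fun t => expR (- c * t)) (z - 1).
  by rewrite mulrA -rpowCD addNr rpowC0 mul1r.
rewrite /mellin -(cintegralZ _ mP ic) Euler_integralE.
case: iE => e1 e2.
apply: complex_eq; rewrite /mellin /cintegral/=.
  rewrite (Rintegral_scale_0y c0 (f := fun t => Re ((expR (- t))%:C * rpowC t (z - 1))))//.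
  - by apply: eq_Rintegral => t /set_mem Dt; rewrite -(cReZ c) E.
  - exact/cont_pos_mellin_Re/cont_expRN.
  - by apply: (integ_eq mP _ k1) => t Dt; rewrite -(cReZ c) E.
rewrite (Rintegral_scale_0y c0 (f := fun t => Im ((expR (- t))%:C * rpowC t (z - 1))))//.
- by apply: eq_Rintegral => t /set_mem Dt; rewrite -(cImZ c) E.
- exact/cont_pos_mellin_Im/cont_expRN.
- by apply: (integ_eq mP _ k2) => t Dt; rewrite -(cImZ c) E.
Qed.

Lemma rpowC_integrable_1y w : Re w < 0 -> cintegrable ge1R (fun t => 1%:C * rpowC t (w - 1)).
Proof.
move=> w0; apply: (mellin_integrable measurable_ge1R ge1R_gt0 (phi := fun=> 1)).
  exact: measurable_cst.
have w1 : Re (w - 1) < -1 by rewrite cReD cReN/=; lra.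
by apply: (integ_eq measurable_ge1R _ (integ_pw_1y w1)) => t _; rewrite normr1 mul1r.
Qed.

(** t^w / w is a primitive of t^(w-1), and vanishes at infinity as Re w < 0. *)
Lemma mellin_1y w : Re w < 0 -> mellin ge1R (fun=> 1) (w - 1) = - w^-1.
Proof.
move=> w0; have mP := measurable_ge1R.
have wn0 : w != 0 by apply/eqP => e; rewrite e /= ltxx in w0.
have iw := rpowC_integrable_1y w0.
suff h : w * mellin ge1R (fun=> 1) (w - 1) = - 1.
  by rewrite -[LHS](mulKf wn0) h mulrN1.
rewrite /mellin -(cintegralZ _ mP iw).
rewrite (@eq_cintegral R ge1R _ (fun t => w * rpowC t (w - 1))); last first.
  by move=> t _; rewrite mul1r.
have [i1 i2] : cintegrable ge1R (fun t => w * rpowC t (w - 1)).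
  by apply: eq_cintegrable mP _ (cintegrableZ w mP iw) => t _; rewrite mul1r.
have lim (f : R -> R) : (forall t, `|f t| <= pw (Re w) t) ->
    f n.+2%:R @[n --> \oo] --> (0 : R).
  move=> hf; have w0' : 0 < - Re w by rewrite oppr_gt0.
  have := @cvg_pw_neg R _ w0'; rewrite opprK => hu.
  apply/cvgrPdist_le => e e0; move/cvgrPdist_le : hu => /(_ e e0).
  apply: filterS => n; rewrite !sub0r !normrN => h; apply: le_trans h.
  by rewrite (le_trans (hf _))// ler_norm.
have cover t : ge1R t -> \forall n \near \oo, 1 <= t <= n.+2%:R.
  by move=> /ge1R_ge1 t1; apply: filterS (near_large t) => n ->; rewrite t1.
have cF (f : R -> R) : f 1 @[n --> \oo] --> (f 1 : R) by exact: cvg_cst.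
have cR : cont_pos (fun t => Re (w * rpowC t (w - 1))).
  rewrite (_ : (fun t => _) = fun t => Re w * Re (rpowC t (w - 1)) - Im w * Im (rpowC t (w - 1))).
    move=> t t0; apply: cvgB; apply: cvgM; try exact: cvg_cst.
      exact: cont_pos_Re_rpowC.
    exact: cont_pos_Im_rpowC.
  by apply/funext => t; rewrite cReM.
have cI : cont_pos (fun t => Im (w * rpowC t (w - 1))).
  rewrite (_ : (fun t => _) = fun t => Re w * Im (rpowC t (w - 1)) + Im w * Re (rpowC t (w - 1))).
    move=> t t0; apply: cvgD; apply: cvgM; try exact: cvg_cst.
      exact: cont_pos_Im_rpowC.
    exact: cont_pos_Re_rpowC.
  by apply/funext => t; rewrite cImM.
have e1 : rpowC 1 w = 1 :> R[i] by rewrite /rpowC ln1 mulr0 cexp0.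
have dR t : 0 < t -> is_derive t 1 (fun t => Re (rpowC t w)) (Re (w * rpowC t (w - 1))).
  by move=> t0; have [] := is_derive_Re_rpowC w t0.
have dI t : 0 < t -> is_derive t 1 (fun t => Im (rpowC t w)) (Im (w * rpowC t (w - 1))).
  by move=> t0; have [] := is_derive_Re_rpowC w t0.
have lR : Re (rpowC n.+2%:R w) @[n --> \oo] --> (0 : R).
  apply: (lim (fun t => Re (rpowC t w))) => t.
  by rewrite Re_rpowC normrM (ger0_norm (pw_ge0 _ _)) ler_piMr ?pw_ge0// ler_norml cos_geN1 cos_le1.
have lI : Im (rpowC n.+2%:R w) @[n --> \oo] --> (0 : R).
  apply: (lim (fun t => Im (rpowC t w))) => t.
  by rewrite Im_rpowC normrM (ger0_norm (pw_ge0 _ _)) ler_piMr ?pw_ge0// ler_norml sin_geN1 sin_le1.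
have HR := @FTC_improper R ge1R (fun=> 1) (fun n => n.+2%:R) _ _ _ _ mP
  (fun=> ltr01) (@ltr1n2 R) (@subset_1n R) cover dR cR i1 (cF (fun t => Re (rpowC t w))) lR.
have HI := @FTC_improper R ge1R (fun=> 1) (fun n => n.+2%:R) _ _ _ _ mP
  (fun=> ltr01) (@ltr1n2 R) (@subset_1n R) cover dI cI i2 (cF (fun t => Im (rpowC t w))) lI.
apply: complex_eq; rewrite /cintegral [LHS]/=.
  by rewrite HR e1 sub0r.
by rewrite HI e1 sub0r.
Qed.

Lemma GammaE z : 0 < Re z -> Gamma z = Euler_integral z.
Proof.
move=> z0; apply: invr_inj; rewrite (@Gamma_inv _ z 0) ?addr0// big_ord0 mul1r ?addr0.
by [].
Qed.
End MellinTools.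

(** * Theta series without the constant term *)

Section LatticeMellin.
Variables (R : realType) (d : nat).
Local Notation RR := (measurableTypeR R).
Local Notation Re := (@complex.Re R).
Local Notation Im := (@complex.Im R).
Local Notation ge1R := (@ge1R R).
Local Notation posR := (@posR R).
Implicit Types (alpha : 'rV[nat]_d) (n : 'rV[int]_d) (s : R[i]) (t p c : R).

Lemma has_rsum_punct (f : 'rV[int]_d -> R) (S : R) : has_rsum f S ->
  has_rsum (fun n => if n != 0 then f n else 0) (S - f 0).
Proof.
move=> fS.
have h0 : has_rsum (fun n => if n == 0 then f n else 0) (f 0).
  have := @has_rsum_fin _ _ (fun n => if n == 0 then f n else 0) [fset 0 : 'rV[int]_d]%fset.
  rewrite big_seq_fset1 eqxx; apply => n.
  by rewrite in_fset1 => /negbTE ->.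
apply: (eq_has_rsum _ (has_rsumB fS h0)) => n.
by case: eqP => _ /=; rewrite ?subrr ?subr0.
Qed.

(** The spectral gap of the lattice, from which the exponential decay of omega
follows. *)
Lemma enorm_vecR_ge1 n : n != 0 -> 1 <= enorm (vecR R n) ^+ 2.
Proof.
move=> n0; have /existsP[j nj] : [exists j, n 0 j != 0].
  apply: contraNT n0 => /existsPn h; apply/eqP/rowP => j.
  by rewrite mxE; apply/eqP; have := h j; rewrite negbK.
rewrite enorm_sqr (bigD1 j)//= ler_wpDr//; first by apply: sumr_ge0 => i _; exact: sqr_ge0.
rewrite mxE -rmorphXn/= ler1z.
by rewrite -gtz0_ge1 exprn_even_gt0.
Qed.

Lemma mulr2n_mxE alpha j : (alpha *+ 2) 0 j = (2 * alpha 0%R j)%N.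
Proof. by rewrite mulmxnE mulnC -mulr_natr natn. Qed.

Lemma monomial0 alpha : monomial (alpha *+ 2) (0 : 'rV[R]_d) = (alpha == 0)%:R.
Proof.
rewrite /monomial; have [->|a0] := eqVneq alpha 0.
  by rewrite big1// => j _; rewrite mulmxnE !mxE mul0rn expr0.
have /existsP[j nj] : [exists j, alpha 0 j != 0%N].
  apply: contraNT a0 => /existsPn h; apply/eqP/rowP => j.
  by rewrite mxE; apply/eqP; have := h j; rewrite negbK.
by rewrite (bigD1 j)//= mulr2n_mxE mxE expr0n muln_eq0/= (negbTE nj) mul0r.
Qed.

Lemma vecR0 : vecR R (0 : 'rV[int]_d) = 0.
Proof. by apply/rowP => j; rewrite !mxE. Qed.

Lemma enorm0 : enorm (0 : 'rV[R]_d) = 0.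
Proof. by rewrite /enorm big1 ?sqrtr0// => j _; rewrite mxE expr0n. Qed.

Lemma ltheta_term0 alpha t : ltheta_term alpha t 0 = (alpha == 0)%:R.
Proof. by rewrite /ltheta_term vecR0 monomial0 enorm0 expr0n oppr0 !mul0r expR0 mulr1. Qed.

Lemma ltheta_dual_term0 alpha t : ltheta_dual_term alpha t 0 = Hermite (alpha *+ 2) (0 : 'rV[R]_d).
Proof. by rewrite /ltheta_dual_term vecR0 scaler0 enorm0 expr0n oppr0 !mul0r expR0 mul1r. Qed.

Definition omega alpha t : R := ltheta alpha t - (alpha == 0)%:R.
Definition omega_dual alpha t : R := ltheta_dual alpha t - Hermite (alpha *+ 2) (0 : 'rV[R]_d).

Lemma has_omega alpha t : 0 < t ->
  has_rsum (fun n => if n != 0 then ltheta_term alpha t n else 0) (omega alpha t).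
Proof. by move=> t0; have := has_rsum_punct (has_ltheta alpha t0); rewrite ltheta_term0. Qed.

Lemma has_omega_dual alpha t : 0 < t ->
  has_rsum (fun n => if n != 0 then ltheta_dual_term alpha t n else 0) (omega_dual alpha t).
Proof. by move=> t0; have := has_rsum_punct (has_ltheta_dual alpha t0); rewrite ltheta_dual_term0. Qed.

Lemma omega_ge0 alpha t : 0 < t -> 0 <= omega alpha t.
Proof.
move=> t0; apply: has_rsum_ge0 (has_omega alpha t0) => n.
by case: (n != 0) => //; exact: ltheta_term_ge0.
Qed.

(** Each term satisfies the bound, because pi |n|^2 (t - c) >= pi (t - c). *)
Lemma omega_decay alpha c t : 0 < c -> c <= t ->
  omega alpha t <= expR (- pi * (t - c)) * omega alpha c.
Proof.
move=> c0 ct; have t0 := lt_le_trans c0 ct; have pi0 := @pi_gt0 R.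
apply: has_rsum_le (has_omega alpha t0) (has_rsumZ _ (has_omega alpha c0)) => n /=.
case: ifPn => n0; last by rewrite mulr0.
rewrite /ltheta_term mulrCA ler_wpM2l//.
  apply: prodr_ge0 => j _; rewrite mulr2n_mxE exprM.
  by rewrite exprn_ge0// sqr_ge0.
rewrite -expRD ler_expR.
have h : 0 <= pi * ((enorm (vecR R n) ^+ 2 - 1) * (t - c)).
  by rewrite mulr_ge0 ?(ltW pi0)// mulr_ge0// subr_ge0// enorm_vecR_ge1.
by move: (pi : R) (enorm _ ^+ 2) h => P e; lra.
Qed.

Lemma cont_pos_ltheta alpha : cont_pos (ltheta alpha : R -> R).
Proof.
move=> t t0; rewrite /ltheta; apply: cvg_big => [|j _]; first exact: mul_continuous.
exact: (is_derive_cont (is_derive_theta _ t0)).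
Qed.

Lemma cont_pos_omega alpha : cont_pos (omega alpha : R -> R).
Proof. by move=> t t0; apply: cvgB; [exact: cont_pos_ltheta|exact: cvg_cst]. Qed.

Definition theta_coef alpha : R := (- (4 * pi)^-1) ^+ norm1 alpha.
Definition theta_weight alpha : R := d%:R / 2 + (norm1 alpha)%:R.

Lemma theta_coef_neq0 alpha : theta_coef alpha != 0.
Proof.
by rewrite expf_neq0// oppr_eq0 invr_eq0 mulf_neq0// gt_eqF// pi_gt0.
Qed.

Lemma pw_theta_weight alpha t : 0 < t -> Num.sqrt t ^+ d * t ^+ norm1 alpha = pw (theta_weight alpha) t.
Proof.
move=> t0; rewrite /theta_weight pwD pwX// -pw_half//; congr (_ * _).
by rewrite /pw -expRM_natl; congr expR; ring.
Qed.

Lemma ltheta_inv alpha t : 0 < t ->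
  ltheta alpha t^-1 = theta_coef alpha * pw (theta_weight alpha) t * ltheta_dual alpha t.
Proof. by move=> t0; rewrite ltheta_inversion// -pw_theta_weight// mulrA. Qed.

Lemma omega_inv alpha t : 0 < t ->
  omega alpha t^-1 = theta_coef alpha * pw (theta_weight alpha) t *
    (omega_dual alpha t + Hermite (alpha *+ 2) (0 : 'rV[R]_d)) - (alpha == 0)%:R.
Proof. by move=> t0; rewrite /omega ltheta_inv// /omega_dual subrK. Qed.

(** Continuity of the dual series is inherited from the direct one through the
inversion formula. *)
Lemma measurable_omega_dual alpha : measurable_fun ge1R (omega_dual alpha).
Proof.
have h : cont_pos (fun t => (theta_coef alpha)^-1 * (pw (- theta_weight alpha) t * ltheta alpha t^-1)
    - Hermite (alpha *+ 2) (0 : 'rV[R]_d)).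
  move=> t t0; apply: cvgB; last exact: cvg_cst.
  apply: cvgM; first exact: cvg_cst.
  apply: cvgM; first exact: cont_pw.
  apply: (@continuous_comp _ _ _ (fun t : R => t^-1) (ltheta alpha)).
    by apply: inv_continuous; rewrite gt_eqF.
  by apply: cont_pos_ltheta; rewrite invr_gt0.
apply: eq_measurable_fun (cont_pos_measurable (@measurable_ge1R R) (@ge1R_gt0 R) h).
move=> t /set_mem/ge1R_gt0 t0.
rewrite ltheta_inv// /omega_dual pwN; congr (_ - _).
have c0 := theta_coef_neq0 alpha; have p0 : pw (theta_weight alpha) t != 0 by rewrite gt_eqF// pw_gt0.
by move: (theta_coef _) (pw _ _) (ltheta_dual _ _) c0 p0 => x y z x0 y0; field; rewrite x0 y0.
Qed.

Lemma measurable_omega (D : set RR) alpha c : 0 < c -> measurable D -> (forall t, D t -> 0 < t) ->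
  measurable_fun D (fun t => omega alpha (c * t)).
Proof.
move=> c0 mD D0; apply: cont_pos_measurable => // t t0.
apply: (@continuous_comp _ _ _ (fun t : R => c * t) (omega alpha)).
  by apply: cvgM; [exact: cvg_cst|exact: cvg_id].
by apply: cont_pos_omega; rewrite mulr_gt0.
Qed.

Lemma integ_omega_1y alpha c p : 0 < c ->
  integ ge1R (fun t => omega alpha (c * t) * pw p t).
Proof.
move=> c0; have pc : 0 < pi * c by rewrite mulr_gt0// pi_gt0.
apply: (integ_dom (@measurable_ge1R R) _ _
  (integZ (omega alpha c * expR (pi * c)) (@measurable_ge1R R) (integ_pw_exp_1y p pc))).
  apply: measurable_funM.
    exact: (measurable_omega _ c0 (@measurable_ge1R R) (@ge1R_gt0 R)).
  exact: (cont_pos_measurable (@measurable_ge1R R) (@ge1R_gt0 R) (@cont_pw R p)).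
move=> t t1; have t0 := ge1R_gt0 t1; have ct : c <= c * t.
  by rewrite ler_peMr ?(ltW c0)// ge1R_ge1.
rewrite ger0_norm ?mulr_ge0 ?pw_ge0 ?omega_ge0// ?mulr_gt0//.
rewrite (le_trans (ler_wpM2r (pw_ge0 _ _) (omega_decay alpha c0 ct)))//.
rewrite (_ : - pi * (c * t - c) = pi * c + - (pi * c) * t); last by ring.
by rewrite expRD le_eqVlt; apply/orP; left; apply/eqP; ring.
Qed.

(** All terms are non-negative, so the series is its own domination. *)
Lemma omega_csum_1y alpha s :
  [/\ forall n, n != 0 -> cintegrable ge1R (fun t => (ltheta_term alpha t n)%:C * rpowC t s),
      cintegrable ge1R (fun t => (omega alpha t)%:C * rpowC t s) &
      has_csum (fun n : 'rV[int]_d => n != 0)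
        (fun n => mellin ge1R (fun t => ltheta_term alpha t n) s) (mellin ge1R (omega alpha) s)].
Proof.
have mt n : measurable_fun ge1R (fun t => ltheta_term alpha t n).
  apply: measurable_funM; first exact: measurable_cst.
  rewrite /=; apply: (cont_pos_measurable (@measurable_ge1R R) (@ge1R_gt0 R)).
  by under eq_fun do rewrite !mulNr -mulNr; exact: cont_expRM.
apply: (@mellin_csum R 'rV[int]_d _ ge1R (fun n t => ltheta_term alpha t n)
  (fun n t => ltheta_term alpha t n) (omega alpha) (omega alpha) s
  (@measurable_ge1R R) (@ge1R_gt0 R)) => //.
- by move=> n t _; rewrite ger0_norm// ltheta_term_ge0.
- by move=> t /ge1R_gt0; exact: has_omega.
- by move=> t /ge1R_gt0; exact: has_omega.
- apply: (integ_eq (@measurable_ge1R R) _ (integ_omega_1y alpha (Re s) ltr01)) => t _.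
  by rewrite mul1r.
Qed.
End LatticeMellin.

(** * Convergence of the Mellin transforms *)

Section LatticeZeta.
Variables (R : realType) (d : nat) (alpha : 'rV[nat]_d).
Local Notation RR := (measurableTypeR R).
Local Notation Re := (@complex.Re R).
Local Notation Im := (@complex.Im R).
Local Notation ge1R := (@ge1R R).
Local Notation posR := (@posR R).
Local Notation h0 := (Hermite (alpha *+ 2) (0 : 'rV[R]_d)).
Local Notation zero := (0 : 'rV[nat]_d).
Implicit Types (n : 'rV[int]_d) (s z : R[i]) (t p c : R).

Lemma ltheta_term_zero t n : ltheta_term zero t n = expR (- enorm (vecR R n) ^+ 2 * pi * t).
Proof.
rewrite /ltheta_term /monomial big1 ?mul1r// => j _.
by rewrite mul0rn [X in _ ^+ X]mxE expr0.
Qed.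

(** The dual terms change sign; they are dominated by those of the unweighted theta
series at t / 2. *)
Lemma omega_dual_bound : exists2 C : R, 0 <= C &
  (forall t n, 0 < t -> `|ltheta_dual_term alpha t n| <= C * ltheta_term zero (2^-1 * t) n) /\
  (forall t, 0 < t -> `|omega_dual alpha t| <= C * omega zero (2^-1 * t)).
Proof.
have [C C0 hC] := @ltheta_dual_bound R d alpha; exists C => //.
have h t n : 0 < t -> `|ltheta_dual_term alpha t n| <= C * ltheta_term zero (2^-1 * t) n.
  by move=> t0; rewrite ltheta_term_zero [2^-1 * t]mulrC; exact: hC.
split=> // t t0; have t20 : 0 < 2^-1 * t by rewrite mulr_gt0.
apply: has_rsum_norm_le (has_rsumZ C (has_omega zero t20)) _ (has_omega_dual alpha t0) => n /=.
by case: (n != 0); rewrite ?normr0 ?mulr0//; exact: h.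
Qed.

Lemma measurable_ltheta_term beta c n : 0 < c ->
  measurable_fun ge1R (fun t => ltheta_term beta (c * t) n).
Proof.
move=> c0; apply: measurable_funM; first exact: measurable_cst.
apply: (cont_pos_measurable (@measurable_ge1R R) (@ge1R_gt0 R)).
by under eq_fun do rewrite mulrA !mulNr -mulNr; exact: cont_expRM.
Qed.

Lemma measurable_ltheta_dual_term n : measurable_fun ge1R (fun t => ltheta_dual_term alpha t n).
Proof.
have h : cont_pos (fun t => \prod_(j < d) polyterm (hermite_sqr R (alpha 0 j)) t (n 0 j)).
  move=> t t0; apply: cvg_big => [|j _]; first exact: mul_continuous.
  apply: cvgM.
    apply: (@continuous_comp _ _ _ (fun t : R => pi * (n 0 j)%:~R ^+ 2 * t)
      (horner (hermite_sqr R (alpha 0 j)))); last exact: continuous_horner.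
    by apply: cvgM; [exact: cvg_cst|exact: cvg_id].
  have E : (fun t : R => expR (- (pi * (n 0 j)%:~R ^+ 2 * t))) =
      fun t => expR (- (pi * (n 0 j)%:~R ^+ 2) * t) by apply/funext => u; rewrite mulNr.
  have : {for t, continuous (fun t : R => expR (- (pi * (n 0 j)%:~R ^+ 2 * t)))}.
    by rewrite E; exact: cont_expRM.
  exact.
apply: eq_measurable_fun (cont_pos_measurable (@measurable_ge1R R) (@ge1R_gt0 R) h).
by move=> t /set_mem/ge1R_gt0 t0; rewrite ltheta_dual_termE.
Qed.

Lemma omega_dual_csum_1y s :
  [/\ forall n, n != 0 -> cintegrable ge1R (fun t => (ltheta_dual_term alpha t n)%:C * rpowC t s),
      cintegrable ge1R (fun t => (omega_dual alpha t)%:C * rpowC t s) &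
      has_csum (fun n : 'rV[int]_d => n != 0)
        (fun n => mellin ge1R (fun t => ltheta_dual_term alpha t n) s) (mellin ge1R (omega_dual alpha) s)].
Proof.
have [C C0 [hC _]] := omega_dual_bound; have i20 : 0 < 2^-1 :> R by rewrite invr_gt0.
apply: (@mellin_csum R 'rV[int]_d _ ge1R (fun n t => ltheta_dual_term alpha t n)
  (fun n t => C * ltheta_term zero (2^-1 * t) n) (omega_dual alpha)
  (fun t => C * omega zero (2^-1 * t)) s (@measurable_ge1R R) (@ge1R_gt0 R)) => //.
- by move=> n t /ge1R_gt0 t0; exact: hC.
- move=> t /ge1R_gt0 t0; have t20 : 0 < 2^-1 * t by rewrite mulr_gt0.
  apply: (eq_has_rsum _ (has_rsumZ C (has_omega zero t20))) => n.
  by case: (n != 0) => //; rewrite mulr0.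
- by move=> t /ge1R_gt0; exact: has_omega_dual.
- by move=> n; apply: measurable_funM; [exact: measurable_cst|exact: measurable_ltheta_term].
- exact: measurable_ltheta_dual_term.
- apply: (integ_eq (@measurable_ge1R R) _
    (integZ C (@measurable_ge1R R) (integ_omega_1y zero (Re s) i20))) => t _.
  by rewrite mulrA.
Qed.

Lemma integ_omega_dual_1y p : integ ge1R (fun t => `|omega_dual alpha t| * pw p t).
Proof.
have [C C0 [_ hC]] := omega_dual_bound; have i20 : 0 < 2^-1 :> R by rewrite invr_gt0.
apply: (integ_dom (@measurable_ge1R R) _ _
  (integZ C (@measurable_ge1R R) (integ_omega_1y zero p i20))).
  apply: measurable_funM; first by apply: measurableT_comp => //; exact: measurable_omega_dual.
  exact: (cont_pos_measurable (@measurable_ge1R R) (@ge1R_gt0 R) (@cont_pw R p)).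
move=> t /ge1R_gt0 t0; rewrite normrM normr_id (ger0_norm (pw_ge0 p t)) mulrA.
by rewrite ler_wpM2r ?pw_ge0// hC.
Qed.

Lemma integ_abs_omega_1y p : integ ge1R (fun t => `|omega alpha t| * pw p t).
Proof.
apply: (integ_eq (@measurable_ge1R R) _ (integ_omega_1y alpha p ltr01)) => t /ge1R_gt0 t0.
by rewrite mul1r ger0_norm// omega_ge0.
Qed.

(** Near 0 the inversion formula bounds omega by a multiple of
t^-(d/2 + |alpha|), which is where the half-plane of convergence comes from. *)
Lemma integ_omega_01 p : theta_weight R alpha - 1 < p -> integ `]0, 1] (fun t => omega alpha t * pw p t).
Proof.
move=> hp; have [C C0 [_ hC]] := omega_dual_bound.
have m01 : forall t : R, `]0, 1]%classic t -> 0 < t by move=> t; rewrite /= in_itv/= => /andP[].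
have i20 : 0 < 2^-1 :> R by rewrite invr_gt0.
pose M := C * omega zero 2^-1 + `|h0|.
have mI : measurable (`]0, 1]%classic : set RR) by exact: measurable_itv.
have hp' : -1 < p - theta_weight R alpha by lra.
apply: (integ_dom mI _ _ (integZ (`|theta_coef R alpha| * M) mI (integ_pw_01 hp'))).
  apply: cont_pos_measurable => //.
  by apply: cont_posM; [exact: cont_pos_omega|exact: cont_pw].
move=> t t1; have t0 := m01 t t1.
have t'0 : 0 < t^-1 by rewrite invr_gt0.
have t'1 : 1 <= t^-1.
  by move: t1; rewrite /= in_itv/= => /andP[_ t1]; rewrite invf_ge1.
rewrite ger0_norm ?mulr_ge0 ?pw_ge0 ?omega_ge0//.
suff key : omega alpha t <= `|theta_coef R alpha| * M * pw (- theta_weight R alpha) t.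
  by rewrite pwD [pw p t * _]mulrC [leRHS]mulrA ler_wpM2r ?pw_ge0.
rewrite -(invrK t).
rewrite (@le_trans _ _ (ltheta alpha t^-1^-1))//.
  by rewrite /omega gerBl.
have -> : pw (- theta_weight R alpha) t^-1^-1 = pw (theta_weight R alpha) t^-1.
  by rewrite pwV// opprK.
rewrite ltheta_inv// -!mulrA.
rewrite (le_trans (ler_norm _))// normrM ler_wpM2l// normrM.
rewrite (ger0_norm (pw_ge0 _ _)) [leRHS]mulrC ler_wpM2l ?pw_ge0//.
have -> : ltheta_dual alpha t^-1 = omega_dual alpha t^-1 + h0 by rewrite /omega_dual subrK.
rewrite (le_trans (ler_normD _ _))// lerD2r (le_trans (hC _ t'0))// ler_wpM2l//.
have hc : 2^-1 <= 2^-1 * t^-1 by rewrite ler_peMr ?(ltW i20).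
rewrite (le_trans (omega_decay zero i20 hc))// ler_piMl ?omega_ge0//.
by rewrite expR_le1 mulNr oppr_le0 mulr_ge0 ?pi_ge0// subr_ge0.
Qed.
End LatticeZeta.

(** * The zeta function as a Mellin transform *)

Section ZetaIntegral.
Variables (R : realType) (d : nat) (alpha : 'rV[nat]_d).
Local Notation RR := (measurableTypeR R).
Local Notation Re := (@complex.Re R).
Local Notation Im := (@complex.Im R).
Local Notation ge1R := (@ge1R R).
Local Notation posR := (@posR R).
Local Notation h0 := (Hermite (alpha *+ 2) (0 : 'rV[R]_d)).
Local Notation a := (norm1 alpha).
Local Notation nonzero := (fun n : 'rV[int]_d => n != 0).
Implicit Types (n : 'rV[int]_d) (s z w : R[i]) (t p c : R).

Lemma eq_has_csum (I : choiceType) (P : pred I) (f g : I -> R[i]) z :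
  (forall i, P i -> f i = g i) -> has_csum P f z -> has_csum P g z.
Proof.
move=> fg; rewrite /has_csum (_ : (fun A : {fset I} => \sum_(i <- A | P i) f i) =
  fun A => \sum_(i <- A | P i) g i)//.
by apply/funext => A; apply: eq_bigr => i; exact: fg.
Qed.

Lemma integ_omega_posR p : theta_weight R alpha - 1 < p ->
  integ posR (fun t => omega alpha t * pw p t).
Proof.
move=> hp; rewrite posR_split; apply: integ_setU => //; first exact: integ_omega_01.
apply: (integ_eq (@measurable_ge1R R) _ (integ_omega_1y alpha p ltr01)) => t _.
by rewrite mul1r.
Qed.

Lemma ltheta_term_expR t n : ltheta_term alpha t n =
  monomial (alpha *+ 2) (vecR R n) * expR (- (enorm (vecR R n) ^+ 2 * pi) * t).
Proof. by rewrite /ltheta_term !mulNr. Qed.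

Lemma enorm_vecR_gt0 n : n != 0 -> 0 < enorm (vecR R n).
Proof.
move=> n0; have h := lt_le_trans ltr01 (@enorm_vecR_ge1 R d n n0).
by rewrite lt_neqAle sqrtr_ge0 andbT eq_sym -sqrf_eq0 gt_eqF.
Qed.

Lemma omega_csum_posR z : theta_weight R alpha - 1 < Re z ->
  cintegrable posR (fun t => (omega alpha t)%:C * rpowC t z) /\
      has_csum nonzero
        (fun n => mellin posR (fun t => ltheta_term alpha t n) z) (mellin posR (omega alpha) z).
Proof.
move=> hz.
have mt n : measurable_fun posR (fun t => ltheta_term alpha t n).
  under eq_fun do rewrite ltheta_term_expR.
  apply: measurable_funM; first exact: measurable_cst.
  exact: (cont_pos_measurable (@measurable_posR R) (@posR_gt0 R) (@cont_expRM R _)).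
have [] := @mellin_csum R 'rV[int]_d nonzero posR (fun n t => ltheta_term alpha t n)
  (fun n t => ltheta_term alpha t n) (omega alpha) (omega alpha) z
  (@measurable_posR R) (@posR_gt0 R) => //.
- by move=> n t _; rewrite ger0_norm// ltheta_term_ge0.
- by move=> t /posR_gt0; exact: has_omega.
- by move=> t /posR_gt0; exact: has_omega.
- exact: integ_omega_posR.
Qed.

(** The substitution t -> pi |n|^2 t turns each term into Euler's integral. *)
Lemma mellin_ltheta_term n z : n != 0 -> 0 < Re z ->
  mellin posR (fun t => ltheta_term alpha t n) (z - 1) =
  zeta_term (alpha *+ 2) (z * 2) n * (rpowC pi (- z) * Euler_integral z).
Proof.
move=> n0 z0; have e0 := enorm_vecR_gt0 n0.
have c0 : 0 < enorm (vecR R n) ^+ 2 * pi by rewrite mulr_gt0 ?pi_gt0// exprn_gt0.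
have z1 : -1 < Re (z - 1) by rewrite cReD cReN/=; lra.
transitivity ((monomial (alpha *+ 2) (vecR R n))%:C *
    mellin posR (fun t => expR (- (enorm (vecR R n) ^+ 2 * pi) * t)) (z - 1)).
  rewrite /mellin -(cintegralZ _ (@measurable_posR R) (cexpR_integrable c0 z1)).
  apply: eq_cintegral => t _; rewrite ltheta_term_expR.
  by rewrite [X in X * _](rmorphM (real_complex R)) -mulrA.
rewrite mellin_expR_scale// /zeta_term rpowCM ?pi_gt0 ?exprn_gt0// expr2 rpowCM// -rpowCD.
rewrite -rpowCN (_ : - (z * 2) = - z + - z); last by ring.
by rewrite !mulrA.
Qed.

Lemma zeta_csum s : (d + 2 * a)%:R < Re s ->
  has_csum nonzero (zeta_term (alpha *+ 2) s)
    (rpowC pi (s / 2) / Gamma (s / 2) * mellin posR (omega alpha) (s / 2 - 1)).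
Proof.
move=> hs; have e2 : s / 2 = (2^-1)%:C * s.
  by rewrite mulrC (rmorphV (real_complex R)) ?unitfE// rmorph_nat.
have r2 : Re (s / 2) = 2^-1 * Re s by rewrite e2 cReZ.
have s0 : 0 < Re s by apply: le_lt_trans hs.
have s2 : 0 < Re (s / 2) by rewrite r2 mulr_gt0.
have hz : theta_weight R alpha - 1 < Re (s / 2 - 1).
  rewrite cReD cReN r2 /theta_weight /= ltrD2r; move: hs; rewrite natrD natrM; lra.
have [_ hc] := omega_csum_posR hz.
have E0 := Euler_integral_neq0 s2.
apply: (eq_has_csum _ (@has_csumZ _ _ _ _ _ (rpowC pi (s / 2) / Gamma (s / 2)) hc)) => n n0.
rewrite mellin_ltheta_term// divfK// GammaE// rpowCN.
have p0 := rpowC_neq0 (pi : R) (s / 2).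
by move: (rpowC _ _) (Euler_integral _) (zeta_term _ _ _) p0 E0 => x y z x0 y0; field; rewrite x0 y0.
Qed.

(** The two pieces overlap in the single point 1, of measure 0; ]0, 1] is the image
of [1, +oo[ under t -> 1/t. *)
Lemma mellin_split (phi : RR -> R) z : cintegrable posR (fun t => (phi t)%:C * rpowC t z) ->
  mellin posR phi z = mellin `]0, 1] phi z + mellin ge1R phi z.
Proof.
have E : posR = `]0, 1[%classic `|` ge1R.
  apply/seteqP; split => t; rewrite /posR /ge1R /= !in_itv/= !andbT.
    by move=> t0; case: (ltP t 1) => h; [left; rewrite t0|right].
  by case=> [/andP[]|/(lt_le_trans _)]//; apply.
have dj : [disjoint (`]0, 1[%classic : set RR) & ge1R].
  apply/disj_set2P/seteqP; split => t //=.
  by rewrite /ge1R /= !in_itv/= andbT => -[/andP[_ t1] /(lt_le_trans t1)]; rewrite ltxx.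
rewrite {1 2}E => -[i1 i2].
have m0 : measurable (`]0, 1[%classic : set RR) by exact: measurable_itv.
have m1 := @measurable_ge1R R.
have s01 : `]0, 1[%classic `<=` `]0, 1[%classic `|` ge1R by exact: subsetUl.
have j1 := integrableS (measurableU _ _ m0 m1) m0 s01 i1.
have j2 := integrableS (measurableU _ _ m0 m1) m0 s01 i2.
rewrite /mellin cintegral_setU//; congr (_ + _).
apply: complex_eq; rewrite /cintegral/=.
  exact: Rintegral_itv_bndo_bndc.
exact: Rintegral_itv_bndo_bndc.
Qed.

(** On ]0, 1] the substitution t -> 1/t and the inversion formula replace omega by
omega_dual and two pure powers, the contributions of the terms at 0 of both
series; these powers integrate to the polar terms. *)
Lemma mellin_omega_split s : (d + 2 * a)%:R < Re s ->
  mellin posR (omega alpha) (s / 2 - 1) =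
  (theta_coef R alpha)%:C * ((2 * h0)%:C / (s - d%:R - 2 * a%:R))
  - 2 * (alpha == 0)%:R / s
  + mellin ge1R (omega alpha) (s / 2 - 1)
  + (theta_coef R alpha)%:C * mellin ge1R (omega_dual alpha) ((d%:R + 2 * a%:R - s) / 2 - 1).
Proof.
move=> hs; have e2 z : z / 2 = (2^-1)%:C * z.
  by rewrite mulrC (rmorphV (real_complex R)) ?unitfE// rmorph_nat.
have r2 z : Re (z / 2) = 2^-1 * Re z by rewrite e2 cReZ.
have s0 : 0 < Re s by apply: le_lt_trans hs.
have hz : theta_weight R alpha - 1 < Re (s / 2 - 1).
  rewrite cReD cReN r2 /theta_weight /= ltrD2r; move: hs; rewrite natrD natrM; lra.
have [ci _] := omega_csum_posR hz.
have m1 := @measurable_ge1R R.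
have m01 : measurable (`]0, 1]%classic : set RR) by exact: measurable_itv.
set w := (d%:R + 2 * a%:R - s) / 2.
have we : w = (theta_weight R alpha)%:C - s / 2.
  rewrite /w /theta_weight rmorphD rmorphM rmorph_nat (rmorphV (real_complex R)) ?unitfE// !rmorph_nat.
  by field.
have w0 : Re w < 0.
  rewrite we cReD cReN r2 /theta_weight /=; move: hs; rewrite natrD natrM; lra.
have v0 : Re (- (s / 2)) < 0 by rewrite cReN r2 oppr_lt0 mulr_gt0.
(* On [1, +oo[ the transformed integrand is the dual one plus two pure powers of t. *)
have D t : ge1R t -> (omega alpha t^-1)%:C * rpowC t (- (s / 2 - 1) - 2) =
   (theta_coef R alpha)%:C * ((omega_dual alpha t)%:C * rpowC t (w - 1)) +
   ((theta_coef R alpha)%:C * h0%:C * (1%:C * rpowC t (w - 1)) -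
    (alpha == 0)%:R * (1%:C * rpowC t (- (s / 2) - 1))).
  move=> /ge1R_gt0 t0; rewrite omega_inv//.
  rewrite (_ : w - 1 = (theta_weight R alpha)%:C + (- (s / 2) - 1)); last by rewrite we; ring.
  rewrite (_ : - (s / 2 - 1) - 2 = - (s / 2) - 1); last by ring.
  rewrite rpowCD rpowC_real.
  move: (rpowC _ _) (theta_coef _ _) (pw _ _) (omega_dual _ _) h0 => x y p u v.
  have -> : (y * p * (u + v) - (alpha == 0)%:R)%:C = y%:C * p%:C * (u%:C + v%:C) - (alpha == 0)%:R :> R[i].
    by rewrite rmorphB !rmorphM rmorphD rmorph_nat.
  by move: y%:C p%:C u%:C v%:C (alpha == 0)%:R => *; ring.
have [_ ie _] := @omega_dual_csum_1y R d alpha (w - 1).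
have iw := rpowC_integrable_1y w0; have iv := rpowC_integrable_1y v0.
have i1 := cintegrableZ (theta_coef R alpha)%:C m1 ie.
have i2 := cintegrableZ ((theta_coef R alpha)%:C * h0%:C) m1 iw.
have i3 := cintegrableZ ((alpha == 0)%:R : R[i]) m1 iv.
have i23 := cintegrableB m1 i2 i3.
have i123 := cintegrableD m1 i1 i23.
have iinv : cintegrable ge1R (fun t => (omega alpha t^-1)%:C * rpowC t (- (s / 2 - 1) - 2)).
  by apply: eq_cintegrable m1 _ i123 => t Dt; rewrite D.
have i01 : cintegrable `]0, 1] (fun t => (omega alpha t)%:C * rpowC t (s / 2 - 1)).
  apply: mellin_integrable => //.
  - by move=> t; rewrite /= in_itv/= => /andP[].
  - apply: (cont_pos_measurable m01 _ (@cont_pos_omega R d alpha)).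
    by move=> t; rewrite /= in_itv/= => /andP[].
  - apply: (integ_eq m01 _ (integ_omega_01 hz)) => t; rewrite /= in_itv/= => /andP[t0 _].
    by rewrite ger0_norm// omega_ge0.
rewrite (mellin_split ci) mellin_inv//; last exact: cont_pos_omega.
rewrite [X in X + _](@eq_cintegral R ge1R _ _ D) (cintegralD m1 i1 i23) (cintegralB m1 i2 i3).
have M1 : cintegral ge1R (fun t => 1%:C * rpowC t (w - 1)) = - w^-1 := mellin_1y w0.
have M2 : cintegral ge1R (fun t => 1%:C * rpowC t (- (s / 2) - 1)) = - (- (s / 2))^-1 := mellin_1y v0.
rewrite (cintegralZ _ m1 ie) (cintegralZ _ m1 iw) (cintegralZ _ m1 iv) M1 M2.
have E2 (x : R) : (2 * x)%:C = 2 * x%:C :> R[i] by rewrite rmorphM rmorph_nat.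
rewrite E2.
have s00 : s != 0 by apply/eqP => e; rewrite e /= ltxx in s0.
have w00 : s - d%:R - 2 * a%:R != 0.
  apply/eqP => e; move: w0; rewrite (_ : w = - (s - d%:R - 2 * a%:R) / 2); last by rewrite /w; ring.
  by rewrite e oppr0 mul0r ltxx.
rewrite /mellin /w.
move: (theta_coef R alpha)%:C h0%:C (alpha == 0)%:R (cintegral _ _) (cintegral _ _) => x y z u v.
have w01 : d%:R + 2 * a%:R - s != 0 by rewrite (_ : _ - s = - (s - d%:R - 2 * a%:R)) ?oppr_eq0//; ring.
by field; rewrite s00 w00 w01.
Qed.
End ZetaIntegral.

(** * The meromorphic continuation *)

Section Continuation.
Variables (R : realType) (d : nat) (alpha : 'rV[nat]_d).
Local Notation C := (R[i])^o.
Local Notation Re := (@complex.Re R).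
Local Notation ge1R := (@ge1R R).
Local Notation h0 := (Hermite (alpha *+ 2) (0 : 'rV[R]_d)).
Local Notation a := (norm1 alpha).
Local Notation nonzero := (fun n : 'rV[int]_d => n != 0).
Local Notation coef := (theta_coef R alpha)%:C.
Local Notation s0 := ((d + 2 * a)%:R : R[i]).
Implicit Types (n : 'rV[int]_d) (s z w : R[i]).

Definition omega_mellin s := mellin ge1R (omega alpha) (s / 2 - 1).
Definition omega_dual_mellin s := mellin ge1R (omega_dual alpha) ((d%:R + 2 * a%:R - s) / 2 - 1).

(** The right hand side of the functional equation times pi^(s/2) / Gamma (s/2), with
the polar term 2/s absorbed into 1 / Gamma (s/2 + 1). *)
Definition zeta_cont s := rpowC pi (s / 2) *
  ((Gamma (s / 2))^-1 * (coef * ((2 * h0)%:C / (s - d%:R - 2 * a%:R)) + omega_mellin s + coef * omega_dual_mellin s)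
   - (alpha == 0)%:R * (Gamma (s / 2 + 1))^-1).

(** The continuation multiplied by s - d - 2 |alpha|, which is entire. *)
Definition zeta_reg s := rpowC pi (s / 2) *
  ((Gamma (s / 2))^-1 * (coef * (2 * h0)%:C + (s - d%:R - 2 * a%:R) * (omega_mellin s + coef * omega_dual_mellin s))
   - (s - d%:R - 2 * a%:R) * ((alpha == 0)%:R * (Gamma (s / 2 + 1))^-1)).

Lemma subr_pole s : s - d%:R - 2 * a%:R = s - s0.
Proof. by rewrite natrD natrM; ring. Qed.

Lemma subr_pole_neq0 s : s != s0 -> s - d%:R - 2 * a%:R != 0.
Proof. by rewrite subr_pole subr_eq0. Qed.

Lemma zeta_contE s : s != s0 -> zeta_cont s = zeta_reg s / (s - s0).
Proof.
move=> ss; have := subr_pole_neq0 ss; rewrite /zeta_cont /zeta_reg !subr_pole.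
move: (s - s0) (rpowC _ _) (Gamma _)^-1 (Gamma _)^-1 (omega_mellin s) (omega_dual_mellin s) (2 * h0)%:C coef.
by move=> x y g g' u v e c x0; field.
Qed.

Lemma cdiff_half z : cdiff (fun s => s / 2) z.
Proof. by apply: cdiffM; [exact: cdiff_id|exact: cdiff_cst]. Qed.

Lemma cdiff_omega_mellin z : cdiff omega_mellin z.
Proof.
apply: (@cdiff_comp _ (mellin ge1R (omega alpha)) (fun s => s / 2 - 1)).
  by apply: cdiffB; [exact: cdiff_half|exact: cdiff_cst].
apply: cdiff_of_is_derive.
apply: (@is_derive_mellin R ge1R (@measurable_ge1R R) (@ge1R_gt0 R) _ _ 1) => //.
- exact: (cont_pos_measurable (@measurable_ge1R R) (@ge1R_gt0 R) (@cont_pos_omega R d alpha)).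
- exact: integ_abs_omega_1y.
- exact: integ_abs_omega_1y.
Qed.

Lemma cdiff_omega_dual_mellin z : cdiff omega_dual_mellin z.
Proof.
apply: (@cdiff_comp _ (mellin ge1R (omega_dual alpha)) (fun s => (d%:R + 2 * a%:R - s) / 2 - 1)).
  apply: cdiffB; last exact: cdiff_cst.
  apply: cdiffM; last exact: cdiff_cst.
  by apply: cdiffB; [exact: cdiff_cst|exact: cdiff_id].
apply: cdiff_of_is_derive.
apply: (@is_derive_mellin R ge1R (@measurable_ge1R R) (@ge1R_gt0 R) _ _ 1) => //.
- exact: measurable_omega_dual.
- exact: integ_omega_dual_1y.
- exact: integ_omega_dual_1y.
Qed.

Lemma cdiff_pi_half z : cdiff (fun s => rpowC pi (s / 2)) z.
Proof. by apply: (@cdiff_comp _ (rpowC pi)); [exact: cdiff_half|exact: cdiff_rpowC]. Qed.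

Lemma cdiff_Gamma_half z : cdiff (fun s => (Gamma (s / 2))^-1) z.
Proof.
by apply: (@cdiff_comp _ (fun s => (Gamma s)^-1)); [exact: cdiff_half|exact: cdiff_Gamma_inv].
Qed.

Lemma cdiff_Gamma_half1 z : cdiff (fun s => (Gamma (s / 2 + 1))^-1) z.
Proof.
apply: (@cdiff_comp _ (fun s => (Gamma s)^-1) (fun s => s / 2 + 1)); last exact: cdiff_Gamma_inv.
by apply: cdiffD; [exact: cdiff_half|exact: cdiff_cst].
Qed.

Lemma cdiff_sub z : cdiff (fun s => s - d%:R - 2 * a%:R) z.
Proof. by do 2 (apply: cdiffB; last exact: cdiff_cst); exact: cdiff_id. Qed.

Lemma cdiff_zeta_cont z : z != s0 -> cdiff zeta_cont z.
Proof.
move=> zs; apply: cdiffM; first exact: cdiff_pi_half.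
apply: cdiffB; last by apply: cdiffM; [exact: cdiff_cst|exact: cdiff_Gamma_half1].
apply: cdiffM; first exact: cdiff_Gamma_half.
apply: cdiffD; last by apply: cdiffM; [exact: cdiff_cst|exact: cdiff_omega_dual_mellin].
apply: cdiffD; last exact: cdiff_omega_mellin.
apply: cdiffM; first exact: cdiff_cst.
apply: cdiffM; first exact: cdiff_cst.
by apply: cdiffV; [exact: subr_pole_neq0|exact: cdiff_sub].
Qed.

Lemma cdiff_zeta_reg z : cdiff zeta_reg z.
Proof.
apply: cdiffM; first exact: cdiff_pi_half.
apply: cdiffB; last first.
  apply: cdiffM; first exact: cdiff_sub.
  by apply: cdiffM; [exact: cdiff_cst|exact: cdiff_Gamma_half1].
apply: cdiffM; first exact: cdiff_Gamma_half.
apply: cdiffD; first exact: cdiff_cst.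
apply: cdiffM; first exact: cdiff_sub.
apply: cdiffD; first exact: cdiff_omega_mellin.
by apply: cdiffM; [exact: cdiff_cst|exact: cdiff_omega_dual_mellin].
Qed.

(** At the pole only the term with H_(2 alpha) (0) survives; Gamma is non-zero there
because s0 > 0. *)
Lemma zeta_reg_neq0 : (0 < d)%N -> zeta_reg s0 != 0.
Proof.
move=> d0; rewrite /zeta_reg subr_pole subrr !mul0r addr0 subr0.
rewrite mulf_neq0 ?rpowC_neq0// mulf_neq0//.
  rewrite invr_eq0 Gamma_neq0// => -[m h].
  have : Re s0 = - (m%:R * 2).
    rewrite -[s0](@divfK _ 2)// h -mulNr.
    rewrite (_ : - m%:R * 2 = (- m%:R * 2)%:C)//.
    by rewrite rmorphM rmorphN !rmorph_nat.
  rewrite -[s0](rmorph_nat (real_complex R)) /= => e.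
  have : 0 < (d + 2 * a)%:R :> R by rewrite ltr0n addn_gt0 d0.
  by rewrite e oppr_gt0 -natrM ltrn0.
rewrite mulf_neq0//.
  by rewrite -(rmorph0 (real_complex R)) (inj_eq (@complexI R)) theta_coef_neq0.
rewrite -(rmorph0 (real_complex R)) (inj_eq (@complexI R)) mulf_neq0//.
exact: Hermite_even0_neq0.
Qed.

Lemma holomorphic_zeta_cont z : z != s0 -> holomorphic_at zeta_cont z.
Proof.
move=> zs; have e0 : 0 < `|z - s0| by rewrite normr_gt0 subr_eq0.
apply: filterS (@nbhsx_ballx _ C z _ e0) => w; rewrite /ball/= => h.
apply: cdiff_zeta_cont; apply: contraTneq h => ->.
by rewrite ltxx.
Qed.

Lemma near_dnbhs_neq z : \forall w \near (z : C)^', w != z.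
Proof. exact: (@nbhs_dnbhs_neq C z). Qed.

Lemma pole_zeta_cont : (0 < d)%N -> pole_of_order zeta_cont s0 1.
Proof.
move=> d0; split=> //; exists zeta_reg; split.
- by apply: filterE => w; exact: cdiff_zeta_reg.
- exact: zeta_reg_neq0.
- near=> w; rewrite expr1 zeta_contE//.
  by near: w; exact: near_dnbhs_neq.
Unshelve. all: by end_near. Qed.

(** If f w = g w / (w - z)^m near z, then f w (w - z)^m - g w is continuous at z and
vanishes on a punctured neighbourhood of z, while its value at z is - g z, not 0. *)
Lemma not_pole (f : R[i] -> R[i]) z : cdiff f z -> ~ is_pole f z.
Proof.
move=> df [m [m0 [g [hg g0 fg]]]].
have dh : cdiff (fun w => f w * (w - z) ^+ m - g w) z.
  apply: cdiffB; last exact: (nbhs_singleton hg).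
  apply: cdiffM; first exact: df.
  rewrite (_ : (fun w => _) = fun w => \prod_(k < m) (w - z)).
    by apply: cdiff_prod => k; apply: cdiffB; [exact: cdiff_id|exact: cdiff_cst].
  by apply/funext => w; rewrite prodr_const card_ord.
have /continuous_withinNx := cdiff_continuous dh.
rewrite /= subrr expr0n eqn0Ngt m0 mulr0 sub0r => c.
have c0 : (fun w : C => f w * (w - z) ^+ m - g w) @ (z : C)^' --> (0 : C).
  have FF : Filter ((z : C)^') by exact: dnbhs_filter.
  apply: (@cvg_near_cst _ C (0 : C) _ _ FF); near=> w.
  have wz : w - z != 0 by rewrite subr_eq0; near: w; exact: near_dnbhs_neq.
  have -> : f w = g w / (w - z) ^+ m by near: w.
  by rewrite divfK ?subrr// expf_neq0.
have := cvg_unique (@norm_hausdorff _ C) c c0.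
by move=> e; move: g0; rewrite -oppr_eq0 e eqxx.
Unshelve. all: by end_near. Qed.
End Continuation.

(** * The functional equation *)

Unset Implicit Arguments.

Theorem theorem2p11 (R : realType) (d : nat) (hd : (0 < d)%N)
    (alpha : 'rV[nat]_d) :
  let a := norm1 alpha in
  let s0 : R[i] := (d + 2 * a)%:R in
  let nonzero := fun n : 'rV[int]_d => n != 0 in
  let coef : R[i] := ((- (4 * pi)^-1) ^+ a)%:C in
  let F := fun (s : R[i]) (n : 'rV[int]_d) (t : R) =>
    (expR (- enorm (vecR R n) ^+ 2 * pi * t))%:C * rpowC t (s / 2 - 1) in
  let G := fun (s : R[i]) (k : 'rV[int]_d) (t : R) =>
    (expR (- enorm (vecR R k) ^+ 2 * pi * t))%:C
    * (Hermite (alpha *+ 2) (Num.sqrt (pi * t) *: vecR R k))%:C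
    * rpowC t ((d%:R + 2 * a%:R - s) / 2 - 1) in
  let A := fun (s : R[i]) (n : 'rV[int]_d) =>
    (monomial (alpha *+ 2) (vecR R n))%:C * cintegral `[1, +oo[ (F s n) in
  let B := fun (s : R[i]) (k : 'rV[int]_d) =>
    cintegral `[1, +oo[ (G s k) in
  (forall s : R[i], (d + 2 * a)%:R < complex.Re s ->
     csummable nonzero (zeta_term (alpha *+ 2) s)) /\
  (forall s : R[i],
     [/\ forall n, nonzero n -> cintegrable `[1, +oo[ (F s n),
         csummable nonzero (A s),
         forall k, nonzero k -> cintegrable `[1, +oo[ (G s k) &
         csummable nonzero (B s)]) /\
  exists Z : R[i] -> R[i],
    [/\ forall s : R[i], (d + 2 * a)%:R < complex.Re s ->
          Z s = gen_zeta (alpha *+ 2) s,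
        meromorphic Z,
        pole_of_order Z s0 1,
        forall s, is_pole Z s -> s = s0 &
        forall s : R[i], ~ Gamma_pole (s / 2) -> s != s0 ->
          Gamma (s / 2) / rpowC pi (s / 2) * Z s =
            coef * ((2 * Hermite (alpha *+ 2) (0 : 'rV[R]_d))%:C
                    / (s - d%:R - 2 * a%:R))
            - 2 * (alpha == 0)%:R / s
            + csum nonzero (A s)
            + coef * csum nonzero (B s)].
Proof.
move=> a s0 nonzero coef F G A B.
have cF s n : nonzero n -> cintegrable `[1, +oo[ (F s n).
  move=> n0; have c0 : 0 < enorm (vecR R n) ^+ 2 * pi.
    by rewrite mulr_gt0 ?pi_gt0// exprn_gt0// enorm_vecR_gt0.
  apply: (mellin_integrable (@measurable_ge1R R) (@ge1R_gt0 R)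
    (phi := fun t => expR (- enorm (vecR R n) ^+ 2 * pi * t))).
    apply: (cont_pos_measurable (@measurable_ge1R R) (@ge1R_gt0 R)).
    by under eq_fun do rewrite mulNr; exact: cont_expRM.
  apply: (integ_eq (@measurable_ge1R R) _ (integ_pw_exp_1y (complex.Re (s / 2 - 1)) c0)) => t _.
  by rewrite ger0_norm ?expR_ge0// mulrC !mulNr.
have hA s : has_csum nonzero (A s) (omega_mellin alpha s).
  have [_ _ h] := @omega_csum_1y R d alpha (s / 2 - 1).
  apply: (eq_has_csum _ h) => n n0.
  rewrite /A -(cintegralZ _ (@measurable_ge1R R) (cF s n n0)).
  apply: eq_cintegral => t _.
  by rewrite /F /ltheta_term [X in X * _](rmorphM (real_complex R)) mulrA.
have GE s k t : G s k t = (ltheta_dual_term alpha t k)%:C *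
    rpowC t ((d%:R + 2 * a%:R - s) / 2 - 1).
  by rewrite /G /ltheta_dual_term [X in _ = X * _](rmorphM (real_complex R)).
have hB s : has_csum nonzero (B s) (omega_dual_mellin alpha s).
  have [_ _ h] := @omega_dual_csum_1y R d alpha ((d%:R + 2 * a%:R - s) / 2 - 1).
  apply: (eq_has_csum _ h) => n n0.
  by apply: eq_cintegral => t _; rewrite GE.
split; first by move=> s hs; exists (rpowC pi (s / 2) / Gamma (s / 2) *
    mellin (@posR R) (omega alpha) (s / 2 - 1)); exact: zeta_csum.
split.
  move=> s; split; [exact: cF|by eexists; exact: hA| |by eexists; exact: hB].
  move=> k k0; have [h _ _] := @omega_dual_csum_1y R d alpha ((d%:R + 2 * a%:R - s) / 2 - 1).
  by apply: (eq_cintegrable (@measurable_ge1R R) _ (h k k0)) => t _; rewrite GE.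
exists (zeta_cont alpha); split.
- move=> s hs; rewrite /gen_zeta (csumE (zeta_csum hs)) (mellin_omega_split hs) -/(omega_mellin alpha s) -/(omega_dual_mellin alpha s).
  have sn0 : s != 0.
    by apply/eqP => e; move: hs; rewrite e /= ltNge ler0n.
  rewrite /zeta_cont Gamma_inv_S -!mulrA; congr (_ * _).
  move: (theta_coef _ _)%:C (_ / (s - _ - _)) (omega_mellin _ _) (omega_dual_mellin _ _) (Gamma _)^-1 ((alpha == 0)%:R) => x y u v g e.
  by field.
- move=> z; have [->|zs] := eqVneq z s0; last by left; exact: holomorphic_zeta_cont.
  by right; exists 1%N; exact: pole_zeta_cont.
- exact: pole_zeta_cont.
- move=> s ps; apply/eqP; apply: contrapT => /negP zs.
  by apply: not_pole ps; exact: cdiff_zeta_cont.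
- move=> s sp ss; rewrite (csumE (hA s)) (csumE (hB s)).
  have sn0 : s != 0.
    by apply/eqP => e; apply: sp; exists 0%N; rewrite e mul0r oppr0.
  have g0 := Gamma_neq0 sp.
  have p0 := rpowC_neq0 (pi : R) (s / 2).
  have gS : (Gamma (s / 2 + 1))^-1 = (Gamma (s / 2))^-1 / (s / 2).
    by rewrite (Gamma_inv_S (s / 2)) mulrAC mulfV ?mul1r// mulf_neq0// invr_eq0.
  rewrite /zeta_cont gS /coef -/a.
  move: (theta_coef _ _)%:C (_ / (s - _ - _)) (omega_mellin _ _) (omega_dual_mellin _ _) (Gamma _) (rpowC _ _) ((alpha == 0)%:R) g0 p0 => x y u v g p e g0 p0.
  by field; rewrite g0 p0 sn0.
Qed.
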